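(* Let $d\ge1$ and suppose $V:\mathbb{R}^d\to\mathbb{R}_{\ge0}$ is a smooth $\mathbb{Z}^d$-periodic potential which is uniformly $p$-coercive for some integer $p\ge2$ and has only isolated critical points. Then as $\theta\to0$ (with $\theta>0$): (a) $\mu(B_\theta)=\Omega\big(\theta^{\frac{2p}{p+1}}\big)$ if $d=1,2$; (b) $\mu(B_\theta)=\Omega\big(\theta^{\frac{2p}{p+2}}\big)$ if $d\ge3$; (c) $\mu(B_\theta)=O\big(\theta^{\frac{2p}{p+2}}\big)$ for all $d\ge1$; where the implicit constants depend on $V$.
   Context: $B_\theta:H^2(\mathbb{R}^d)\to L^2(\mathbb{R}^d)$ is $B_\theta g=-\theta^2\Delta g+Vg$, and $\mu(B_\theta)$ is the infimum of its spectrum; equivalently $$\mu(B_\theta)=\inf_{g\in H^2(\mathbb{R}^d),\,\|g\|=1}\int_{\mathbb{R}^d}\theta^2\|\nabla g(x)\|^2+V(x)g(x)^2\,dx.$$ For a multi-index $\alpha\in\mathbb{N}^d$, $D^\alpha=(\partial/\partial x_1)^{\alpha_1}\cdots(\partial/\partial x_d)^{\alpha_d}$. Critical point: $m\in\mathbb{R}^d$ is a critical point of order $p$ of $V$ if $D^\alpha V(m)=0$ for all $\alpha$ with $\|\alpha\|_1\le p-1$ (including $\alpha=0$), and $D^\alpha V(m)\ne0$ for some $\alpha$ with $\|\alpha\|_1=p$. Coercivity: $V$ is $P$-coercive with parameters $(t_0,K,P)$, where $t_0>0$ and $K\ge1$, if for every $t\le t_0$ and $y\in\mathbb{R}^d$,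 $V(y)\le t+\inf V$ implies that there exists a critical point $m$ of some order $p$ with $2\le p\le P$ such that $\|y-m\|\le Kt^{1/p}$. $V$ is uniformly $p$-coercive if it is $p$-coercive (for some $t_0,K$) and all of its critical points have order exactly $p$. $F(\theta)=\Omega(G(\theta))$ as $\theta\to0$ means $F(\theta)\ge cG(\theta)$ for some $c>0$ and all sufficiently small $\theta>0$. *)

(* Defs.v *)
From HB Require Import structures.
From mathcomp Require Import all_boot all_order all_algebra.
From mathcomp Require Import all_classical all_reals all_analysis.

Set Implicit Arguments.
Unset Strict Implicit.
Unset Printing Implicit Defensive.
Import Order.TTheory GRing.Theory Num.Theory.
Import numFieldNormedType.Exports.
Local Open Scope classical_set_scope.
Local Open Scope ring_scope.

(* Row vectors carry the sigma-algebra generated by the coordinates, as tuples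
   do in the library; on [R^d] it is the Borel sigma-algebra. *)

Definition measure_rV_display : measure_display -> measure_display.
Proof. exact. Qed.

Section measurable_rV.
Context {d} {T : measurableType d} (n : nat).

Let coord (i : 'I_n) (x : 'rV[T]_n) : T := x ord0 i.

Let rV_set0 : g_sigma_preimage coord set0.
Proof. exact: sigma_algebra0. Qed.

Let rV_setC A : g_sigma_preimage coord A -> g_sigma_preimage coord (~` A).
Proof. exact: sigma_algebraC. Qed.

Let rV_bigcup (F : (set 'rV[T]_n)^nat) :
  (forall i, g_sigma_preimage coord (F i)) ->
  g_sigma_preimage coord (\bigcup_i (F i)).
Proof. exact: sigma_algebra_bigcup. Qed.

HB.instance Definition _ := @isMeasurable.Build (measure_rV_display d)
  'rV[T]_n (g_sigma_preimage coord) rV_set0 rV_setC rV_bigcup.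

Lemma measurable_coord_rV (i : 'I_n) :
  measurable_fun [set: 'rV[T]_n] (fun x => x ord0 i).
Proof.
move=> _ Y mY; rewrite setTI; apply: sub_sigma_algebra => /=.
rewrite -bigcup_seq/=; exists i => /=; first by rewrite mem_index_enum.
by exists Y => //; rewrite setTI.
Qed.

Lemma measurable_fun_rV d' (T' : measurableType d') (f : T' -> 'rV[T]_n) :
  (forall i, measurable_fun setT (fun x => f x ord0 i)) ->
  measurable_fun setT f.
Proof.
move=> mf; apply: (@measurability _ _ _ _ _ _
  (\big[setU/set0]_(i < n) preimage_set_system setT (coord i) measurable)) => //.
move=> _ [A + <-]; rewrite -bigcup_seq/= => -[i _ [Y mY <-]].
by rewrite !setTI -[X in measurable X]setTI; exact: mf.
Qed.

End measurable_rV.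

Section lebesgue_measure_rV.
Context (R : realType).
Local Open Scope ereal_scope.

Definition cons_rV n (z : R * 'rV[R]_n) : 'rV[R]_n.+1 :=
  \row_i if unlift ord0 i is Some j then z.2 ord0 j else z.1.

Definition uncons_rV n (x : 'rV[R]_n.+1) : R * 'rV[R]_n :=
  (x ord0 ord0, \row_i x ord0 (lift ord0 i)).

Lemma cons_rV0 n (z : R * 'rV[R]_n) : cons_rV z ord0 ord0 = z.1.
Proof. by rewrite mxE unlift_none. Qed.

Lemma cons_rVS n (z : R * 'rV[R]_n) i :
  cons_rV z ord0 (lift ord0 i) = z.2 ord0 i.
Proof. by rewrite mxE liftK. Qed.

Lemma cons_rVK n : cancel (@cons_rV n) (@uncons_rV n).
Proof.
move=> z; rewrite /uncons_rV cons_rV0 [RHS]surjective_pairing; congr pair.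
by apply/rowP => i; rewrite mxE cons_rVS.
Qed.

Lemma measurable_cons_rV n : measurable_fun setT (@cons_rV n).
Proof.
apply: measurable_fun_rV => i; case: (unliftP ord0 i) => [j ->|->].
  under eq_fun do rewrite cons_rVS.
  apply: (@measurableT_comp _ _ _ _ _ _ (fun x : 'rV[R]_n => x ord0 j)) => //.
  exact: measurable_coord_rV.
under eq_fun do rewrite cons_rV0.
exact: measurable_fst.
Qed.

Lemma measurable_uncons_rV n : measurable_fun setT (@uncons_rV n).
Proof.
apply/measurable_fun_pairP; split; first exact: measurable_coord_rV.
apply: measurable_fun_rV => i; under eq_fun do rewrite mxE.
exact: measurable_coord_rV.
Qed.

Section step.
Context (n : nat) (nu : {sigma_finite_measure set 'rV[R]_n -> \bar R}).

Let mpush : {measure set 'rV[R]_n.+1 -> \bar R} :=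
  @measure_function_pushforward__canonical__measure_function_Measure _ _ _ _ _
  (@lebesgue_measure R \x nu) _ (@measurable_cons_rV n).

Definition cons_measure : set 'rV[R]_n.+1 -> \bar R :=
  pushforward (@lebesgue_measure R \x nu) (@cons_rV n).

HB.instance Definition _ := isMeasure.Build _ _ _ cons_measure
  (measure0 mpush) (measure_ge0 mpush) (@measure_semi_sigma_additive _ _ _ mpush).

Let cons_measure_sigma_finite : sigma_finite setT cons_measure.
Proof.
have /sigma_finiteP[F [TF ndF Foo]] :=
  @sigma_finiteT _ _ _ (@lebesgue_measure R).
have /sigma_finiteP[G [TG ndG Goo]] := sigma_finiteT nu.
pose FG k := F k `*` G k.
have mFG k : measurable (FG k).
  by apply: measurableX; [exact: (Foo k).1|exact: (Goo k).1].
exists (fun k => @uncons_rV n @^-1` FG k).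
  apply/esym; rewrite -subTset => x _.
  have [i _ Fi] : (\bigcup_i F i) (uncons_rV x).1 by rewrite -TF.
  have [j _ Gj] : (\bigcup_i G i) (uncons_rV x).2 by rewrite -TG.
  exists (maxn i j) => //; split.
    by move: Fi; exact/subsetPset/ndF/leq_maxl.
  by move: Gj; exact/subsetPset/ndG/leq_maxr.
move=> k; split.
  rewrite -[X in measurable X]setTI.
  exact: (@measurable_uncons_rV n measurableT _ (mFG k)).
rewrite /cons_measure /pushforward -comp_preimage (_ : _ \o _ = id); last first.
  by apply/funext => z; exact: cons_rVK.
rewrite preimage_id product_measure1E//; [|exact: (Foo k).1|exact: (Goo k).1].
have [[? ?] [? ?]] := (Foo k, Goo k).
by rewrite lte_mul_pinfty// ge0_fin_numE.
Qed.

HB.instance Definition _ := @Measure_isSigmaFinite.Build _ _ _ cons_measure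
  cons_measure_sigma_finite.

End step.

Fixpoint lebesgue_rV (d : nat) : {sigma_finite_measure set 'rV[R]_d -> \bar R} :=
  match d with
  | 0%N => \d_(0%R : 'rV[R]_0)
  | n.+1 => cons_measure (lebesgue_rV n)
  end.

(* By uniqueness of the product measure, this characterizes [lebesgue_rV]. *)
Lemma lebesgue_rV_box d (A : 'I_d -> set R) :
  (forall i, measurable (A i)) ->
  lebesgue_rV d [set x | forall i, A i (x ord0 i)] =
  \prod_(i < d) @lebesgue_measure R (A i).
Proof.
elim: d A => [|d IHd] A mA /=.
  by rewrite big_ord0 diracE mem_set//= => -[].
rewrite big_ord_recl /cons_measure /pushforward.
have -> : @cons_rV d @^-1` [set x | forall i, A i (x ord0 i)] =
    A ord0 `*` [set x : 'rV[R]_d | forall i, A (lift ord0 i) (x ord0 i)].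
  apply/seteqP; split=> [z Az|z [Az0 Az] i] /=.
    by split=> [|i] /=; [rewrite -(cons_rV0 z)|rewrite -cons_rVS]; exact: Az.
  by case: (unliftP ord0 i) => [j ->|->]; rewrite ?cons_rV0 ?cons_rVS.
rewrite product_measure1E; [|exact: (mA ord0)|]; first congr (_ * _).
  exact: (IHd (fun i => A (lift ord0 i)) (fun i => mA _)).
have -> : [set x : 'rV[R]_d | forall i, A (lift ord0 i) (x ord0 i)] =
    \big[setI/setT]_(i < d)
      ((fun x : 'rV[R]_d => x ord0 i) @^-1` A (lift ord0 i)).
  by rewrite -bigcap_seq; apply/seteqP; split=> x /= Ax i; [move=> _|];
    apply: Ax; rewrite /= ?mem_index_enum.
apply: bigsetI_measurable => i _; rewrite -[X in measurable X]setTI.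
exact: (@measurable_coord_rV _ _ d i measurableT _ (mA _)).
Qed.

End lebesgue_measure_rV.

Section calculus.
Context (R : realType) (d : nat).
Implicit Types (f g h : 'rV[R]_d -> R) (a : 'I_d -> nat) (x y m : 'rV[R]_d).

Definition enorm x : R := Num.sqrt (\sum_i x ord0 i ^+ 2).

Definition partial (i : 'I_d) f : 'rV[R]_d -> R :=
  fun x => 'D_(delta_mx ord0 i) f x.

Definition partials (s : seq 'I_d) f : 'rV[R]_d -> R := foldr partial f s.

Definition smooth f := forall s : seq 'I_d,
  continuous (partials s f) /\
  forall i x, derivable (partials s f) x (delta_mx ord0 i).

Definition mlength a : nat := (\sum_i a i)%N.

Definition Dmi a f : 'rV[R]_d -> R :=
  foldr (fun i u => iter (a i) (partial i) u) f (enum 'I_d).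

Definition Zd_periodic f := forall x (k : 'rV[int]_d),
  f (x + map_mx intr k) = f x.

(* The condition [0 < p] excludes the degenerate case [p = 0], in which every
   non-zero of [f] would be a critical point; vanishing for
   [mlength a < p] then includes [f m = 0]. *)
Definition critical_point f (p : nat) m :=
  [/\ (0 < p)%N,
      forall a, (mlength a < p)%N -> Dmi a f m = 0 &
      exists2 a, mlength a = p & Dmi a f m <> 0].

Definition critical_points f : set 'rV[R]_d :=
  [set m | exists p, critical_point f p m].

Definition coercive_with f (t0 K : R) (P : nat) :=
  [/\ 0 < t0, 1 <= K &
      forall t y, t <= t0 -> f y <= t + inf (range f) ->
        exists p m, [/\ (2 <= p <= P)%N, critical_point f p m &
                        enorm (y - m) <= K * t `^ p%:R^-1]].

Definition coercive f (P : nat) := exists t0 K, coercive_with f t0 K P.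

Definition uniformly_coercive f (p : nat) :=
  coercive f p /\ forall q m, critical_point f q m -> q = p.

End calculus.

Section schrodinger.
Context (R : realType) (d : nat).
Implicit Types (f g h phi : 'rV[R]_d -> R) (a : 'I_d -> nat).

Local Notation leb := (lebesgue_rV R d).
Local Notation norm2 g := ('N[leb]_2%:E[EFin \o g])%E.

(* Elements of [L^2] and [H^2] are represented by functions, and are compared
   up to equality almost everywhere. *)
Definition L2 : set ('rV[R]_d -> R) := [set g | g \in Lfun leb 2%:E].

Definition test_function phi :=
  smooth phi /\ compact (closure [set x | phi x != 0]).

Definition is_weak_derivative a g h := forall phi, test_function phi ->
  \int[leb]_x (g x * Dmi a phi x) =
  (-1) ^+ mlength a * \int[leb]_x (h x * phi x).

Definition H2 : set ('rV[R]_d -> R) := [set g | L2 g /\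
  forall a, (mlength a <= 2)%N -> exists2 h, L2 h & is_weak_derivative a g h].

(* For [g] in [H2] this is a choice of representative of [D^a g], which is
   unique up to equality almost everywhere. *)
Definition weak_derivative a g : 'rV[R]_d -> R :=
  xget (cst 0) [set h | L2 h /\ is_weak_derivative a g h].

Definition weak_laplacian g : 'rV[R]_d -> R :=
  fun x => \sum_(i < d) weak_derivative (fun j => (2 * (j == i))%N) g x.

Definition schrodinger (theta : R) (V : 'rV[R]_d -> R) g : 'rV[R]_d -> R :=
  fun x => - theta ^+ 2 * weak_laplacian g x + V x * g x.

(* [l] is in the resolvent set of the operator [A : D -> L^2] when [A - l] is
   a bijection from [D] onto [L^2] with a bounded inverse. *)
Definition resolvent_set (D : set ('rV[R]_d -> R))
    (A : ('rV[R]_d -> R) -> ('rV[R]_d -> R)) : set R :=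
  [set l | let Al g := fun x => A g x - l * g x in
    [/\ forall f, L2 f ->
          exists2 g, D g & {ae leb, forall x, Al g x = f x},
        forall g1 g2, D g1 -> D g2 ->
          {ae leb, forall x, Al g1 x = Al g2 x} ->
          {ae leb, forall x, g1 x = g2 x} &
        exists C : R, forall g, D g -> (norm2 g <= C%:E * norm2 (Al g))%E]].

Definition spectrum D A : set R := ~` resolvent_set D A.

(* The infimum is taken in [\bar R], so that no junk value arises if the
   spectrum is empty or unbounded below. *)
Definition mu_B (V : 'rV[R]_d -> R) (theta : R) : \bar R :=
  ereal_inf (EFin @` spectrum H2 (schrodinger theta V)).

End schrodinger.

Definition Omega_at0 (R : realType) (F : R -> \bar R) (G : R -> R) :=
  exists2 c : R, 0 < c & \forall theta \near 0^'+, ((c * G theta)%:E <= F theta)%E.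

Definition O_at0 (R : realType) (F : R -> \bar R) (G : R -> R) :=
  exists C : R, \forall theta \near 0^'+, (`|F theta| <= (C * `|G theta|)%:E)%E.

(* Main.v *)
(* Put t = theta^(2p/(p+2)) and u = theta^(2/(p+2)), so that theta^2 / u^2 = u^p = t.

   Lower bound, in every dimension: by coercivity {V <= t} lies within K u of the
   zeros of V, and by periodicity these are uniformly separated. Hence a translation
   by 3 K u along a coordinate axis moves {V <= t} into {V > t}, and comparing a test
   function with its translate gives t |phi|^2 <= C <(-theta^2 Laplacian + V) phi, phi>.
   Since 2p/(p+1) >= 2p/(p+2), this also yields (a).

   Upper bound: a bump of width u centred at a critical point m has Rayleigh quotient
   O(t), because V(m + h) = O(|h|^p).

   Test functions are a core for the Laplacian (they are dense in the graph of the
   weak Laplacian), so that the infimum of the spectrum is governed by the quadratic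
   form on test functions. *)
From HB Require Import structures.
From mathcomp Require Import all_boot all_order all_algebra.
From mathcomp Require Import all_classical all_reals all_analysis.
From mathcomp Require Import measurable_realfun ring lra.
Require Import Defs.
Set Implicit Arguments.
Unset Strict Implicit.
Unset Printing Implicit Defensive.
Import Order.TTheory GRing.Theory Num.Theory.
Import numFieldNormedType.Exports.
Local Open Scope classical_set_scope.
Local Open Scope ring_scope.

(** * The Hilbert space L^2 *)

(** [mu_B] is defined through the resolvent set, so its link with the quadratic form is proved in
    both directions. If the form of [B - l] dominates [c |phi|^2] on test functions, then
    [c |g| <= |(B - l) g|] on the whole weak graph; the range is closed by this bound, and dense
    because a vector orthogonal to it solves [(B - l) u = 0] weakly. Conversely, the largest [l]
    with a nonnegative form is in the spectrum: a bounded inverse would improve nonnegativity to a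
    strict gap, against maximality.

    The core property amounts to this: a [u] orthogonal to every [phi - lap phi] is null. Mollifying
    [u] would show it; here [u] is first replaced by a nearby test function, and the mollifier by
    averages over translates, which use only the translation invariance of the measure. The same
    invariance gives integration by parts through difference quotients. The identity [|D_j D_i
    phi|^2 = <D_j D_j phi, D_i D_i phi>] then bounds all second derivatives by the Laplacian, so
    that weak solutions lie in [H2]. *)

Lemma half_pow_lt (R : realType) (e : R) : 0 < e -> exists n, 2^-1 ^+ n < e.
Proof.
move=> e0; have h : `|2^-1 : R| < 1 by rewrite ger0_norm// invf_lt1// ltr1n.
have /cvgr0Pnorm_lt/(_ _ e0)[n _ /(_ n (leqnn n))] := cvg_expr h.
by move=> /(le_lt_trans (ler_norm _)); exists n.
Qed.

(** Cauchy-Schwarz for a semidefinite form. It is kept abstract because it serves both for [ip] and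
    for the form of [B - l]. *)
Lemma sqr_form_le (R : realType) (E : lmodType R) (b : E -> E -> R)
    (bC : forall x y, b x y = b y x)
    (bDl : forall x y z, b (x + y) z = b x z + b y z)
    (bZl : forall a x y, b (a *: x) y = a * b x y)
    (b_ge0 : forall x, 0 <= b x x) (x y : E) :
  b x y ^+ 2 <= b x x * b y y.
Proof.
have H a c : 0 <= a ^+ 2 * b x x + 2 * (a * c * b x y) + c ^+ 2 * b y y.
  have := b_ge0 (a *: x + c *: y).
  rewrite bDl !bZl !(bC _ (a *: x + c *: y)) !bDl !bZl (bC y x).
  by congr (0 <= _); ring.
have [y0|y0] := eqVneq (b y y) 0.
  have [->|s0] := eqVneq (b x y) 0; first by rewrite y0 expr0n/= mulr0.
  (* When [b y y = 0] the quadratic is affine in [c]; this choice gives it the negative value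
     [- b x x - 2]. *)
  have := H 1 (- (b x x + 1) / b x y).
  rewrite y0 mulr0 mul1r (divfK s0).
  by have := b_ge0 x; lra.
have := H (b y y) (- b x y); have := b_ge0 y.
by rewrite le_eqVlt eq_sym (negbTE y0)/= => y_gt0 h; rewrite -subr_ge0 -(pmulr_rge0 _ y_gt0); lra.
Qed.

Section L2_type.
Context d (T : measurableType d) (R : realType) (mu : {measure set T -> \bar R}).

(** Functions, not classes modulo equality almost everywhere: [nrm] is only a seminorm, and equality
    in L^2 is expressed by [nrm (f - g) = 0]. *)
Definition L2T := LfunType mu (lee1n 2).
HB.instance Definition _ := GRing.Lmodule.on L2T.

Implicit Types f g h : L2T.

Lemma L2TD f g x : (f + g) x = f x + g x. Proof. by []. Qed.

Lemma L2TN f x : (- f) x = - f x. Proof. by []. Qed.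

Lemma L2TZ a f x : (a *: f) x = a * f x. Proof. by []. Qed.

Definition L2TE := (L2TD, L2TN, L2TZ).

End L2_type.

HB.lock Definition ip d (T : measurableType d) (R : realType)
    (mu : {measure set T -> \bar R}) (f g : L2T mu) : R :=
  \int[mu]_x (f x * g x).
Canonical locked_ip := Unlockable ip.unlock.

HB.lock Definition nrm d (T : measurableType d) (R : realType)
    (mu : {measure set T -> \bar R}) (f : L2T mu) : R := Num.sqrt (ip f f).
Canonical locked_nrm := Unlockable nrm.unlock.

Section L2_space.
Context d (T : measurableType d) (R : realType) (mu : {measure set T -> \bar R}).
Local Notation L2T := (L2T mu).
Implicit Types f g h : L2T.

Lemma ip_def f g : ip f g = \int[mu]_x (f x * g x).
Proof. by rewrite unlock. Qed.

Lemma nrm_def f : nrm f = Num.sqrt (ip f f).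
Proof. by rewrite unlock. Qed.

Lemma measurable_L2T f : measurable_fun setT f.
Proof. by have := LfunP f; rewrite inE => /andP[/[!inE]]. Qed.

Lemma L2T_integrableM f g : mu.-integrable setT (EFin \o (fun x => f x * g x)).
Proof. exact/Lfun1_integrable/Lfun2_mul_Lfun1/LfunP/LfunP. Qed.

Lemma ipC f g : ip f g = ip g f.
Proof. by rewrite !ip_def; apply: eq_Rintegral => x _; rewrite mulrC. Qed.

Lemma ipDl f g h : ip (f + g) h = ip f h + ip g h.
Proof.
rewrite !ip_def -RintegralD//; [|exact: L2T_integrableM..].
by apply: eq_Rintegral => x _; rewrite -mulrDl.
Qed.

Lemma ipZl a f g : ip (a *: f) g = a * ip f g.
Proof.
rewrite !ip_def -RintegralZl//; last exact: L2T_integrableM.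
by apply: eq_Rintegral => x _; rewrite mulrA.
Qed.

Lemma ipDr f g h : ip f (g + h) = ip f g + ip f h.
Proof. by rewrite ipC ipDl !(ipC f). Qed.

Lemma ipZr a f g : ip f (a *: g) = a * ip f g.
Proof. by rewrite ipC ipZl ipC. Qed.

Lemma ipNl f g : ip (- f) g = - ip f g.
Proof. by rewrite -scaleN1r ipZl mulN1r. Qed.

Lemma ipNr f g : ip f (- g) = - ip f g.
Proof. by rewrite ipC ipNl ipC. Qed.

Lemma ipBl f g h : ip (f - g) h = ip f h - ip g h.
Proof. by rewrite ipDl ipNl. Qed.

Lemma ipBr f g h : ip f (g - h) = ip f g - ip f h.
Proof. by rewrite ipDr ipNr. Qed.

Lemma ip0l f : ip 0 f = 0.
Proof. by rewrite -(scale0r 0) ipZl mul0r. Qed.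

Lemma ip_ge0 f : 0 <= ip f f.
Proof. by rewrite ip_def; apply: Rintegral_ge0 => x _; rewrite -expr2 sqr_ge0. Qed.

Lemma nrm_ge0 f : 0 <= nrm f.
Proof. by rewrite nrm_def sqrtr_ge0. Qed.

Lemma sqr_nrm f : nrm f ^+ 2 = ip f f.
Proof. by rewrite nrm_def sqr_sqrtr// ip_ge0. Qed.

Lemma Lfun2P (f : T -> R) : f \in Lfun mu 2%:E <->
  measurable_fun setT f /\ (\int[mu]_x (f x ^+ 2)%:E < +oo)%E.
Proof.
have sqrE x : (`|(EFin \o f) x| `^ 2 = (f x ^+ 2)%:E)%E.
  by rewrite /= powR_mulrn// real_normK ?num_real.
have norm2E : ('N[mu]_2%:E[EFin \o f] `^ 2 = \int[mu]_x (f x ^+ 2)%:E)%E.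
  by rewrite poweR_Lnorm ?pnatr_eq0//; apply: eq_integral => x _; rewrite sqrE.
split=> [fL|[mf foo]].
  split; first by move: fL; rewrite inE => /andP[/[!inE]].
  rewrite -norm2E poweR_lty//.
  by move: fL; rewrite inE => /andP[_]; rewrite inE.
rewrite inE; apply/andP; split; rewrite inE//=.
by rewrite /finite_norm (@lty_poweRy _ _ 2) ?pnatr_eq0// norm2E.
Qed.

Lemma le_Lfun2 (f : T -> R) (g : L2T) : measurable_fun setT f ->
  (forall x, `|f x| <= `|g x|) -> f \in Lfun mu 2%:E.
Proof.
move=> mf fg; apply/Lfun2P; split=> //.
have /Lfun2P[mg] := LfunP g; apply: le_lt_trans.
apply: ge0_le_integral => //.
- by move=> x _; rewrite lee_fin sqr_ge0.
- exact/measurable_EFinP/measurable_funX.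
- exact/measurable_EFinP/measurable_funX.
- move=> x _; rewrite lee_fin -[leLHS]real_normK ?num_real//.
  by rewrite -[leRHS]real_normK ?num_real// lerXn2r ?nnegrE.
Qed.

Lemma ipE f : ((ip f f)%:E = \int[mu]_x (f x ^+ 2)%:E)%E.
Proof.
rewrite ip_def /Rintegral fineK; last first.
  by apply: integrable_fin_num => //; exact: L2T_integrableM.
by apply: eq_integral => x _; rewrite expr2.
Qed.

Lemma Lnorm2E f : ('N[mu]_2%:E[EFin \o f] = (nrm f)%:E)%E.
Proof.
rewrite unlock /Lnorm.
have -> : (\int[mu]_x `|(EFin \o f) x| `^ 2 = (ip f f)%:E)%E.
  rewrite ipE; apply: eq_integral => x _ /=.
  by rewrite powR_mulrn// real_normK ?num_real.
by rewrite nrm_def poweR_EFin powR12_sqrt// ip_ge0.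
Qed.

Lemma nrm_eq0 f : nrm f = 0 -> f = cst 0 %[ae mu].
Proof.
move=> f0; have := Lnorm2E f; rewrite f0 => /Lnorm_eq0_eq0.
move=> H; have /measurable_EFinP/H := measurable_L2T f.
rewrite lte_fin ltr0n => /(_ isT).
by apply: filterS => x /= xfoo /xfoo[].
Qed.

Lemma eq_nrm f g : f = g %[ae mu] -> nrm f = nrm g.
Proof.
move=> fg; rewrite !nrm_def !ip_def; congr Num.sqrt; congr fine; apply: ae_eq_integral => //.
- by have := L2T_integrableM f f => /integrableP[].
- by have := L2T_integrableM g g => /integrableP[].
- by apply: filterS fg => x /= /(_ I) ->.
Qed.

Lemma ip_sqr_le f g : ip f g ^+ 2 <= ip f f * ip g g.
Proof.
apply: (@sqr_form_le _ _ (@ip _ _ _ mu)) => //; [exact: ipC|exact: ipDl|exact: ipZl|].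
exact: ip_ge0.
Qed.

Lemma ip_le f g : ip f g <= nrm f * nrm g.
Proof.
rewrite (le_trans (ler_norm _))// -sqrtr_sqr !nrm_def -sqrtrM ?ip_ge0//.
by rewrite ler_wsqrtr// ip_sqr_le.
Qed.

Lemma normr_ip_le f g : `|ip f g| <= nrm f * nrm g.
Proof.
rewrite -sqrtr_sqr !nrm_def -sqrtrM ?ip_ge0//.
by rewrite ler_wsqrtr// ip_sqr_le.
Qed.

Lemma nrmD f g : nrm (f + g) <= nrm f + nrm g.
Proof.
rewrite -(@ler_pXn2r _ 2)// ?nnegrE ?addr_ge0 ?nrm_ge0//.
rewrite sqr_nrm ipDl !ipDr (ipC g f) sqrrD !sqr_nrm.
by have := ip_le f g; lra.
Qed.

Lemma nrmZ a f : nrm (a *: f) = `|a| * nrm f.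
Proof. by rewrite !nrm_def ipZl ipZr mulrA -expr2 sqrtrM ?sqr_ge0// sqrtr_sqr. Qed.

Lemma nrmN f : nrm (- f) = nrm f.
Proof. by rewrite -scaleN1r nrmZ normrN1 mul1r. Qed.

Lemma nrm0 : nrm (0 : L2T) = 0.
Proof. by rewrite !nrm_def ip0l sqrtr0. Qed.

Lemma nrmB f g : nrm (f - g) <= nrm f + nrm g.
Proof. by rewrite -(nrmN g) nrmD. Qed.

Lemma nrm_sum (I : Type) (r : seq I) (F : I -> L2T) :
  nrm (\sum_(i <- r) F i) <= \sum_(i <- r) nrm (F i).
Proof.
elim/big_ind2 : _ => //; first by rewrite nrm0.
by move=> x a y b xa yb; rewrite (le_trans (nrmD _ _))// lerD.
Qed.

Lemma ip_suml (I : Type) (r : seq I) (F : I -> L2T) g :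
  ip (\sum_(i <- r) F i) g = \sum_(i <- r) ip (F i) g.
Proof.
elim: r => [|i r IH]; first by rewrite !big_nil ip0l.
by rewrite !big_cons ipDl IH.
Qed.

Lemma ip_sumr (I : Type) (r : seq I) (F : I -> L2T) g :
  ip g (\sum_(i <- r) F i) = \sum_(i <- r) ip g (F i).
Proof. by rewrite ipC ip_suml; apply: eq_bigr => i _; exact: ipC. Qed.

(** Riesz-Fischer for a fast Cauchy sequence. The partial sums [W] of the absolute increments have
    norm at most 2, so by monotone convergence their limit is finite almost everywhere, and there
    [u n x] converges absolutely. Fatou gives the rate. *)
Lemma L2T_complete (u : nat -> L2T) :
  (forall n, nrm (u n.+1 - u n) <= 2^-1 ^+ n) ->
  exists f, forall n, nrm (f - u n) <= 2 * 2^-1 ^+ n.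
Proof.
move=> hu.
have half_sum a b : (a <= b)%N ->
    \sum_(a <= i < b) (2^-1 : R) ^+ i <= 2 * 2^-1 ^+ a.
  move=> ab; rewrite (_ : \sum_(a <= i < b) _ = 2 * 2^-1 ^+ a - 2 * 2^-1 ^+ b).
    by rewrite gerBl mulr_ge0// exprn_ge0.
  rewrite (telescope_sumr_eq (fun i => - (2 * 2^-1 ^+ i)))//; first by ring.
  by move=> k _; rewrite exprS; field.
have w_L2 n : (fun x => `|(u n.+1 - u n) x|) \in Lfun mu 2%:E.
  apply: (le_Lfun2 (g := u n.+1 - u n)); last by move=> x; rewrite normr_id.
  by apply: measurableT_comp => //; exact: measurable_L2T.
pose w n : L2T := Lfun_Sub (lee1n 2) (w_L2 n).
have wE n x : w n x = `|(u n.+1 - u n) x| by [].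
pose W N : L2T := \sum_(0 <= i < N) w i.
have WE N x : W N x = \sum_(0 <= i < N) w i x.
  by rewrite /W; elim/big_ind2 : _ => // a b c e <- <-.
have W_ge0 N x : 0 <= W N x by rewrite WE sumr_ge0// => i _; rewrite wE.
have ndW x : {homo (fun N => W N x) : n m / (n <= m)%N >-> n <= m}.
  move=> n m nm; rewrite !WE (big_cat_nat _ nm)//= lerDl sumr_ge0// => i _; rewrite wE.
have nW N : ip (W N) (W N) <= 4.
  rewrite -sqr_nrm (_ : 4 = 2 ^+ 2); last by rewrite -natrX.
  rewrite lerXn2r ?nnegrE ?nrm_ge0// (le_trans (nrm_sum _ _))//.
  have : \sum_(0 <= i < N) (2^-1 : R) ^+ i <= 2.
    by rewrite (le_trans (half_sum 0 N _))// expr0 mulr1.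
  apply: le_trans.
  apply: ler_sum => i _; rewrite (le_trans _ (hu i))//.
  rewrite !nrm_def ler_wsqrtr// !ip_def le_eqVlt; apply/orP; left; apply/eqP.
  by apply: eq_Rintegral => x _; rewrite wE -normrM ger0_norm// -expr2 sqr_ge0.
pose G n x := ((W n x) ^+ 2)%:E.
have mG n : measurable_fun setT (G n).
  exact/measurable_EFinP/measurable_funX/measurable_L2T.
have G_ge0 n x : (0 <= G n x)%E by rewrite lee_fin sqr_ge0.
have ndG x : {homo (fun n => G n x) : n m / (n <= m)%N >-> (n <= m)%E}.
  by move=> n m nm; rewrite lee_fin lerXn2r ?nnegrE ?W_ge0 ?ndW.
have cvgG x : cvgn (fun n => G n x).
  by apply: ereal_nondecreasing_is_cvgn => n m; exact: ndG.
pose Goo x := limn (fun n => G n x).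
have mGoo : measurable_fun setT Goo.
  by apply: (emeasurable_fun_cvg G) => // x _; exact: cvgG.
have Goo_ge0 x : (0 <= Goo x)%E by apply: lime_ge => //; exact: nearW.
have iGoo : mu.-integrable setT Goo.
  apply/integrableP; split=> //.
  under eq_integral do rewrite gee0_abs//.
  have Gcvg := @cvg_monotone_convergence _ _ _ mu _ measurableT G mG
    (fun n x _ => G_ge0 n x) (fun x _ => @ndG x).
  rewrite -(cvg_lim _ Gcvg)//.
  apply: (@le_lt_trans _ _ 4%:E); last exact: ltry.
  apply: lime_le; first by apply/cvg_ex; eexists; exact: Gcvg.
  by apply: nearW => n; rewrite -ipE lee_fin.
pose A := [set x | (Goo x < +oo)%E].
have mA : measurable A.
  by rewrite -[A]setTI; exact: emeasurable_fun_infty_o.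
have aeA : {ae mu, forall x, A x}.
  apply: filterS (integrable_ae measurableT iGoo) => x /(_ I).
  by rewrite ge0_fin_numE.
have cvg_u x : A x -> cvgn (fun n => u n x).
  move=> Ax.
  have GGoo n : (G n x <= Goo x)%E.
    rewrite /Goo (cvg_lim _ (ereal_nondecreasing_cvgn (@ndG x)))//.
    by apply: ereal_sup_ubound; exists n.
  have WB n : W n x <= fine (Goo x) + 1.
    have : W n x ^+ 2 <= fine (Goo x).
      rewrite -lee_fin fineK; first exact: GGoo.
      by rewrite ge0_fin_numE.
    have := W_ge0 n x; nra.
  have /normed_cvg cvgs : cvgn [normed series (telescope (fun n => u n x))].
    apply: nondecreasing_is_cvgn.
      by move=> n m; rewrite /series/=; exact: nondecreasing_series.
    exists (fine (Goo x) + 1) => _ [n _ <-].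
    by rewrite (le_trans _ (WB n))// WE.
  have -> : (fun n => u n x) = cst (u 0%N x) \+ series (telescope (fun n => u n x)).
    by apply/funext => n; exact: eq_sum_telescope.
  by apply: is_cvgD => //; exact: is_cvg_cst.
(* Cut off outside [A], where [u] may diverge, so that the limit exists everywhere and is
   measurable. *)
pose h n x := u n x * \1_A x.
have cvg_h x : cvgn (fun n => h n x).
  rewrite /h indicE; case: (boolP (x \in A)) => [/set_mem/cvg_u Ax|_].
    by under eq_fun do rewrite mulr1.
  by under eq_fun do rewrite mulr0; exact: is_cvg_cst.
pose f x := limn (fun n => h n x).
have mf : measurable_fun setT f.
  apply: (measurable_fun_cvg (h := h)) => [n|x _]; last exact: cvg_h.
  by apply: measurable_funM; [exact: measurable_L2T|exact: measurable_indic].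
have fE x : A x -> u ^~ x @ \oo --> f x.
  move=> Ax; rewrite /f (_ : h ^~ x = u ^~ x); last first.
    by apply/funext => n; rewrite /h indicE mem_set// mulr1.
  exact: cvg_u.
have fu n : (\int[mu]_x ((f x - u n x) ^+ 2)%:E <= ((2 * 2^-1 ^+ n) ^+ 2)%:E)%E.
  pose F m x := ((u (m + n)%N x - u n x) ^+ 2)%:E.
  have mF m : measurable_fun setT (F m).
    apply/measurable_EFinP/measurable_funX.
    by apply: measurable_funB; exact: measurable_L2T.
  have F_ge0 m x : (0 <= F m x)%E by rewrite lee_fin sqr_ge0.
  have -> : (\int[mu]_x ((f x - u n x) ^+ 2)%:E =
      \int[mu]_x limn_einf (F ^~ x))%E.
    apply: ae_eq_integral => //.
    - apply/measurable_EFinP/measurable_funX.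
      by apply: measurable_funB => //; exact: measurable_L2T.
    - apply: (emeasurable_fun_cvg (fun m x => einfs (F ^~ x) m)) => [m|x _].
        exact: measurable_fun_einfs.
      by rewrite limn_einf_lim; exact: is_cvg_einfs.
    - apply: filterS aeA => x Ax _; apply/esym.
      apply: (cvg_limn_einf_sup _).1; apply: cvg_EFin; first exact: nearW.
      have ufx : (fun m => u (m + n)%N x) @ \oo --> f x.
        by have := fE _ Ax; rewrite -(cvg_shiftn n).
      rewrite expr2 (_ : fine \o _ = fun m =>
        (u (m + n)%N x - u n x) * (u (m + n)%N x - u n x)).
        by apply: cvgM; apply: cvgB => //; exact: cvg_cst.
      by apply/funext => m; rewrite -expr2.
  apply: (le_trans (fatou mu measurableT mF (fun m x _ => F_ge0 m x))).
  rewrite limn_einf_lim; apply: lime_le; first exact: is_cvg_einfs.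
  apply: nearW => m; apply: (@le_trans _ _ (\int[mu]_x F m x)%E).
    by apply: ereal_inf_lbound; exists m => //=.
  rewrite -(ipE (u (m + n)%N - u n)) lee_fin -sqr_nrm.
  rewrite lerXn2r ?nnegrE ?nrm_ge0 ?mulr_ge0 ?exprn_ge0 ?invr_ge0//.
  rewrite -(telescope_sumr u (leq_addl m n)) (le_trans (nrm_sum _ _))//.
  by rewrite (le_trans _ (half_sum _ _ (leq_addl m n)))// ler_sum.
(* Fatou controls only the differences [f - u n]; [f] enters L^2 as [(f - u 0) + u 0]. *)
have fu0 : f - u 0%N \in Lfun mu 2%:E.
  apply/Lfun2P; split; last exact: le_lt_trans (fu 0%N) (ltry _).
  by apply: measurable_funB => //; exact: measurable_L2T.
pose g : L2T := Lfun_Sub (lee1n 2) fu0 + u 0%N.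
exists g => n.
rewrite -(@ler_pXn2r _ 2)// ?nnegrE ?nrm_ge0 ?mulr_ge0 ?exprn_ge0 ?invr_ge0//.
rewrite sqr_nrm -lee_fin ipE; apply: le_trans (fu n).
rewrite le_eqVlt; apply/orP; left; apply/eqP; apply: eq_integral => x _.
by rewrite [(g - u n) x](_ : _ = f x - u 0%N x + u 0%N x - u n x)// subrK.
Qed.

(** The projection argument: a minimizing sequence in [X] is Cauchy by the parallelogram law, and
    the residual of [f] at its limit is orthogonal to [X], hence null. *)
Lemma orthogonal_dense (X : set L2T) :
  X 0 -> (forall a x y, X x -> X y -> X (a *: x + y)) ->
  (forall u, (forall x, X x -> ip u x = 0) -> nrm u = 0) ->
  forall f e, 0 < e -> exists2 x, X x & nrm (f - x) < e.
Proof.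
move=> X0 XD Xperp f e e0.
pose S := [set nrm (f - x) ^+ 2 | x in X].
pose delta := inf S.
have S0 : S !=set0 by exists (nrm (f - 0) ^+ 2); exists 0.
have lbS : has_lbound S by exists 0 => _ [x _ <-]; rewrite exprn_ge0 ?nrm_ge0.
have delta_le x : X x -> delta <= nrm (f - x) ^+ 2.
  by move=> Xx; apply: ge_inf => //; exists x.
have delta_ge0 : 0 <= delta.
  by apply: lb_le_inf => // _ [x _ <-]; rewrite exprn_ge0 ?nrm_ge0.
have half_gt0 n : 0 < (2^-1 : R) ^+ n by rewrite exprn_gt0.
(* With this tolerance the parallelogram law gives [|x n.+1 - x n|^2 <= 5/8 * (2^-1 ^+ n) ^+ 2],
   within the reach of [L2T_complete]. *)
have /choice[x Xx] : forall n, exists x, X x /\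
    nrm (f - x) ^+ 2 < delta + (2^-1 ^+ n / 2) ^+ 2.
  move=> n; have en : 0 < (2^-1 ^+ n / 2 : R) ^+ 2 by rewrite exprn_gt0// divr_gt0.
  by have [_ [z Xz <-] zd] := inf_adherent en (conj S0 lbS); exists z.
have [y yx] : exists y, forall n, nrm (y - x n) <= 2 * 2^-1 ^+ n.
  apply: L2T_complete => n.
  rewrite -(@ler_pXn2r _ 2)// ?nnegrE ?nrm_ge0 ?exprn_ge0//.
  have XZ a z : X z -> X (a *: z).
    by move=> Xz; rewrite -[_ *: z]addr0; exact: XD.
  have := delta_le (2^-1 *: x n.+1 + 2^-1 *: x n)
    (XD _ _ _ (Xx n.+1).1 (XZ _ _ (Xx n).1)).
  have -> : f - (2^-1 *: x n.+1 + 2^-1 *: x n) =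
      2^-1 *: ((f - x n.+1) + (f - x n)).
    by apply/LfuneqP => t; rewrite !L2TE; field.
  rewrite nrmZ (_ : x n.+1 - x n = (f - x n) - (f - x n.+1)); last first.
    by apply/LfuneqP => t; rewrite !L2TE; ring.
  have [_] := Xx n.+1; have [_] := Xx n; rewrite (exprS _ n) !sqr_nrm.
  have := half_gt0 n; move: (2^-1 ^+ n) (f - x n) (f - x n.+1) => q a b q0.
  rewrite [(_ * nrm _) ^+ 2]exprMn ger0_norm// !sqr_nrm !(ipDl, ipDr, ipNl, ipNr) (ipC b a).
  by nra.
have lim_le (a b : R) : (forall n, a <= b + 5 * 2^-1 ^+ n) -> a <= b.
  move=> ab; apply/ler_addgt0Pr => c c0.
  have [n /ltW nc] := half_pow_lt (divr_gt0 c0 (ltr0n R 5)).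
  by rewrite (le_trans (ab n))// lerD2l mulrC -ler_pdivlMr.
pose r := f - y; pose s := Num.sqrt delta.
have s_ge0 : 0 <= s by exact: sqrtr_ge0.
have sE : s ^+ 2 = delta by rewrite sqr_sqrtr.
(* The limit [y] need not belong to [X], so minimality is compared with [x n], at a total cost below
   [5 * 2^-1 ^+ n]. *)
have r_min t z : X z -> nrm r <= nrm (r - t *: z).
  move=> Xz; apply: lim_le => n.
  have h1 : nrm r <= nrm (f - x n) + 2 * 2^-1 ^+ n.
    rewrite (_ : r = (f - x n) - (y - x n)); last first.
      by rewrite opprB addrA subrK.
    by rewrite (le_trans (nrmB _ _))// lerD2l.
  have h2 : nrm (f - x n) <= s + 2^-1 ^+ n / 2.
    rewrite -(@ler_pXn2r _ 2)// ?nnegrE ?nrm_ge0//; last first.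
      by rewrite addr_ge0// divr_ge0// ltW.
    rewrite (le_trans (ltW (Xx n).2))// sqrrD -sE.
    by have := half_gt0 n; set q := 2^-1 ^+ n => q0; nra.
  have h3 : s <= nrm (r - t *: z) + 2 * 2^-1 ^+ n.
    rewrite (le_trans (_ : s <= nrm (f - (t *: z + x n))))//.
      rewrite -(@ler_pXn2r _ 2)// ?nnegrE ?nrm_ge0// sE.
      by apply: delta_le; apply: XD => //; exact: (Xx n).1.
    rewrite (_ : f - _ = (r - t *: z) + (y - x n)); last first.
      by apply/LfuneqP => t'; rewrite !L2TE; ring.
    by rewrite (le_trans (nrmD _ _))// lerD2l.
  have := half_gt0 n; lra.
have rE : r = f - y by [].
clearbody r.
have r0 : nrm r = 0.
  apply: Xperp => z Xz.
  have h t : 0 <= t ^+ 2 * ip z z - 2 * (t * ip r z).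
    have := r_min t z Xz; rewrite -(@ler_pXn2r _ 2)// ?nnegrE ?nrm_ge0//.
    rewrite !sqr_nrm ipBl !ipBr !(ipZl, ipZr) (ipC z r); lra.
  have z_ge0 := ip_ge0 z.
  (* Nearly the optimal step [(ip z z)^-1], without division by zero; at [t = ip r z * c] the
     quadratic equals [- (ip r z)^2 * c * (1 + c)]. *)
  pose c := (ip z z + 1)^-1.
  have c0 : 0 < c by rewrite invr_gt0 ltr_wpDl.
  have cE : ip z z * c = 1 - c.
    by rewrite /c; field; rewrite gt_eqF// ltr_wpDl.
  have := h (ip r z * c).
  rewrite (_ : _ - _ = ip r z ^+ 2 * c * (ip z z * c - 2)); last by ring.
  rewrite cE => h'; have [//|a0] := eqVneq (ip r z) 0.
  have a2 : 0 < ip r z ^+ 2 by rewrite lt_def sqrf_eq0 a0 sqr_ge0.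
  have := mulr_gt0 (mulr_gt0 a2 c0) (addr_gt0 ltr01 c0); lra.
have [n ne] := half_pow_lt (divr_gt0 e0 (ltr0n R 2)).
exists (x n); first exact: (Xx n).1.
rewrite (_ : f - x n = r + (y - x n)); last by rewrite rE addrA subrK.
rewrite (le_lt_trans (nrmD _ _))// r0 add0r (le_lt_trans (yx n))//.
by rewrite mulrC -ltr_pdivlMr.
Qed.

End L2_space.

(** * Lebesgue measure on R^d *)

Lemma rV_norm_le (R : realType) d (x : 'rV[R]_d) (c : R) :
  0 <= c -> (forall i, `|x ord0 i| <= c) -> `|x| <= c.
Proof.
move=> c0 xc; rewrite /Num.norm/= mx_normrE; apply: bigmax_le => // -[i j] _ /=.
by rewrite ord1.
Qed.

Lemma rV_norm_ge (R : realType) d (x : 'rV[R]_d) i : `|x ord0 i| <= `|x|.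
Proof.
rewrite [leRHS]/Num.norm/= mx_normrE.
exact: (le_bigmax _ (fun ij : 'I_1 * 'I_d => `|x ij.1 ij.2|) (ord0, i)).
Qed.

Section lebesgue_rV_theory.
Context (R : realType) (d : nat).
Local Notation leb := (lebesgue_rV R d).
Implicit Types (a b x y v : 'rV[R]_d).

Definition obox a b : set 'rV[R]_d :=
  [set x | forall i, a ord0 i < x ord0 i < b ord0 i].

Definition oboxes : set (set 'rV[R]_d) := range (fun ab => obox ab.1 ab.2).

Lemma oboxE a b :
  obox a b = \bigcap_i [set x | x ord0 i \in `]a ord0 i, b ord0 i[].
Proof.
apply/seteqP; split=> x /= xab i => [_|]; rewrite ?in_itv//=.
  exact: xab.
by have := xab i I; rewrite /= in_itv.
Qed.

Lemma measurable_obox a b : measurable (obox a b).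
Proof.
rewrite oboxE; apply: fin_bigcap_measurable => // i _.
rewrite -[X in measurable X]setTI.
by apply: (@measurable_coord_rV _ _ d i measurableT `]a ord0 i, b ord0 i[%classic).
Qed.

Lemma oboxI a b a' b' : obox a b `&` obox a' b' =
  obox (\row_i Num.max (a ord0 i) (a' ord0 i))
       (\row_i Num.min (b ord0 i) (b' ord0 i)).
Proof.
apply/seteqP; split=> x /=.
  move=> [xab xab'] i; rewrite !mxE gt_max lt_min.
  by have /andP[-> ->] := xab i; have /andP[-> ->] := xab' i.
move=> h; split=> i; have := h i; rewrite !mxE gt_max lt_min;
  by case/andP=> /andP[h1 h2] /andP[h3 h4]; apply/andP.
Qed.

Lemma bigcup_obox : \bigcup_n obox (const_mx (- n%:R)) (const_mx n%:R) = setT.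
Proof.
apply/seteqP; split=> // x _.
exists (Num.truncn (\sum_i `|x ord0 i|)).+1 => // i; rewrite !mxE -ltr_norml.
apply: le_lt_trans (truncnS_gt _).
by rewrite (bigD1 i)//= lerDl sumr_ge0.
Qed.

(** A half-space [c < x_i] is the union of boxes that grow in every other direction, so boxes
    generate the coordinate sigma-algebra. *)
Lemma measurable_oboxE : measurable = <<s oboxes >>.
Proof.
apply/seteqP; split; last first.
  apply: smallest_sub => //; first exact: sigma_algebra_measurable.
  by move=> _ [[a b] _ <-]; exact: measurable_obox.
apply: smallest_sub; first exact: smallest_sigma_algebra.
move=> X; rewrite -bigcup_seq => -[i _ [Y mY <-]]; rewrite setTI.
have mi : measurable_fun (setT : set (g_sigma_algebraType oboxes))
    (fun x => (x : 'rV[R]_d) ord0 i).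
  apply: (measurability _ (RGenOInfty.measurableE R)) => _ [_ [c ->] <-].
  rewrite setTI (_ : _ @^-1` _ = \bigcup_n (obox
    (\row_j if j == i then c else - n%:R) (const_mx n%:R))); last first.
    apply/seteqP; split=> x /=.
      rewrite in_itv/= andbT => cx.
      have : setT x by []. rewrite -bigcup_obox => -[n _ xn].
      exists n => // j; have := xn j; rewrite !mxE.
      by case: eqVneq => // -> /andP[_ ->]; rewrite cx.
    by move=> [n _ xn]; have := xn i; rewrite !mxE eqxx in_itv/= andbT => /andP[].
  apply: bigcupT_measurable => n; apply: sub_sigma_algebra.
  by eexists (_, _).
by rewrite -[X in <<s _ >> X]setTI; exact: mi.
Qed.

(** Boxes are stable under intersection and exhaust the space. This serves twice: for translation
    invariance, and to identify the positive and negative parts of a function orthogonal to all test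
    functions. *)
Lemma obox_measure_unique (m1 m2 : {measure set 'rV[R]_d -> \bar R}) :
  (forall a b, m1 (obox a b) = m2 (obox a b)) ->
  (forall a b, m1 (obox a b) < +oo)%E ->
  forall A, measurable A -> m1 A = m2 A.
Proof.
move=> m12 m1oo; apply: (measure_unique oboxes
  (fun n => obox (const_mx (- n%:R)) (const_mx n%:R))) => //.
- exact: measurable_oboxE.
- by move=> _ _ [[a b] _ <-] [[a' b'] _ <-]; rewrite oboxI; eexists (_, _).
- by move=> n; exists (const_mx (- n%:R), const_mx n%:R).
- exact: bigcup_obox.
- by move=> _ [[a b] _ <-]; exact: m12.
Qed.

Lemma lebesgue_rV_obox a b :
  leb (obox a b) = (\prod_(i < d) Num.max 0 (b ord0 i - a ord0 i))%:E.
Proof.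
have -> : obox a b =
    [set x | forall i, `]a ord0 i, b ord0 i[%classic (x ord0 i)].
  by apply/seteqP; split=> x xab i; have := xab i; rewrite /= in_itv.
rewrite (@lebesgue_rV_box R d (fun i => `]a ord0 i, b ord0 i[%classic)) => [|i].
  2: exact: measurable_itv.
rewrite -prodEFin; apply: eq_bigr => i _.
rewrite lebesgue_measure_itv/= lte_fin; case: ltP => ab; congr (_%:E).
  by rewrite max_r// subr_ge0 ltW.
by rewrite max_l// subr_le0.
Qed.

Lemma lebesgue_rV_obox_lty a b : (leb (obox a b) < +oo)%E.
Proof. by rewrite lebesgue_rV_obox ltry. Qed.

Lemma measurable_translation v : measurable_fun [set: 'rV[R]_d] (fun x => x + v).
Proof.
apply: measurable_fun_rV => i; under eq_fun do rewrite mxE.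
by apply: measurable_funD => //; exact: measurable_coord_rV.
Qed.

Lemma translate_obox a b v :
  (fun x => x + v) @^-1` obox a b = obox (a - v) (b - v).
Proof.
by apply/seteqP; split=> x /= xab i; have := xab i; rewrite !mxE ltrBlDr ltrBrDr.
Qed.

Lemma lebesgue_rV_translation v A : measurable A ->
  pushforward leb (fun x => x + v) A = leb A.
Proof.
pose m := @measure_function_pushforward__canonical__measure_function_Measure
  _ _ _ _ _ leb _ (measurable_translation v).
move: A; apply: (@obox_measure_unique m leb) => a b.
  rewrite /m/= /pushforward translate_obox !lebesgue_rV_obox; congr (_%:E).
  by apply: eq_bigr => i _; rewrite !mxE; congr Num.max; ring.
by rewrite /m/= /pushforward translate_obox lebesgue_rV_obox_lty.
Qed.

Lemma integral_translation (f : 'rV[R]_d -> \bar R) v :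
  measurable_fun setT f -> (forall x, (0 <= f x)%E) ->
  (\int[leb]_x f (x + v)%R = \int[leb]_x f x)%E.
Proof.
move=> mf f0.
pose m := @measure_function_pushforward__canonical__measure_function_Measure
  _ _ _ _ _ leb _ (measurable_translation v).
have -> : (\int[leb]_x f x = \int[m]_x f x)%E.
  by apply: eq_measure_integral => A mA _; apply/esym/lebesgue_rV_translation.
by rewrite ge0_integral_pushforward//; exact: measurable_translation.
Qed.

Lemma Rintegral_translation (f : 'rV[R]_d -> R) v : measurable_fun setT f ->
  \int[leb]_x f (x + v) = \int[leb]_x f x.
Proof.
move=> /measurable_EFinP mf; congr fine; rewrite integralE [RHS]integralE.
congr (_ - _)%E.
  rewrite -[RHS](integral_translation v (measurable_funepos mf))//.
  by apply: eq_integral => x _; rewrite !funeposE.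
rewrite -[RHS](integral_translation v (measurable_funeneg mf))//.
by apply: eq_integral => x _; rewrite !funenegE.
Qed.

(** Balls of the sup norm are boxes, so an open set is the union of the countably many boxes with
    rational centre and radius [2^-1 ^+ k] that it contains. *)
Lemma open_measurable_rV (U : set 'rV[R]_d) : open U -> measurable U.
Proof.
rewrite openE => oU.
pose bx (qk : 'rV[rat]_d * nat) : set 'rV[R]_d :=
  obox (\row_i (ratr (qk.1 ord0 i) - 2^-1 ^+ qk.2))
       (\row_i (ratr (qk.1 ord0 i) + 2^-1 ^+ qk.2)).
rewrite (_ : U = \bigcup_qk (if `[< bx qk `<=` U >] then bx qk else set0)).
  apply: countable_bigcupT_measurable; first exact: countableP.
  by move=> qk; case: ifPn => // _; exact: measurable_obox.
apply/seteqP; split=> x; last first.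
  by move=> [qk _]; case: asboolP => // bU /bU.
move=> Ux; have /nbhs_ballP[e /= e0 eU] := oU _ Ux.
have [k ke] := half_pow_lt (divr_gt0 e0 (ltr0n R 2)).
have k0 : 0 < (2^-1 : R) ^+ k by rewrite exprn_gt0.
have /choice[q qx] i : exists q : rat, `|x ord0 i - ratr q| < 2^-1 ^+ k.
  have [|q] := @rat_in_itvoo R (x ord0 i - 2^-1 ^+ k) (x ord0 i + 2^-1 ^+ k).
    by rewrite ltrD2l gtrN.
  by rewrite in_itv/= => xq; exists q; rewrite distrC ltr_distl.
pose qk := (\row_i q i : 'rV[rat]_d, k).
have bxU : bx qk `<=` U.
  move=> y /= bxy; apply: eU; rewrite mx_norm_ball /ball_/=.
  rewrite (@le_lt_trans _ _ (2^-1 ^+ k + 2^-1 ^+ k))//; last first.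
    by rewrite [ltRHS]splitr ltrD.
  apply: rV_norm_le => [|i]; first by rewrite addr_ge0// ltW.
  have := qx i; have := bxy i; rewrite !mxE -ltr_distl => h1 h2.
  rewrite (_ : _ - _ = (x ord0 i - ratr (q i)) - (y ord0 i - ratr (q i))); last by ring.
  by rewrite (le_trans (ler_normB _ _))// lerD ?ltW.
exists qk => //; rewrite asboolT// => i; rewrite !mxE.
by have := qx i; rewrite ltr_distl.
Qed.

Lemma continuous_measurable_rV (f : 'rV[R]_d -> R) :
  continuous f -> measurable_fun setT f.
Proof.
move=> /continuousP cf; apply: (measurability _ (RGenOpens.measurableE R)).
move=> _ [_ [a [b ->]] <-]; rewrite setTI; apply: open_measurable_rV.
by apply: cf; exact: interval_open.
Qed.

End lebesgue_rV_theory.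

(** * Smooth functions *)

Section smooth_functions.
Context (R : realType) (d : nat).
Implicit Types (f g : 'rV[R]_d -> R) (x : 'rV[R]_d).

Local Notation e_ i := (delta_mx ord0 i : 'rV[R]_d).

Lemma is_derive_line f i x t : (forall y, derivable f y (e_ i)) ->
  is_derive t (1 : R) (fun s : R => f (x + s *: e_ i)) (partial i f (x + t *: e_ i)).
Proof.
move=> df; have E : (fun h : R => h^-1 *: (((fun s : R => f (x + s *: e_ i)) \o shift t) (h *: 1)
      - f (x + t *: e_ i))) =
    (fun h : R => h^-1 *: ((f \o shift (x + t *: e_ i)) (h *: e_ i)
      - f (x + t *: e_ i))).
  apply/funext => h /=; congr (_ *: (f _ - _)).
  by rewrite [h *: 1]mulr1 scalerDl addrCA addrC addrAC.
split; first by rewrite /derivable E; exact: df.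
by rewrite /derive E.
Qed.

Lemma continuous_line f i x : (forall y, derivable f y (e_ i)) ->
  continuous (fun s : R => f (x + s *: e_ i)).
Proof.
move=> df t; apply: differentiable_continuous.
by apply/derivable1_diffP; have [] := is_derive_line x t df.
Qed.

Lemma partial_MVT f i x t : (forall y, derivable f y (e_ i)) ->
  exists2 s, `|s| <= `|t| &
    f (x + t *: e_ i) - f x = t * partial i f (x + s *: e_ i).
Proof.
move=> df.
have der (a b : R) c : c \in `]a, b[%R ->
    is_derive c 1 (fun s : R => f (x + s *: e_ i)) (partial i f (x + c *: e_ i)).
  by move=> _; exact: is_derive_line.
have cont (a b : R) : {within `[a, b], continuous (fun s : R => f (x + s *: e_ i))}.
  by apply: continuous_subspaceT; exact: continuous_line.
have [t0|t0] := leP 0 t.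
  have [c] := MVT_segment t0 (@der 0 t) (@cont 0 t).
  rewrite in_itv/= => /andP[c0 ct]; rewrite scale0r addr0 subr0 mulrC => ->.
  by exists c => //; rewrite !ger0_norm.
have [c] := MVT_segment (ltW t0) (@der t 0) (@cont t 0).
rewrite in_itv/= => /andP[c0 ct]; rewrite scale0r addr0 sub0r => ctE.
exists c; first by rewrite !ler0_norm ?lerN2// ltW.
by rewrite -opprB ctE mulrN opprK mulrC.
Qed.

Lemma partialD i f g x : derivable f x (e_ i) -> derivable g x (e_ i) ->
  partial i (f + g) x = partial i f x + partial i g x.
Proof. exact: deriveD. Qed.

Lemma partialZ i a f x : derivable f x (e_ i) ->
  partial i (a *: f) x = a * partial i f x.
Proof. by move=> df; rewrite /partial deriveZ. Qed.

Lemma partialM i f g x : derivable f x (e_ i) -> derivable g x (e_ i) ->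
  partial i (f * g) x = partial i f x * g x + f x * partial i g x.
Proof. move=> df dg; have H := deriveM df dg.
rewrite addrC (mulrC (partial i f x)) /partial H; reflexivity. Qed.

(** Graded form of [smooth]: derivatives of order up to [n] are continuous and derivable. Closure
    under products then goes by induction on [n], without a formula for the iterated derivatives of
    a product. *)
Fixpoint smoothn n f : Prop :=
  [/\ continuous f, forall i x, derivable f x (e_ i) &
      if n is m.+1 then forall i, smoothn m (partial i f) else True].

Lemma smoothnW n f : smoothn n.+1 f -> smoothn n f.
Proof.
elim: n f => [|n IH] f; first by case.
by case=> cf df pf; split=> // i; exact/IH/pf.
Qed.

Lemma smooth_partial f i : smooth f -> smooth (partial i f).
Proof. by move=> sf s; have := sf (rcons s i); rewrite /partials foldr_rcons. Qed.

Lemma smoothnP f : smooth f <-> forall n, smoothn n f.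
Proof.
split=> [sf n|].
  elim: n f sf => [|n IH] f sf; have [cf df] := sf [::]; split=> // i.
  exact/IH/smooth_partial.
(* In [partials s f] the last index is differentiated first, hence the induction from the right. *)
move=> sf s; elim/last_ind: s f sf => [|s i IH] f sf.
  by have [] := sf 0%N.
rewrite /partials foldr_rcons; apply: IH => n.
by have [_ _] := sf n.+1; apply.
Qed.

Lemma smoothn_cst n a : smoothn n (cst a).
Proof.
elim: n a => [|n IH] a; split=> //; try by move=> x; exact: cst_continuous.
move=> i; rewrite (_ : partial i _ = cst 0); first exact: IH.
by apply/funext => x; exact: derive_cst.
Qed.

Lemma smoothnD n f g : smoothn n f -> smoothn n g -> smoothn n (f + g).
Proof.
elim: n f g => [|n IH] f g [cf df pf] [cg dg pg]; split.
- by move=> x; exact: (continuousD (cf x) (cg x)).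
- by move=> i x; exact: (derivableD (df i x) (dg i x)).
- by [].
- by move=> x; exact: (continuousD (cf x) (cg x)).
- by move=> i x; exact: (derivableD (df i x) (dg i x)).
- move=> i; rewrite (_ : partial i _ = partial i f + partial i g).
    by apply: IH; [exact: pf|exact: pg].
  by apply/funext => x; exact: (partialD (df i x) (dg i x)).
Qed.

Lemma smoothnM n f g : smoothn n f -> smoothn n g -> smoothn n (f * g).
Proof.
elim: n f g => [|n IH] f g sf sg; have [cf df pf] := sf; have [cg dg pg] := sg; split.
- by move=> x; exact: (continuousM (cf x) (cg x)).
- by move=> i x; exact: (derivableM (df i x) (dg i x)).
- by [].
- by move=> x; exact: (continuousM (cf x) (cg x)).
- by move=> i x; exact: (derivableM (df i x) (dg i x)).
- move=> i; rewrite (_ : partial i _ = partial i f * g + f * partial i g).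
    apply: smoothnD; apply: IH; [exact: pf|exact: smoothnW|exact: smoothnW|exact: pg].
  by apply/funext => x; exact: (partialM (df i x) (dg i x)).
Qed.

Lemma smoothnZ n a f : smoothn n f -> smoothn n (a *: f).
Proof. by move=> sf; have := smoothnM (smoothn_cst n a) sf. Qed.

Lemma smoothn_prod n (I : Type) (r : seq I) (F : I -> 'rV[R]_d -> R) :
  (forall i, smoothn n (F i)) -> smoothn n (fun x => \prod_(i <- r) F i x).
Proof.
move=> sF; elim: r => [|i r IH].
  by under eq_fun do rewrite big_nil; exact: smoothn_cst.
by under eq_fun do rewrite big_cons; exact: (smoothnM (sF i) IH).
Qed.

Lemma coord_line_continuous (w : R -> R) i :
  continuous w -> continuous (fun x : 'rV[R]_d => w (x ord0 i)).
Proof.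
move=> cw x; apply: (@continuous_comp _ _ _ (fun x : 'rV[R]_d => x ord0 i) w).
  exact: coord_continuous.
exact: cw.
Qed.

Lemma is_derive_coord (w : R -> R) w' i j x :
  is_derive (x ord0 i) 1 w w' ->
  is_derive x (e_ j) (fun x : 'rV[R]_d => w (x ord0 i)) ((j == i)%:R * w').
Proof.
move=> dw.
have [->|ji] := eqVneq j i; last first.
  rewrite mul0r.
  have E : (fun h : R => h^-1 *: (((fun x : 'rV[R]_d => w (x ord0 i)) \o shift x)
      (h *: e_ j) - w (x ord0 i))) = cst 0.
    apply/funext => h /=; rewrite !mxE eqxx eq_sym (negbTE ji) mulr0 add0r.
    by rewrite subrr scaler0.
  split; first by rewrite /derivable E; exact: is_cvg_cst.
  by rewrite /derive E; exact: lim_cst.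
rewrite mul1r.
have E : (fun h : R => h^-1 *: (((fun x : 'rV[R]_d => w (x ord0 i)) \o shift x) (h *: e_ i)
      - w (x ord0 i))) =
    (fun h : R => h^-1 *: ((w \o shift (x ord0 i)) (h *: 1) - w (x ord0 i))).
  by apply/funext => h /=; rewrite !mxE !eqxx.
by split; [rewrite /derivable E|rewrite /derive E]; case: dw.
Qed.

End smooth_functions.

(** * Smooth bumps supported in a box *)

Section bump.
Context (R : realType).
Implicit Types (s t a b : R) (k : nat).

(* The powers [t^-1 ^+ k] make the family closed under differentiation, so that
   smoothness is proved for all [k] at once. *)
Definition bumpf s k t : R := if 0 < t then t^-1 ^+ k * expR (- s * t^-1) else 0.

Lemma bumpf_ge0 s k t : 0 <= bumpf s k t.
Proof.
rewrite /bumpf; case: ifPn => // t0.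
by rewrite mulr_ge0 ?expR_ge0// exprn_ge0// invr_ge0 ltW.
Qed.

(** This is [y ^+ k / k! <= expR y] at [y = s / t], uniformly in [t]. *)
Lemma bumpf_le s k t : 0 < s -> bumpf s k t <= k`!%:R / s ^+ k.
Proof.
move=> s0; rewrite /bumpf; case: ifPn => [t0|_]; last first.
  by rewrite divr_ge0// exprn_ge0// ltW.
have y0 : 0 < t^-1 by rewrite invr_gt0.
rewrite mulNr expRN ler_pdivrMr ?expR_gt0// mulrAC ler_pdivlMr ?exprn_gt0//.
rewrite -exprMn mulrC; case: k => [|k].
  by rewrite fact0 mul1r expr0 ltW// expR_gt1 mulr_gt0// mulrC.
have := @expR_ge1Dxn R (s * t^-1) k (ltW (mulr_gt0 s0 y0)).
have f0 : 0 < (k.+1)`!%:R :> R by rewrite ltr0n fact_gt0.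
move=> h.
by rewrite [leRHS]mulrC -ler_pdivrMr// (le_trans _ h)// lerDr.
Qed.

(** Serves for the derivative at the origin: the difference quotient there becomes
    [h * bumpf s k.+2 h], which tends to 0 because the second factor is bounded. *)
Lemma bumpfE s k t : bumpf s k t = t ^+ 2 * bumpf s k.+2 t.
Proof.
rewrite /bumpf; case: ifPn => [t0|]; last by rewrite mulr0.
by rewrite mulrA !exprS expr0; field; rewrite gt_eqF.
Qed.

Lemma is_derive_bumpf s k t : 0 < s ->
  is_derive t 1 (bumpf s k) (- (k%:R * bumpf s k.+1 t) + s * bumpf s k.+2 t).
Proof.
move=> s0; have [t0|t0|t0] := ltgtP 0 t.
- have tn0 : t != 0 by rewrite gt_eqF.
  pose v (u : R) := u^-1; pose w (u : R) := - s * u^-1.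
  have vX n u : (v ^+ n) u = u^-1 ^+ n.
    by elim: n => // n IHn; rewrite !exprS -IHn.
  have E : \near t, (v ^+ k * (expR \o w)) t = bumpf s k t.
    near=> u; rewrite /bumpf ifT; first by rewrite /GRing.mul/= vX.
    by near: u; exact: lt_nbhsr.
  apply: (near_eq_is_derive E).
  have dv : is_derive t 1 v (- t ^- 2).
    by apply: is_derive_eq; [exact: is_deriveV|rewrite scaler1].
  have dw : is_derive t 1 w (s * t ^- 2).
    have -> : s * t ^- 2 = (- s) *: (- t ^- 2) by rewrite /GRing.scale/= mulrNN.
    exact: (is_deriveZ (- s) dv).
  have dexp : is_derive t 1 (expR \o w) (expR (w t) * (s * t ^- 2)).
    exact: is_derive1_comp.
  have H := is_deriveM (is_deriveX k dv) dexp; apply: (is_derive_eq H).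
  rewrite /bumpf t0 vX /w /= /v.
  rewrite /GRing.scale/=.
  case: k {E H} => [|k]; first by rewrite !exprS expr0; field.
  by rewrite /= !exprS; field.
- have E : \near t, cst 0 t = bumpf s k t.
    near=> u; rewrite /bumpf ifF//; apply/negbTE; rewrite -leNgt ltW//.
    by near: u; exact: lt_nbhsl.
  apply: (near_eq_is_derive E); rewrite /bumpf ltNge (ltW t0)/= !mulr0 addr0 oppr0.
  exact: is_derive_cst.
- rewrite -t0 /bumpf ltxx !mulr0 addr0 oppr0.
  have C0 : 0 < k.+2`!%:R / s ^+ k.+2 :> R.
    by rewrite divr_gt0 ?exprn_gt0// ltr0n fact_gt0.
  have H : (fun h : R => h^-1 *: ((bumpf s k \o shift 0) (h *: 1) - bumpf s k 0))
      @ 0^' --> (0 : R).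
    apply/cvgr0Pnorm_le => e e0; near=> h.
    rewrite /= addr0 [h *: 1]mulr1 {2}/bumpf ltxx subr0 bumpfE.
    have h0 : h != 0 by near: h; exact: nbhs_dnbhs_neq.
    rewrite expr2 -mulrA scalerA mulVf// scale1r normrM.
    rewrite (ger0_norm (bumpf_ge0 _ _ _)).
    rewrite (le_trans (ler_wpM2l (normr_ge0 _) (bumpf_le _ _ s0)))//.
    rewrite -ler_pdivlMr// ltW//; near: h; apply: dnbhs0_lt.
    by rewrite divr_gt0.
  split; first by apply/cvg_ex; exists 0.
  exact: cvg_lim.
Unshelve. all: by end_near.
Qed.

End bump.

Section bump_rV.
Context (R : realType) (d : nat).
Implicit Types (f g : 'rV[R]_d -> R) (x a b : 'rV[R]_d) (s : R).
Local Notation e_ i := (delta_mx ord0 i : 'rV[R]_d).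

(** Only the recurrence for the derivatives matters, so that one induction covers both [t - a] and
    [b - t], whose recurrences differ by signs. *)
Lemma smoothn_coord_derive n (F : nat -> R -> R) (c1 c2 : nat -> R)
    (i : 'I_d) :
  (forall k (t : R), is_derive t 1 (F k) (c1 k * F k.+1 t + c2 k * F k.+2 t)) ->
  forall k, smoothn n (fun x => F k (x ord0 i)).
Proof.
move=> dF; elim: n => [|n IH] k; split.
- apply: coord_line_continuous => t; apply: differentiable_continuous.
  by apply/derivable1_diffP; have [] := dF k t.
- by move=> j x; have [] := is_derive_coord j (dF k (x ord0 i)).
- by [].
- apply: coord_line_continuous => t; apply: differentiable_continuous.
  by apply/derivable1_diffP; have [] := dF k t.
- by move=> j x; have [] := is_derive_coord j (dF k (x ord0 i)).
move=> j.
rewrite (_ : partial j _ = ((j == i)%:R * c1 k) *: (fun x => F k.+1 (x ord0 i)) +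
  ((j == i)%:R * c2 k) *: (fun x => F k.+2 (x ord0 i))); last first.
  apply/funext => x; have [_ D] := is_derive_coord j (dF k (x ord0 i)).
  by rewrite /partial D mulrDr !mulrA.
by apply: smoothnD; apply: smoothnZ; exact: IH.
Qed.

Lemma is_derive_bumpf_left s k (a t : R) : 0 < s -> is_derive t 1 (fun u => bumpf s k (u - a))
  (- k%:R * bumpf s k.+1 (t - a) + s * bumpf s k.+2 (t - a)).
Proof.
move=> s0; have sh : is_derive t 1 (fun u : R => u - a) 1.
  by have := is_deriveB (is_derive_id t 1) (is_derive_cst a t 1); rewrite subr0.
have := @is_derive1_comp _ (bumpf s k) (fun u => u - a) t _ _ (is_derive_bumpf k (t - a) s0) sh.
by rewrite mulr1 mulNr.
Qed.

Lemma is_derive_bumpf_right s k (b t : R) : 0 < s -> is_derive t 1 (fun u => bumpf s k (b - u))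
  (k%:R * bumpf s k.+1 (b - t) - s * bumpf s k.+2 (b - t)).
Proof.
move=> s0; have sh : is_derive t 1 (fun u : R => b - u) (-1).
  by have := is_deriveB (is_derive_cst b t 1) (is_derive_id t 1); rewrite sub0r.
have := @is_derive1_comp _ (bumpf s k) (fun u => b - u) t _ _ (is_derive_bumpf k (b - t) s0) sh.
by rewrite mulrN1 opprD opprK.
Qed.

(** Inside the box this is the exponential of [- s] times the sum of the inverse distances to the
    faces. As [s] tends to 0 it tends to the indicator of the box; with [s] proportional to the
    width it is a rescaled fixed profile. *)
Definition bump s a b : 'rV[R]_d -> R := fun x =>
  \prod_i (bumpf s 0 (x ord0 i - a ord0 i) * bumpf s 0 (b ord0 i - x ord0 i)).

Lemma bump_smooth s a b : 0 < s -> smooth (bump s a b).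
Proof.
move=> s0; apply/smoothnP => n; apply: smoothn_prod => i; apply: smoothnM.
  apply: (@smoothn_coord_derive n (fun k t => bumpf s k (t - a ord0 i))
    (fun k => - k%:R) (fun=> s)) => k t.
  exact: is_derive_bumpf_left.
apply: (@smoothn_coord_derive n (fun k t => bumpf s k (b ord0 i - t))
  (fun k => k%:R) (fun=> - s)) => k t.
by rewrite mulNr; exact: is_derive_bumpf_right.
Qed.

Lemma bump_ge0 s a b x : 0 <= bump s a b x.
Proof. by apply: prodr_ge0 => i _; rewrite mulr_ge0 ?bumpf_ge0. Qed.

Lemma bumpf_le1 s t : 0 < s -> bumpf s 0 t <= 1.
Proof. by move=> s0; have := bumpf_le 0 t s0; rewrite fact0 expr0 divr1. Qed.

Lemma bump_le1 s a b x : 0 < s -> bump s a b x <= 1.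
Proof.
move=> s0; apply: prodr_ile1 => i _.
by rewrite mulr_ge0 ?bumpf_ge0//= mulr_ile1 ?bumpf_ge0 ?bumpf_le1.
Qed.

Lemma bump_supp s a b x : bump s a b x != 0 -> obox a b x.
Proof.
move=> /prodf_neq0 h i; have := h i isT; rewrite mulf_eq0 negb_or /bumpf !subr_gt0.
by case: ifP => _; case: ifP => _; rewrite ?eqxx ?andbF.
Qed.

Lemma bump_cvg a b x :
  (fun n => bump (2^-1 ^+ n) a b x) @ \oo --> (\1_(obox a b) x : R).
Proof.
rewrite indicE; have [/set_mem xab|xab] := boolP (x \in obox a b); last first.
  rewrite (_ : (fun _ => _) = cst 0); first exact: cvg_cst.
  apply/funext => n; apply/eqP; apply: contraNT xab => /bump_supp.
  exact: mem_set.
rewrite (_ : (fun _ => _) = expR \o (fun n => - 2^-1 ^+ n *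
    \sum_i ((x ord0 i - a ord0 i)^-1 + (b ord0 i - x ord0 i)^-1))).
  set S := \sum_i _; rewrite -[X in _ --> X](_ : expR (- 0 * S) = _); last first.
    by rewrite oppr0 mul0r expR0.
  apply: continuous_cvg; first exact: continuous_expR.
  apply: cvgMl; apply: cvgN; apply: cvg_expr.
  by rewrite ger0_norm// invf_lt1// ltr1n.
apply/funext => n /=; rewrite mulr_sumr expR_sum; apply: eq_bigr => i _.
have /andP[ax xb] := xab i.
by rewrite mulrDr expRD /bumpf !subr_gt0 ax xb !expr0 !mul1r.
Qed.

Lemma partial_line f g i x : (forall h, f (h *: e_ i + x) = g (h *: e_ i + x)) ->
  partial i f x = partial i g x.
Proof.
move=> fg; have := fg 0; rewrite scale0r add0r => fgx.
have E : (fun h : R => h^-1 *: ((f \o shift x) (h *: e_ i) - f x)) =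
    (fun h : R => h^-1 *: ((g \o shift x) (h *: e_ i) - g x)).
  by apply/funext => h /=; rewrite fg fgx.
by rewrite /partial /derive E.
Qed.

(** All factors lie in [[0, 1]], and each of the two that depend on [x_i] has a derivative of size
    [s * bumpf s 2 <= 2 / s]. *)
Lemma normr_partial_bump s a b i x : 0 < s -> `|partial i (bump s a b) x| <= 4 / s.
Proof.
move=> s0; pose G := \prod_(j | j != i)
  (bumpf s 0 (x ord0 j - a ord0 j) * bumpf s 0 (b ord0 j - x ord0 j)).
have /andP[G0 G1] : 0 <= G <= 1.
  rewrite prodr_ge0 => [|j _]; last by rewrite mulr_ge0 ?bumpf_ge0.
  apply: prodr_ile1 => j _.
  by rewrite mulr_ge0 ?bumpf_ge0//= mulr_ile1 ?bumpf_ge0 ?bumpf_le1.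
pose w t := bumpf s 0 (t - a ord0 i) * bumpf s 0 (b ord0 i - t).
rewrite (@partial_line _ (fun y => G * w (y ord0 i))); last first.
  move=> h; rewrite /bump (bigD1 i)//= mulrC; congr (_ * _).
  apply: eq_bigr => j ji; rewrite !mxE eqxx (negbTE ji) mulr0 add0r//.
set t := x ord0 i.
have dw := is_deriveM (is_derive_bumpf_left 0 (a ord0 i) t s0)
  (is_derive_bumpf_right 0 (b ord0 i) t s0).
have [_ D] := is_derive_coord i (is_deriveZ G dw).
rewrite /partial D eqxx mul1r normrM (ger0_norm G0).
have bound u : 0 <= s * bumpf s 2 u <= 2 / s.
  rewrite mulr_ge0 ?(ltW s0) ?bumpf_ge0//= mulrC -ler_pdivlMr//.
  by rewrite (le_trans (bumpf_le _ _ s0))// expr2 invfM mulrA.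
have /andP[l0 l1] := bound (t - a ord0 i).
have /andP[r0 r1] := bound (b ord0 i - t).
have h1 := bumpf_ge0 s 0 (t - a ord0 i); have h2 := bumpf_le1 (t - a ord0 i) s0.
have h3 := bumpf_ge0 s 0 (b ord0 i - t); have h4 := bumpf_le1 (b ord0 i - t) s0.
rewrite !mulr0n oppr0 !mul0r !add0r /GRing.scale/= mulrN.
rewrite (_ : 4 / s = 1 * (1 * (2 / s) + 1 * (2 / s))); last by field; rewrite gt_eqF.
apply: ler_pM => //; rewrite (le_trans (ler_normD _ _))//.
have p1 := mulr_ge0 h1 r0; have p2 := mulr_ge0 h3 l0.
by rewrite normrN (ger0_norm p1) (ger0_norm p2) lerD// ler_pM.
Qed.

End bump_rV.

(** * Test functions *)

Lemma bounded_setP (R : realType) (V : normedModType R) (A : set V) :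
  bounded_set A <-> exists M, forall x, A x -> `|x| <= M.
Proof.
split=> [[M [_ H]]|[M H]]; first by exists (M + 1); apply: H; rewrite ltrDl.
exists M; split; first exact: num_real.
by move=> N /ltW MN x /H xM; exact: le_trans MN.
Qed.

Lemma closed_norm_le (R : realType) (V : normedModType R) (M : R) :
  closed [set x : V | `|x| <= M].
Proof.
apply: (@closed_comp _ _ (fun x : V => `|x|) [set t | t <= M]).
  by move=> y _; exact: norm_continuous.
exact: closed_le.
Qed.

Section test_functions.
Context (R : realType) (d : nat).
Implicit Types (f g : 'rV[R]_d -> R) (x v : 'rV[R]_d).
Local Notation e_ i := (delta_mx ord0 i : 'rV[R]_d).
Local Notation leb := (lebesgue_rV R d).

Lemma test_functionP f : test_function f <->
  smooth f /\ exists M, forall x, f x != 0 -> `|x| <= M.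
Proof.
split=> -[sf].
  move=> /compact_bounded/bounded_setP[M fM]; split=> //; exists M => x fx.
  by apply: fM; exact: subset_closure.
move=> [M fM]; split=> //; apply: bounded_closed_compact; last exact: closed_closure.
apply/bounded_setP; exists M => x.
have cM := (closure_id _).1 (@closed_norm_le R 'rV[R]_d M).
suff : closure [set x | f x != 0] `<=` [set x : 'rV[R]_d | `|x| <= M] by apply.
by rewrite cM; apply: closure_subset => y /fM.
Qed.

Lemma smooth_continuous f : smooth f -> continuous f.
Proof. by move=> /(_ [::]) []. Qed.

Lemma smooth_derivable f i x : smooth f -> derivable f x (e_ i).
Proof. by move=> /(_ [::]) []. Qed.

Lemma smooth_comb a f g : smooth f -> smooth g -> smooth (a *: f + g).
Proof.
move=> /smoothnP sf /smoothnP sg; apply/smoothnP => n.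
by apply: smoothnD => //; exact: smoothnZ.
Qed.

Lemma partial_translation i f v :
  partial i (fun x => f (x + v)) = (fun x => partial i f (x + v)).
Proof.
apply/funext => x; rewrite /partial /derive.
have -> // : (fun h : R => h^-1 *:
    (((fun x => f (x + v)) \o shift x) (h *: e_ i) - f (x + v))) =
  (fun h : R => h^-1 *: ((f \o shift (x + v)) (h *: e_ i) - f (x + v))).
by apply/funext => h /=; rewrite addrA.
Qed.

Lemma smooth_translation f v : smooth f -> smooth (fun x => f (x + v)).
Proof.
move=> sf; apply/smoothnP => n; elim: n f sf => [|n IH] f sf; split=> //.
- move=> x; apply: (@continuous_comp _ _ _ (fun x => x + v) f).
    exact: (cvgD cvg_id (cvg_cst _)).
  exact: smooth_continuous.
- move=> i x; rewrite /derivable.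
  have -> // : (fun h : R => h^-1 *:
      (((fun x => f (x + v)) \o shift x) (h *: e_ i) - f (x + v))) =
    (fun h : R => h^-1 *: ((f \o shift (x + v)) (h *: e_ i) - f (x + v))).
    by apply/funext => h /=; rewrite addrA.
  exact: smooth_derivable.
- move=> x; apply: (@continuous_comp _ _ _ (fun x => x + v) f).
    exact: (cvgD cvg_id (cvg_cst _)).
  exact: smooth_continuous.
- move=> i x; rewrite /derivable.
  have -> // : (fun h : R => h^-1 *:
      (((fun x => f (x + v)) \o shift x) (h *: e_ i) - f (x + v))) =
    (fun h : R => h^-1 *: ((f \o shift (x + v)) (h *: e_ i) - f (x + v))).
    by apply/funext => h /=; rewrite addrA.
  exact: smooth_derivable.
- by move=> i; rewrite partial_translation; apply: IH; exact: smooth_partial.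
Qed.

Definition tfun : {pred 'rV[R]_d -> R} := fun f => `[< test_function f >].

Lemma tfunP f : reflect (test_function f) (f \in tfun).
Proof. by apply: (iffP (asboolP _)). Qed.

Lemma tfun_submod : submod_closed tfun.
Proof.
split=> [|a f g /tfunP/test_functionP[sf [M fM]] /tfunP/test_functionP[sg [N gN]]].
  apply/tfunP/test_functionP; split; last by exists 0 => x; rewrite eqxx.
  by apply/smoothnP => n; exact: smoothn_cst.
apply/tfunP/test_functionP; split; first exact: smooth_comb.
exists (Num.max M N) => x; rewrite le_max; apply: contraNT.
rewrite negb_or => /andP[xM xN]; rewrite (_ : (_ + _) x = a * f x + g x)//.
have /negPn/eqP -> : ~~ (f x != 0) by apply: contra xM => /fM.
have /negPn/eqP -> : ~~ (g x != 0) by apply: contra xN => /gN.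
by rewrite mulr0 addr0.
Qed.

HB.instance Definition _ :=
  GRing.isSubmodClosed.Build R ('rV[R]_d -> R) tfun tfun_submod.

Record TF := MkTF { tf_val :> 'rV[R]_d -> R ; tf_prop : tf_val \in tfun }.
HB.instance Definition _ := [isSub for tf_val].
HB.instance Definition _ := [Choice of TF by <:].
HB.instance Definition _ := [SubChoice_isSubLmodule of TF by <:].

Implicit Types phi psi : TF.

Lemma TFD phi psi x : (phi + psi) x = phi x + psi x. Proof. by []. Qed.

Lemma TFN phi x : (- phi) x = - phi x. Proof. by []. Qed.

Lemma TFZ a phi x : (a *: phi) x = a * phi x. Proof. by []. Qed.

Lemma TF0 x : (0 : TF) x = 0. Proof. by []. Qed.

Definition TFE := (TFD, TFN, TFZ, TF0).

Lemma TFP phi psi : phi =1 psi -> phi = psi.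
Proof. by move=> e; apply/val_inj/funext. Qed.

Lemma tf_test phi : test_function phi.
Proof. exact/tfunP/tf_prop. Qed.

Lemma tf_smooth phi : smooth phi.
Proof. by have [] := tf_test phi. Qed.

Lemma tf_supp phi : exists M, forall x, phi x != 0 -> `|x| <= M.
Proof. by have /test_functionP[] := tf_test phi. Qed.

Lemma partial_supp i (f : 'rV[R]_d -> R) M : (forall x, f x != 0 -> `|x| <= M) ->
  forall x, partial i f x != 0 -> `|x| <= M.
Proof.
move=> fM x; apply: contraNT; rewrite -ltNge => Mx.
have E : \near x, f x = cst 0 x.
  near=> y; apply/eqP; apply: contraT => /fM; apply: contraLR => _; rewrite -ltNge.
  near: y; apply: (@open_nbhs_nbhs _ x [set y | M < `|y|]); split=> //.
  apply: (@open_comp _ _ (fun x : 'rV[R]_d => `|x|) [set t | M < t]).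
    by move=> y _; exact: norm_continuous.
  exact: open_gt.
by rewrite /partial (near_eq_derive _ E) derive_cst.
Unshelve. all: by end_near. Qed.

Lemma partial_test i phi : partial i phi \in tfun.
Proof.
apply/tfunP/test_functionP; split; first exact/smooth_partial/tf_smooth.
by have [M phiM] := tf_supp phi; exists M; exact: partial_supp.
Qed.

Definition dT i phi : TF := MkTF (partial_test i phi).

Lemma translation_test v phi : (fun x => phi (x + v)) \in tfun.
Proof.
apply/tfunP/test_functionP; split; first exact/smooth_translation/tf_smooth.
have [M phiM] := tf_supp phi; exists (M + `|v|) => x /phiM xvM.
by rewrite -(addrK v x) (le_trans (ler_normB _ _))// lerD2r.
Qed.

Definition tT v phi : TF := MkTF (translation_test v phi).

Lemma tf_bounded phi : exists2 C, 0 <= C & forall x, `|phi x| <= C.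
Proof.
have [M phiM] := tf_supp phi.
have : compact [set x : 'rV[R]_d | `|x| <= M].
  apply: bounded_closed_compact; first by apply/bounded_setP; exists M.
  exact: closed_norm_le.
have cphi : continuous phi by exact/smooth_continuous/tf_smooth.
move=> /(continuous_compact (continuous_subspaceT cphi))/compact_bounded/bounded_setP[C hC].
exists `|C| => // x; have [->|/phiM xM] := eqVneq (phi x) 0; first by rewrite normr0.
by rewrite (le_trans _ (ler_norm C))//; apply: hC; exists x.
Qed.

Lemma tf_measurable phi : measurable_fun setT phi.
Proof.
by apply: continuous_measurable_rV; apply: smooth_continuous; exact: tf_smooth.
Qed.

Lemma sqr_integral_obox f (C : R) (a b : 'rV[R]_d) : measurable_fun setT f ->
  (forall x, `|f x| <= C) -> (forall x, f x != 0 -> obox a b x) ->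
  (\int[leb]_x (f x ^+ 2)%:E <=
    (C ^+ 2 * \prod_(i < d) Num.max 0 (b ord0 i - a ord0 i))%:E)%E.
Proof.
move=> mf fC fab.
have C0 : 0 <= C by exact: le_trans (normr_ge0 (f 0)) (fC _).
apply: (@le_trans _ _ (\int[leb]_x (C ^+ 2 * \1_(obox a b) x)%:E)%E).
  apply: ge0_le_integral => //.
  - by move=> x _; rewrite lee_fin sqr_ge0.
  - exact/measurable_EFinP/measurable_funX.
  - apply/measurable_EFinP/measurable_funM => //.
    by apply: measurable_indic; exact: measurable_obox.
  - move=> x _; rewrite lee_fin indicE; have [xab|xab] := boolP (x \in obox a b).
      by rewrite mulr1 -[leLHS]real_normK ?num_real// lerXn2r ?nnegrE.
    have /negPn/eqP -> : ~~ (f x != 0) by apply: contra xab => /fab/mem_set.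
    by rewrite expr0n mulr0.
under eq_integral do rewrite EFinM.
rewrite ge0_integralZl//; last first.
- by rewrite lee_fin sqr_ge0.
- apply/measurable_EFinP/measurable_indic; exact: measurable_obox.
rewrite integral_indic//; last exact: measurable_obox.
have H : ((C ^+ 2)%:E * leb (obox a b) <=
    (C ^+ 2 * \prod_(i < d) Num.max 0 (b ord0 i - a ord0 i))%:E)%E.
  by rewrite lebesgue_rV_obox EFinM.
by rewrite setIT; exact: H.
Qed.

Lemma supp_obox f (M : R) : (forall x, f x != 0 -> `|x| <= M) ->
  forall x, f x != 0 -> obox (const_mx (- (M + 1))) (const_mx (M + 1)) x.
Proof.
move=> fM x /fM xM i; rewrite !mxE -ltr_norml.
by rewrite (le_lt_trans (le_trans (rV_norm_ge x i) xM))// ltrDl.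
Qed.

Lemma tf_Lfun phi : (phi : 'rV[R]_d -> R) \in Lfun leb 2%:E.
Proof.
apply/Lfun2P; split; first exact: tf_measurable.
have [C _ phiC] := tf_bounded phi; have [M phiM] := tf_supp phi.
apply: le_lt_trans (ltry _).
exact: (sqr_integral_obox (tf_measurable phi) phiC (supp_obox phiM)).
Qed.

Definition tL phi : L2T leb := Lfun_Sub (lee1n 2) (tf_Lfun phi).

Lemma tLD phi psi : tL (phi + psi) = tL phi + tL psi.
Proof. exact/LfuneqP. Qed.

Lemma tLZ a phi : tL (a *: phi) = a *: tL phi.
Proof. exact/LfuneqP. Qed.

Lemma tLN phi : tL (- phi) = - tL phi.
Proof. exact/LfuneqP. Qed.

Lemma tL0 : tL 0 = 0.
Proof. exact/LfuneqP. Qed.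

End test_functions.

(** * Translations, difference quotients and averages of test functions *)

Section test_function_calculus.
Context (R : realType) (d : nat).
Implicit Types (x v : 'rV[R]_d) (phi psi : TF R d) (h : R).
Local Notation e_ i := (delta_mx ord0 i : 'rV[R]_d).
Local Notation leb := (lebesgue_rV R d).
Local Notation "''[' phi , psi ]" := (ip (tL phi) (tL psi)).
Local Notation N phi := (nrm (tL phi)).

Lemma tT_is_linear v : linear (@tT R d v).
Proof. by move=> a phi psi; exact: TFP. Qed.
HB.instance Definition _ v := GRing.isLinear.Build R (TF R d) (TF R d) _ (@tT R d v)
  (tT_is_linear v).

Lemma dT_is_linear i : linear (@dT R d i).
Proof.
move=> a phi psi; apply: TFP => x.
have dphi := @smooth_derivable R d phi i x (tf_smooth phi).
have dpsi := @smooth_derivable R d psi i x (tf_smooth psi).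
have dZ : derivable (a *: (phi : 'rV[R]_d -> R)) x (e_ i) by exact: derivableZ.
by rewrite !TFE -[dT i phi x]/(partial i phi x) -partialZ//; exact: (partialD dZ dpsi).
Qed.
HB.instance Definition _ i := GRing.isLinear.Build R (TF R d) (TF R d) _ (@dT R d i)
  (dT_is_linear i).

Lemma tL_is_linear : linear (@tL R d).
Proof. by move=> a phi psi; rewrite tLD tLZ. Qed.
HB.instance Definition _ := GRing.isLinear.Build R (TF R d) (L2T leb) _ (@tL R d)
  tL_is_linear.

Lemma tLB phi psi : tL (phi - psi) = tL phi - tL psi.
Proof. exact: linearB. Qed.

Lemma tTZ v a phi : tT v (a *: phi) = a *: tT v phi.
Proof. exact: linearZ. Qed.

Lemma tTB v phi psi : tT v (phi - psi) = tT v phi - tT v psi.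
Proof. exact: linearB. Qed.

Lemma tT_sum v (I : Type) (r : seq I) (F : I -> TF R d) :
  tT v (\sum_(k <- r) F k) = \sum_(k <- r) tT v (F k).
Proof. exact: linear_sum. Qed.

Lemma dTZ i a phi : dT i (a *: phi) = a *: dT i phi.
Proof. exact: linearZ. Qed.

Lemma dTB i phi psi : dT i (phi - psi) = dT i phi - dT i psi.
Proof. exact: linearB. Qed.

Lemma dT_sum i (I : Type) (r : seq I) (F : I -> TF R d) :
  dT i (\sum_(k <- r) F k) = \sum_(k <- r) dT i (F k).
Proof. exact: linear_sum. Qed.

Lemma tL_sum (I : Type) (r : seq I) (F : I -> TF R d) :
  tL (\sum_(k <- r) F k) = \sum_(k <- r) tL (F k).
Proof. exact: linear_sum. Qed.

Lemma tT_tT u v phi : tT u (tT v phi) = tT (u + v) phi.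
Proof. by apply: TFP => x /=; rewrite addrA. Qed.

Lemma tT0 phi : tT 0 phi = phi.
Proof. by apply: TFP => x /=; rewrite addr0. Qed.

Lemma dT_tT i v phi : dT i (tT v phi) = tT v (dT i phi).
Proof. by apply: TFP => x /=; rewrite partial_translation. Qed.

Lemma ip_tT v phi psi : '[tT v phi, tT v psi] = '[phi, psi].
Proof.
rewrite !ip_def; apply: (@Rintegral_translation R d (fun x => phi x * psi x)).
by apply: measurable_funM; exact: tf_measurable.
Qed.

Lemma ip_tTl v phi psi : '[tT v phi, psi] = '[phi, tT (- v) psi].
Proof. by rewrite -(ip_tT v phi) tT_tT subrr tT0. Qed.

Lemma nrm_tT v phi : N (tT v phi) = N phi.
Proof. by rewrite !nrm_def ip_tT. Qed.

Definition dq h i phi : TF R d := h^-1 *: (tT (h *: e_ i) phi - phi).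

Lemma dq_is_linear h i : linear (dq h i).
Proof.
move=> a phi psi; rewrite /dq linearP /=; apply: TFP => x.
by rewrite !TFE; ring.
Qed.
HB.instance Definition _ h i := GRing.isLinear.Build R (TF R d) (TF R d) _ (dq h i)
  (dq_is_linear h i).

Lemma dT_dq h i j phi : dT j (dq h i phi) = dq h i (dT j phi).
Proof. by rewrite /dq linearZ linearB/= dT_tT. Qed.

(** Two uses of the mean value theorem bound the error pointwise by [|h|] times a bound on the
    second derivative; since [|h| <= 1], the error lives in a fixed box, whence the L^2 rate. *)
Lemma dq_cvg i phi : exists2 K : R, 0 <= K & forall h, h != 0 -> `|h| <= 1 ->
  N (dq h i phi - dT i phi) <= K * `|h|.
Proof.
have [C C0 hC] := tf_bounded (dT i (dT i phi)).
have [M hM] := tf_supp phi; have [M' hM'] := tf_supp (dT i phi).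
pose L := Num.max (M + 1) M'.
pose Vol : R := \prod_(j < d) Num.max 0 ((L + 1) - - (L + 1)).
have Vol0 : 0 <= Vol by apply: prodr_ge0 => j _; rewrite le_max lexx.
exists (C * Num.sqrt Vol); first by rewrite mulr_ge0 ?sqrtr_ge0.
move=> h h0 h1; set f := dq h i phi - dT i phi.
have fC x : `|f x| <= C * `|h|.
  have d1 y : derivable phi y (e_ i) by exact/smooth_derivable/tf_smooth.
  have d2 y : derivable (dT i phi) y (e_ i) by exact/smooth_derivable/tf_smooth.
  have [s sh E] := partial_MVT x h d1.
  have [s' ss' E'] := partial_MVT x s d2.
  have -> : f x = s * dT i (dT i phi) (x + s' *: e_ i).
    rewrite -[RHS]E' /f !TFE; congr (_ - _).
    by rewrite -[X in _ * X]/(phi (x + h *: e_ i) - phi x) E mulrA mulVf// mul1r.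
  by rewrite normrM mulrC ler_pM.
have fL x : f x != 0 -> `|x| <= L.
  apply: contraNT; rewrite -ltNge gt_max => /andP[Mx M'x].
  have -> : f x = h^-1 * (phi (x + h *: e_ i) - phi x) - dT i phi x by [].
  have /negPn/eqP -> : ~~ (phi x != 0).
    by apply/negP => /hM; apply/negP; rewrite -ltNge (lt_trans _ Mx)// ltrDl.
  have /negPn/eqP -> : ~~ (dT i phi x != 0).
    by apply/negP => /hM'; apply/negP; rewrite -ltNge.
  have /negPn/eqP -> : ~~ (phi (x + h *: e_ i) != 0).
    apply/negP => /hM; apply/negP; rewrite -ltNge.
    have : `|x| <= `|x + h *: e_ i| + 1.
      rewrite -{1}(addrK (h *: e_ i) x) (le_trans (ler_normB _ _))// lerD2l.
      apply: rV_norm_le => // j; rewrite !mxE eqxx normrM.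
      by rewrite mulr_ile1//; case: eqP; rewrite ?normr1 ?normr0.
    lra.
  by rewrite !subrr mulr0 subrr.
rewrite -(@ler_pXn2r _ 2)// ?nnegrE ?nrm_ge0 ?mulr_ge0 ?sqrtr_ge0//.
rewrite sqr_nrm -lee_fin ipE mulrAC exprMn sqr_sqrtr//.
have := sqr_integral_obox (tf_measurable f) fC (supp_obox fL).
under eq_bigr do rewrite !mxE.
exact.
Qed.

Lemma eq0_small (a : R) :
  (exists K, forall h, 0 < h -> h <= 1 -> `|a| <= K * h) -> a = 0.
Proof.
move=> [K aK]; apply/eqP; rewrite -normr_le0; apply/ler_addgt0Pr => e e0.
rewrite add0r; pose h := Num.min 1 (e / (`|K| + 1)).
have K1 : 0 < `|K| + 1 by rewrite ltr_wpDl.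
have h0 : 0 < h by rewrite lt_min ltr01 divr_gt0.
rewrite (le_trans (aK h h0 _))//; first by rewrite ge_min lexx.
have he : h * (`|K| + 1) <= e by rewrite -ler_pdivlMr// ge_min lexx orbT.
by rewrite (le_trans _ he)// mulrC ler_pM2l// (le_trans (ler_norm _))// lerDl.
Qed.

(** Translation invariance makes [dq h] and [- dq (- h)] exactly adjoint; integration by parts is
    the limit [h -> 0]. *)
Lemma ip_dT i phi psi : '[dT i phi, psi] = - '[phi, dT i psi].
Proof.
apply/eqP; rewrite -addr_eq0; apply/eqP/eq0_small.
have [K K0 hK] := dq_cvg i phi; have [K' K'0 hK'] := dq_cvg i psi.
exists (K * N psi + N phi * K') => h h0 h1.
have hn : `|h| = h by rewrite gtr0_norm.
have dqE : '[dq h i phi, psi] + '[phi, dq (- h) i psi] = 0.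
  rewrite /dq !tLZ ipZl ipZr !tLB ipBl ipBr ip_tTl scaleNr.
  by field; rewrite gt_eqF.
have -> : '[dT i phi, psi] + '[phi, dT i psi] =
    - ('[dq h i phi - dT i phi, psi] + '[phi, dq (- h) i psi - dT i psi]).
  by rewrite !tLB ipBl ipBr; move: dqE; lra.
rewrite normrN (le_trans (ler_normD _ _))// mulrDl lerD//.
  rewrite (le_trans (normr_ip_le _ _))// mulrAC ler_wpM2r ?nrm_ge0//.
  by rewrite -{2}hn hK ?hn// gt_eqF.
rewrite (le_trans (normr_ip_le _ _))// -mulrA ler_wpM2l ?nrm_ge0//.
by rewrite -{2}hn -normrN hK' ?normrN ?hn// oppr_eq0 gt_eqF.
Qed.

(** Symmetry of mixed derivatives in the weak form that suffices: [dq] commutes with [dT] exactly,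
    and the pairing passes to the limit. *)
Lemma ip_dT_comm i j phi psi : '[dT j (dT i phi), psi] = '[dT i (dT j phi), psi].
Proof.
apply/eqP; rewrite -subr_eq0; apply/eqP/eq0_small.
have [K K0 hK] := dq_cvg j (dT i phi); have [K' K'0 hK'] := dq_cvg j phi.
exists (K * N psi + K' * N (dT i psi)) => h h0 h1.
have hn : `|h| = h by rewrite gtr0_norm.
have -> : '[dT j (dT i phi), psi] - '[dT i (dT j phi), psi] =
    - ('[dq h j (dT i phi) - dT j (dT i phi), psi] +
       '[dq h j phi - dT j phi, dT i psi]).
  by rewrite !tLB !ipBl -dT_dq (ip_dT i (dq h j phi)) (ip_dT i (dT j phi)); ring.
rewrite normrN (le_trans (ler_normD _ _))// mulrDl lerD//.
  rewrite (le_trans (normr_ip_le _ _))// mulrAC ler_wpM2r ?nrm_ge0//.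
  by rewrite -{2}hn hK ?hn// gt_eqF.
rewrite (le_trans (normr_ip_le _ _))// mulrAC ler_wpM2r ?nrm_ge0//.
by rewrite -{2}hn hK' ?hn// gt_eqF.
Qed.

(** Two integrations by parts. It makes every term of the expansion of [|lap phi|^2] a square, the
    source of the second-order estimates. *)
Lemma ip_dT_mixed i j phi :
  '[dT j (dT i phi), dT j (dT i phi)] = '[dT j (dT j phi), dT i (dT i phi)].
Proof.
rewrite ip_dT_comm ip_dT ipC ip_dT_comm ip_dT opprK ipC.
by [].
Qed.

(* Averages over [n] translates of step [h / n] stand in for convolution with a
   mollifier: they commute with translations and derivatives and, by telescoping,
   turn the difference quotient of step [h / n] into that of step [h], whose
   [L^2] norm is at most [2 / h * N phi]. *)
Definition avg n h i phi : TF R d :=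
  n%:R^-1 *: \sum_(k < n) tT ((k%:R * (h / n%:R)) *: e_ i) phi.

Lemma avg_is_linear n h i : linear (avg n h i).
Proof.
move=> a phi psi; rewrite /avg; under eq_bigr do rewrite linearP.
by rewrite big_split/= -scaler_sumr scalerDr !scalerA (mulrC a).
Qed.
HB.instance Definition _ n h i := GRing.isLinear.Build R (TF R d) (TF R d) _
  (avg n h i) (avg_is_linear n h i).

Lemma nrm_avg n h i phi : N (avg n h i phi) <= N phi.
Proof.
case: n => [|n]; first by rewrite /avg big_ord0 scaler0 tL0 nrm0 nrm_ge0.
rewrite /avg tLZ nrmZ tL_sum ger0_norm ?invr_ge0// ler_pdivrMl//.
rewrite (le_trans (nrm_sum _ _))//; under eq_bigr do rewrite nrm_tT.
by rewrite sumr_const card_ord mulr_natl.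
Qed.

Lemma avg_tT n h i v phi : avg n h i (tT v phi) = tT v (avg n h i phi).
Proof.
rewrite /avg tTZ tT_sum; congr (_ *: _); apply: eq_bigr => k _.
by rewrite !tT_tT addrC.
Qed.

Lemma avg_comm n h i m k j phi :
  avg n h i (avg m k j phi) = avg m k j (avg n h i phi).
Proof.
rewrite [RHS]/avg; under eq_bigr do rewrite -avg_tT.
by rewrite -linear_sum -linearZ.
Qed.

Lemma dT_avg n h i j phi : dT j (avg n h i phi) = avg n h i (dT j phi).
Proof.
rewrite /avg dTZ dT_sum; congr (_ *: _); apply: eq_bigr => k _.
by rewrite dT_tT.
Qed.

Lemma avg_dq n h k i j phi : avg n h i (dq k j phi) = dq k j (avg n h i phi).
Proof. by rewrite /dq -avg_tT [LHS]linearZ linearB. Qed.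

Lemma ip_avg n h i phi psi : '[avg n h i phi, psi] = '[phi, avg n (- h) i psi].
Proof.
rewrite /avg !tLZ !tL_sum ipZl ipZr ip_suml ip_sumr; congr (_ * _).
by apply: eq_bigr => k _; rewrite ip_tTl -scaleNr mulNr mulrN.
Qed.

Lemma avg_dq_self n h i phi : (0 < n)%N -> h != 0 ->
  avg n h i (dq (h / n%:R) i phi) = dq h i phi.
Proof.
move=> n0 h0.
have nn0 : n%:R != 0 :> R by rewrite pnatr_eq0 -lt0n.
rewrite /avg /dq; under eq_bigr do rewrite tTZ tTB tT_tT -scalerDl.
rewrite -scaler_sumr scalerA; congr (_ *: _); first by field; rewrite h0 nn0.
rewrite -(big_mkord xpredT (fun k => tT ((k%:R * (h / n%:R) + h / n%:R) *: e_ i) phi -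
  tT ((k%:R * (h / n%:R)) *: e_ i) phi)).
rewrite (telescope_sumr_eq (fun k => tT ((k%:R * (h / n%:R)) *: e_ i) phi))//.
  by rewrite mul0r scale0r tT0 mulrCA mulfV// mulr1.
by move=> k _; congr (tT (_ *: _) _ - _); rewrite -natr1; ring.
Qed.

Lemma avg_dT_cvg i phi h : h != 0 -> forall e : R, 0 < e ->
  exists2 n, (0 < n)%N & forall m, (n <= m)%N -> N (dq (h / m%:R) i phi - dT i phi) <= e.
Proof.
move=> h0 e e0; have [K K0 hK] := dq_cvg i phi.
(* Large enough for both [|h| / m <= 1], which [dq_cvg] requires, and [K * |h| / m <= e]. *)
pose n := (Num.truncn (`|h| * (1 + K / e))).+1.
exists n => // m nm; have m0 : (0 < m)%N by exact: leq_trans nm.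
have hm : `|h| * (1 + K / e) <= m%:R.
  by rewrite (le_trans (ltW (truncnS_gt _)))// ler_nat.
have mR : 0 < m%:R :> R by rewrite ltr0n.
have Ke : 0 <= K / e by rewrite divr_ge0// ltW.
have hme : `|h / m%:R| = `|h| / m%:R by rewrite normrM normfV (ger0_norm (ltW mR)).
rewrite (le_trans (hK _ _ _))// ?hme.
- by rewrite mulf_neq0 ?invr_neq0// gt_eqF.
- rewrite ler_pdivrMr// mul1r (le_trans _ hm)// ler_peMr// lerDl//.
- rewrite [leLHS]mulrA ler_pdivrMr// -ler_pdivrMl// (le_trans _ hm)//.
  rewrite (_ : _ * (K * _) = `|h| * (K / e)); last by ring.
  by rewrite ler_wpM2l// lerDr.
Qed.

(** [dq h] is an average of translates of [dq (h / n)], averages contract the norm, and [dq (h / n)]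
    tends to the derivative as [n] grows. *)
Lemma nrm_dq h i phi : h != 0 -> N (dq h i phi) <= N (dT i phi).
Proof.
move=> h0; apply/ler_addgt0Pr => e e0.
have [n n0 hn] := avg_dT_cvg i phi h0 e0.
rewrite -(avg_dq_self _ _ n0 h0) (le_trans (nrm_avg _ _ _ _))//.
rewrite (_ : dq _ _ _ = dT i phi + (dq (h / n%:R) i phi - dT i phi)); last first.
  by rewrite addrCA subrr addr0.
by rewrite tLD (le_trans (nrmD _ _))// lerD2l (hn n).
Qed.

Lemma nrm_tTB h i phi : N (tT (h *: e_ i) phi - phi) <= `|h| * N (dT i phi).
Proof.
have [->|h0] := eqVneq h 0.
  by rewrite scale0r tT0 subrr tL0 nrm0 normr0 mul0r.
rewrite (_ : _ - _ = h *: dq h i phi); last by rewrite /dq scalerA mulfV// scale1r.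
by rewrite tLZ nrmZ ler_wpM2l// nrm_dq.
Qed.

End test_function_calculus.

(** * Density of test functions in L^2 *)

Section density_measure.
Context d (T : measurableType d) (R : realType) (mu : {measure set T -> \bar R}).
Context (f : T -> \bar R) (mf : measurable_fun setT f)
  (f_ge0 : forall x, (0 <= f x)%E).
Local Open Scope ereal_scope.

(** Measurability and sign of [f] are arguments so that the measure structure can be attached to the
    term itself. *)
Definition density_measure of measurable_fun setT f & (forall x, 0 <= f x) :
  set T -> \bar R := fun A => \int[mu]_(x in A) f x.

Let nu0 : density_measure mf f_ge0 set0 = 0.
Proof. by rewrite /density_measure integral_set0. Qed.

Let nu_ge0 A : 0 <= density_measure mf f_ge0 A.
Proof. exact: integral_ge0. Qed.

Let nu_sigma : semi_sigma_additive (density_measure mf f_ge0).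
Proof. exact: semi_sigma_additive_nng_induced. Qed.

HB.instance Definition _ := isMeasure.Build _ _ _ (density_measure mf f_ge0)
  nu0 nu_ge0 nu_sigma.

End density_measure.

Section test_functions_separate.
Context (R : realType) (d : nat).
Implicit Types (x a b : 'rV[R]_d) (phi psi : TF R d) (s : R).
Local Notation leb := (lebesgue_rV R d).

Lemma bump_test s a b : 0 < s -> bump s a b \in @tfun R d.
Proof.
move=> s0; apply/tfunP/test_functionP; split; first exact: bump_smooth.
exists (Num.max `|a| `|b|) => x /bump_supp xab.
apply: rV_norm_le => [|i]; first by rewrite le_max normr_ge0.
have /andP[ax xb] := xab i.
have ha := rV_norm_ge a i; have hb := rV_norm_ge b i; rewrite le_max.
have [x0|x0] := leP 0 (x ord0 i).
  apply/orP; right; rewrite ger0_norm// (le_trans (ltW xb))//.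
  by rewrite (le_trans (ler_norm _)).
apply/orP; left; rewrite ltr0_norm// (le_trans _ ha)//.
by rewrite -normrN (le_trans _ (ler_norm _))// lerN2 ltW.
Qed.

Lemma indic_obox_Lfun a b : (\1_(obox a b) : 'rV[R]_d -> R) \in Lfun leb 2%:E.
Proof.
apply/Lfun2P; split; first by apply: measurable_indic; exact: measurable_obox.
apply: le_lt_trans (ltry _).
apply: (@sqr_integral_obox R d _ 1 a b).
- by apply: measurable_indic; exact: measurable_obox.
- by move=> x; rewrite indicE; case: (_ \in _); rewrite ?normr1 ?normr0.
- by move=> x; rewrite indicE; case: (boolP (x \in _)) => [/set_mem//|_]; rewrite eqxx.
Qed.

(** Dominated convergence along bumps that tend to the indicator of the box; the dominating
    function, [|u|] times that indicator, is integrable as a product of two L^2 functions. *)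
Lemma tf_perp_obox (u : L2T leb) a b : (forall phi, ip u (tL phi) = 0) ->
  (\int[leb]_(x in obox a b) (u x)%:E = 0)%E.
Proof.
move=> u0.
have half_gt0 n : 0 < (2^-1 : R) ^+ n by rewrite exprn_gt0.
pose one : L2T leb := Lfun_Sub (lee1n 2) (indic_obox_Lfun a b).
have mb : measurable (obox a b) by exact: measurable_obox.
pose bmp n : TF R d := MkTF (bump_test a b (half_gt0 n)).
pose f_ n x := (u x * bmp n x)%:E.
have If n : (\int[leb]_x f_ n x = 0)%E.
  have := u0 (bmp n); rewrite ip_def /Rintegral => h.
  rewrite -[LHS]fineK; first by rewrite h.
  by apply: integrable_fin_num => //; exact: (L2T_integrableM u (tL (bmp n))).
have /cvg_lim <- // : (\int[leb]_x f_ n x)%E @[n --> \oo] -->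
    (\int[leb]_(x in obox a b) (u x)%:E)%E; last first.
  by under eq_fun do rewrite If; exact: lim_cst.
rewrite integral_mkcond.
have absuL : (fun x => `|u x|) \in Lfun leb 2%:E.
  apply: (le_Lfun2 (g := u)); last by move=> x; rewrite normr_id.
  by apply: measurableT_comp => //; exact: measurable_L2T.
pose absu : L2T leb := Lfun_Sub (lee1n 2) absuL.
have [] // := @dominated_convergence _ _ _ leb _ measurableT f_
  ((fun x => (u x)%:E) \_ (obox a b)) (EFin \o (fun x => absu x * one x)).
- move=> n; apply/measurable_EFinP/measurable_funM; first exact: measurable_L2T.
  exact: tf_measurable.
- apply/(measurable_restrictT _ mb); apply: measurable_funTS.
  exact/measurable_EFinP/measurable_L2T.
- apply: aeW => x _; rewrite /f_ patchE.
  rewrite (_ : (if _ then _ else _) = (u x * \1_(obox a b) x)%:E); last first.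
    by rewrite indicE; case: ifPn => _; rewrite ?mulr1 ?mulr0.
  apply: cvg_EFin; first exact: nearW.
  by apply: cvgMr; exact: bump_cvg.
- exact: (L2T_integrableM absu one).
- apply: aeW => x n _; rewrite /f_ /= lee_fin normrM.
  rewrite ler_wpM2l// ger0_norm ?bump_ge0// indicE.
  case: (boolP (x \in obox a b)) => [_|xab]; first exact: bump_le1.
  have [->//|/bump_supp/mem_set] := eqVneq (bump (2^-1 ^+ n) a b x) 0.
  by rewrite (negbTE xab).
Qed.

(** The positive and negative parts of [u] are densities of two measures that agree on boxes, hence
    everywhere. On [u > 0] the second measure vanishes, so the positive part is null; symmetrically
    on [u < 0]. *)
Lemma tf_separating (u : L2T leb) : (forall phi, ip u (tL phi) = 0) -> nrm u = 0.
Proof.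
move=> u0.
have mu : measurable_fun setT (EFin \o u) by exact/measurable_EFinP/measurable_L2T.
pose m1 := @density_measure _ _ _ leb _ (measurable_funepos mu) (funepos_ge0 (EFin \o u)).
pose m2 := @density_measure _ _ _ leb _ (measurable_funeneg mu) (funeneg_ge0 (EFin \o u)).
have iu a b : leb.-integrable (obox a b) (EFin \o u).
  apply/(integrable_mkcond _ (measurable_obox a b)).
  have := L2T_integrableM u (Lfun_Sub (lee1n 2) (indic_obox_Lfun a b)).
  congr (integrable _ _ _); apply/funext => x; rewrite patchE /=.
  rewrite indicE.
  by case: ifPn => _; rewrite ?mulr1 ?mulr0.
have m12 A : measurable A -> m1 A = m2 A.
  move=> mA; apply: (@obox_measure_unique R d m1 m2) => // a b; last first.
    rewrite /m1 /= /density_measure.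
    have := integrable_fin_num (measurable_obox a b)
      (integrable_funepos (measurable_obox a b) (iu a b)).
    by rewrite ge0_fin_numE// integral_ge0.
  have := tf_perp_obox a b u0; rewrite integralE.
  have f1 := integrable_fin_num (measurable_obox a b)
      (integrable_funepos (measurable_obox a b) (iu a b)).
  have f2 := integrable_fin_num (measurable_obox a b)
      (integrable_funeneg (measurable_obox a b) (iu a b)).
  rewrite /m1 /m2 /= /density_measure => /eqP.
  by rewrite sube_eq ?fin_num_adde_defl// add0e => /eqP.
have pos_null (A : set 'rV[R]_d) (f g : 'rV[R]_d -> \bar R) :
    measurable A -> measurable_fun setT f ->
    (forall x, (0 <= f x)%E) -> (forall x, A x -> g x = 0%E) ->
    (\int[leb]_(x in A) f x = \int[leb]_(x in A) g x)%E ->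
    {ae leb, forall x, A x -> f x = 0%E}.
  move=> mA mf f0 g0 fg.
  apply/(ae_eq_integral_abs leb mA (measurable_funTS mf)).
  under eq_integral do rewrite gee0_abs//.
  by rewrite fg integral0_eq// => x /set_mem/g0.
pose P := [set x | (0 < u x)]; pose Q := [set x | u x < 0].
have mP : measurable P.
  rewrite -[P]setTI (_ : P = u @^-1` `]0, +oo[); last first.
    by apply/seteqP; split=> x; rewrite /P/= in_itv/= andbT.
  exact: measurable_L2T.
have mQ : measurable Q.
  rewrite -[Q]setTI (_ : Q = u @^-1` `]-oo, 0[); last first.
    by apply/seteqP; split=> x; rewrite /Q/= in_itv/=.
  exact: measurable_L2T.
have Pneg x : P x -> ((EFin \o u)^\- x = 0)%E.
  by move=> Px; rewrite funenegE max_r// leeNl oppe0 lee_fin ltW.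
have Qpos x : Q x -> ((EFin \o u)^\+ x = 0)%E.
  by move=> Qx; rewrite funeposE max_r// lee_fin ltW.
have aeP := pos_null P _ _ mP (measurable_funepos mu) (funepos_ge0 _) Pneg (m12 _ mP).
have aeQ := pos_null Q _ _ mQ (measurable_funeneg mu) (funeneg_ge0 _) Qpos
  (esym (m12 _ mQ)).
rewrite -(@nrm0 _ _ _ leb); apply: eq_nrm; apply: filterS2 aeP aeQ => x Px Qx _.
have [ux|ux|ux] := ltgtP 0 (u x); last by [].
  by have := Px ux; rewrite funeposE max_l ?lee_fin ?ltW// => -[].
have := Qx ux; rewrite funenegE max_l; last by rewrite leeNr oppe0 lee_fin ltW.
by move=> [/eqP]; rewrite oppr_eq0 => /eqP.
Qed.

Lemma tf_dense (u : L2T leb) e : 0 < e -> exists phi, nrm (u - tL phi) < e.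
Proof.
move=> e0; have [] := @orthogonal_dense _ _ _ leb (range (@tL R d)) _ _ _ u e e0.
- by exists 0 => //; exact: tL0.
- by move=> a _ _ [phi _ <-] [psi _ <-]; exists (a *: phi + psi) => //; rewrite tLD tLZ.
- move=> v v0; apply: tf_separating => phi; apply: v0; by exists phi.
- by move=> _ [phi _ <-] h; exists phi.
Qed.

End test_functions_separate.

(** * Density of test functions in the graph of the Laplacian *)

Section laplacian_density.
Context (R : realType) (d : nat).
Implicit Types (phi psi : TF R d) (h : R) (l : seq 'I_d).
Local Notation leb := (lebesgue_rV R d).
Local Notation "''[' phi , psi ]" := (ip (tL phi) (tL psi)).
Local Notation N phi := (nrm (tL phi)).

Definition lap phi : TF R d := \sum_i dT i (dT i phi).

Lemma lapD phi psi : lap (phi + psi) = lap phi + lap psi.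
Proof. by rewrite /lap -big_split/=; apply: eq_bigr => i _; rewrite !linearD. Qed.

Lemma lapZ a phi : lap (a *: phi) = a *: lap phi.
Proof. by rewrite /lap scaler_sumr; apply: eq_bigr => i _; rewrite !dTZ. Qed.

Lemma lapN phi : lap (- phi) = - lap phi.
Proof. by rewrite -scaleN1r lapZ scaleN1r. Qed.

Lemma lapB phi psi : lap (phi - psi) = lap phi - lap psi.
Proof. by rewrite lapD lapN. Qed.

Lemma ip_lap phi psi : '[lap phi, psi] = - \sum_i '[dT i phi, dT i psi].
Proof.
rewrite /lap tL_sum ip_suml -sumrN; apply: eq_bigr => i _; exact: ip_dT.
Qed.

Lemma ip_lapC phi psi : '[lap phi, psi] = '[phi, lap psi].
Proof.
rewrite ip_lap (ipC (tL phi)) ip_lap.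
by under eq_bigr do rewrite ipC.
Qed.

Definition avgs n h l phi := foldr (avg n h) phi l.

Lemma nrm_avgs n h l phi : N (avgs n h l phi) <= N phi.
Proof. by elim: l => //= i l IH; rewrite (le_trans (nrm_avg _ _ _ _)). Qed.

Lemma dT_avgs n h l j phi : dT j (avgs n h l phi) = avgs n h l (dT j phi).
Proof. by elim: l => //= i l IH; rewrite dT_avg IH. Qed.

Lemma avg_avgs n h l m k j phi : avg m k j (avgs n h l phi) = avgs n h l (avg m k j phi).
Proof. by elim: l => //= i l IH; rewrite avg_comm IH. Qed.

Lemma avgs_sum n h l (I : Type) (r : seq I) (F : I -> TF R d) :
  avgs n h l (\sum_(k <- r) F k) = \sum_(k <- r) avgs n h l (F k).
Proof. by elim: l => //= i l IH; rewrite IH linear_sum. Qed.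

Lemma ip_avgs n h l phi psi : '[avgs n h l phi, psi] = '[phi, avgs n (- h) l psi].
Proof.
elim: l psi => //= i l IH psi; rewrite ip_avg IH -avg_avgs//.
Qed.

Lemma nrm_avgs_mem n h l i phi : i \in l -> N (avgs n h l phi) <= N (avg n h i phi).
Proof.
elim: l => //= j l IH; rewrite inE => /orP[/eqP<-|il].
  by rewrite avg_avgs nrm_avgs.
by rewrite (le_trans (nrm_avg _ _ _ _))// IH.
Qed.

Lemma nrm_avgB n h i phi : (0 < n)%N -> N (avg n h i phi - phi) <= `|h| * N (dT i phi).
Proof.
move=> n0; have nR : 0 < n%:R :> R by rewrite ltr0n.
have -> : avg n h i phi - phi =
    n%:R^-1 *: \sum_(k < n) (tT ((k%:R * (h / n%:R)) *: delta_mx ord0 i) phi - phi).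
  rewrite sumrB scalerBr sumr_const card_ord -[phi *+ n]scaler_nat scalerA mulVf ?scale1r//.
  by rewrite gt_eqF.
rewrite tLZ nrmZ tL_sum gtr0_norm ?invr_gt0// ler_pdivrMl//.
rewrite (le_trans (nrm_sum _ _))// -[n in n%:R * _]card_ord -sum1_card.
rewrite natr_sum mulr_suml; apply: ler_sum => k _; rewrite mul1r.
rewrite (le_trans (nrm_tTB _ _ _))// ler_wpM2r ?nrm_ge0//.
rewrite !normrM normfV !normr_nat mulrA ler_pdivrMr// mulrC.
by rewrite ler_wpM2l// ler_nat ltnW.
Qed.

Lemma nrm_avgsB n h l phi : (0 < n)%N ->
  N (avgs n h l phi - phi) <= `|h| * \sum_(i <- l) N (dT i phi).
Proof.
move=> n0; elim: l => [|i l IH] /=; first by rewrite subrr tL0 nrm0 big_nil mulr0.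
rewrite (_ : _ - phi = avg n h i (avgs n h l phi - phi) + (avg n h i phi - phi)).
  rewrite tLD (le_trans (nrmD _ _))// big_cons mulrDr addrC lerD ?nrm_avgB//.
  by rewrite (le_trans (nrm_avg _ _ _ _)).
by rewrite linearB/= addrA subrK.
Qed.

Lemma nrm_dq2 h i phi : h != 0 -> N (dq h i phi) <= 2 / `|h| * N phi.
Proof.
move=> h0; rewrite /dq tLZ nrmZ normfV tLB mulrAC mulrC ler_pM2r ?invr_gt0 ?normr_gt0//.
by rewrite (le_trans (nrmB _ _))// nrm_tT mulr_natl mulr2n.
Qed.

(** An average absorbs one derivative at cost [2 / |h|], up to an error that disappears as [n] grows
    with [phi] fixed. *)
Lemma nrm_avg_dT n h i phi : (0 < n)%N -> h != 0 ->
  N (avg n h i (dT i phi)) <= 2 / `|h| * N phi + N (dT i phi - dq (h / n%:R) i phi).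
Proof.
move=> n0 h0.
rewrite (_ : avg _ _ _ _ = dq h i phi + avg n h i (dT i phi - dq (h / n%:R) i phi)).
  by rewrite tLD (le_trans (nrmD _ _))// lerD ?nrm_dq2 ?nrm_avg.
by rewrite linearB/= avg_dq_self// addrC subrK.
Qed.

(* [avgs] is applied with its adjoint to make [damp] positive, and twice along each
   axis to absorb the two derivatives of [lap]. *)
Definition damp n h phi : TF R d :=
  avgs n (- h) (enum 'I_d) (avgs n h (enum 'I_d) phi).

(** [damp] is [P] followed by its adjoint, and [P] commutes with [lap]; the pairing equals
    [|P phi|^2] plus the squared norm of the gradient of [P phi]. *)
Lemma ip_damp n h phi : '[phi, damp n h phi - lap (damp n h phi)] >=
  N (avgs n h (enum 'I_d) phi) ^+ 2.
Proof.
set P := avgs n h (enum 'I_d); rewrite tLB ipBr sqr_nrm.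
have dampE psi1 psi2 : '[psi1, damp n h psi2] = '[P psi1, P psi2].
  by rewrite /damp -{1}[h]opprK ipC ip_avgs opprK ipC opprK.
have lapP psi : lap (P psi) = P (lap psi).
  by rewrite /lap /P avgs_sum; apply: eq_bigr => i _; rewrite !dT_avgs.
have -> : lap (damp n h phi) = damp n h (lap phi).
  rewrite /damp -/P -lapP /lap avgs_sum.
  by apply: eq_bigr => i _; rewrite !dT_avgs.
rewrite !dampE lerDl -lapP oppr_ge0 -ip_lapC ip_lap oppr_le0.
by apply: sumr_ge0 => i _; exact: ip_ge0.
Qed.

(** Of all the averages in [damp] only the two along axis [i], of steps [h] and [- h], are kept;
    each absorbs one derivative. *)
Lemma nrm_dT2_damp n h i phi : (0 < n)%N -> h != 0 ->
  N (dT i (dT i (damp n h phi))) <=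
  2 / `|h| * (2 / `|h| * N phi + N (dT i phi - dq (h / n%:R) i phi)) +
  N (dT i (dT i phi) - dq (- h / n%:R) i (dT i phi)).
Proof.
move=> n0 h0; rewrite /damp !dT_avgs.
rewrite (le_trans (nrm_avgs_mem _ _ _ (mem_enum _ i)))//.
rewrite avg_avgs (le_trans (nrm_avgs_mem _ _ _ (mem_enum _ i)))//.
rewrite avg_comm -(dT_avg _ _ _ _ (dT i phi)).
rewrite (le_trans (nrm_avg_dT _ _ n0 _))// ?oppr_eq0// normrN.
rewrite lerD// ?ler_wpM2l ?nrm_avg_dT//.
by rewrite dT_avg -avg_dq -linearB nrm_avg.
Qed.

Lemma nrm_damp_le n h phi : N (damp n h phi) <= N phi.
Proof. by rewrite (le_trans (nrm_avgs _ _ _ _))// nrm_avgs. Qed.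

Lemma damp_bound h phi : 0 < h -> exists2 n, (0 < n)%N &
  N (damp n h phi - lap (damp n h phi)) <=
  (1 + d%:R * (2 / h * (2 / h))) * N phi + d%:R * (2 / h + 1).
Proof.
move=> h0; have hn0 : h != 0 by rewrite gt_eqF.
have nhn0 : - h != 0 by rewrite oppr_eq0.
have /choice[m1 Hm1] : forall i, exists n, forall m, (n <= m)%N ->
    N (dT i phi - dq (h / m%:R) i phi) <= 1.
  move=> i; have [n _ Hn] := avg_dT_cvg i phi hn0 ltr01.
  by exists n => m /Hn; rewrite -opprB tLN nrmN.
have /choice[m2 Hm2] : forall i, exists n, forall m, (n <= m)%N ->
    N (dT i (dT i phi) - dq (- h / m%:R) i (dT i phi)) <= 1.
  move=> i; have [n _ Hn] := avg_dT_cvg i (dT i phi) nhn0 ltr01.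
  by exists n => m /Hn; rewrite -opprB tLN nrmN.
(* [n] depends on [phi] and makes every error at most 1; the resulting constants depend only on [h]
   and [d]. *)
pose n := (\max_i maxn (m1 i) (m2 i)).+1.
have nm i : (maxn (m1 i) (m2 i) <= n)%N by rewrite leqW// (leq_bigmax i).
exists n => //.
rewrite tLB (le_trans (nrmB _ _))// mulrDl mul1r -addrA lerD ?nrm_damp_le//.
rewrite /lap tL_sum (le_trans (nrm_sum _ _))//.
rewrite -mulrA -mulrDr -[d in d%:R]card_ord -sum1_card natr_sum mulr_suml.
apply: ler_sum => i _; rewrite mul1r (le_trans (nrm_dT2_damp _ _ _ _))//.
rewrite (gtr0_norm h0) (_ : 2 / h * (2 / h) * N phi + (2 / h + 1) =
  2 / h * (2 / h * N phi + 1) + 1); last by ring.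
rewrite lerD//; last first.
  by apply: Hm2; rewrite (leq_trans (leq_maxr _ _) (nm i)).
rewrite ler_wpM2l ?divr_ge0 ?(ltW h0)// lerD//.
by rewrite Hm1// (leq_trans (leq_maxl _ _) (nm i)).
Qed.

(** For [phi] close to [u] and [r = damp phi - lap (damp phi)], orthogonality gives
    [|P phi|^2 <= <phi, r> = <phi - u, r>], while [|r|] is bounded in terms of [h] and [|u|]
    alone. *)
Lemma lap_perp_damped (u : L2T leb) h e :
  (forall phi, ip u (tL (phi - lap phi)) = 0) -> 0 < h -> 0 < e ->
  exists n phi, [/\ (0 < n)%N, nrm (u - tL phi) <= e &
    N (avgs n h (enum 'I_d) phi) <= e].
Proof.
move=> u0 h0 e0.
pose A := 1 + d%:R * (2 / h * (2 / h)); pose B := d%:R * (2 / h + 1).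
have A0 : 0 <= A.
  by rewrite addr_ge0// mulr_ge0// mulr_ge0// divr_ge0// ltW.
have B0 : 0 <= B by rewrite mulr_ge0// addr_ge0// divr_ge0// ltW.
have D0 : 0 < A * (nrm u + e) + B + 1.
  by rewrite ltr_wpDl// addr_ge0// mulr_ge0// addr_ge0 ?nrm_ge0// ltW.
(* The second entry makes [e'] times the bound on [|r|] at most [e ^+ 2]. *)
pose e' := Num.min e (e ^+ 2 / (A * (nrm u + e) + B + 1)).
have e'0 : 0 < e' by rewrite lt_min e0 divr_gt0 ?exprn_gt0.
have [phi uphi] := tf_dense u e'0.
have [n n0 Rn] := damp_bound phi h0.
exists n, phi; split=> //.
  by rewrite (le_trans (ltW uphi))// ge_min lexx.
have Nphi : N phi <= nrm u + e.
  rewrite -[tL phi](subrK u) addrC (le_trans (nrmD _ _))// lerD2l.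
  by rewrite -opprB nrmN (le_trans (ltW uphi))// ge_min lexx.
rewrite -(@ler_pXn2r _ 2)// ?nnegrE ?nrm_ge0 ?(ltW e0)//.
rewrite (le_trans (ip_damp n h phi))//.
set r := damp n h phi - _.
have -> : '[phi, r] = ip (tL phi - u) (tL r) by rewrite ipBl u0 subr0.
rewrite (le_trans (ip_le _ _))// -opprB nrmN.
have rle : nrm (tL r) <= A * (nrm u + e) + B + 1.
  rewrite (le_trans Rn)// -addrA lerD ?ler_wpM2l// lerDl//.
rewrite (le_trans (ler_pM (nrm_ge0 _) (nrm_ge0 _) (ltW uphi) rle))//.
by rewrite -ler_pdivlMr// ge_min lexx orbT.
Qed.

(** With [Q] the adjoint of [P], [<u, psi> = <u, psi - Q psi> + <u - phi, Q psi> + <P phi, psi>].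
    The first term is small with [h]; the others are small by the choice of [phi] and [n], made
    after [h]. *)
Lemma lap_separating (u : L2T leb) :
  (forall phi, ip u (tL (phi - lap phi)) = 0) -> nrm u = 0.
Proof.
move=> u0; apply: tf_separating => psi; apply/eqP; rewrite -normr_le0.
apply/ler_addgt0Pr => e e0; rewrite add0r.
pose D := \sum_(i <- enum 'I_d) N (dT i psi).
have D0 : 0 <= D by apply: sumr_ge0 => i _; exact: nrm_ge0.
(* Makes the first term at most [e / 3], since [Q] moves [psi] by at most [h * D]. *)
pose h := e / 3 / (nrm u * D + 1).
have uD : 0 < nrm u * D + 1 by rewrite ltr_wpDl// mulr_ge0// nrm_ge0.
have h0 : 0 < h by rewrite divr_gt0// divr_gt0.
have psi1 : 0 < N psi + 1 by rewrite ltr_wpDl// nrm_ge0.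
have c0 : 0 < e / 3 / (N psi + 1) by rewrite divr_gt0// divr_gt0.
have [n [phi [n0 uphi Pphi]]] := lap_perp_damped u0 h0 c0.
pose P := avgs n h (enum 'I_d); pose Q := avgs n (- h) (enum 'I_d).
have -> : ip u (tL psi) = ip u (tL (psi - Q psi)) + ip (u - tL phi) (tL (Q psi)) +
    '[P phi, psi].
  by rewrite ip_avgs -/(Q psi) tLB ipBr ipBl; ring.
have small (x : R) : 0 <= x -> x <= e / 3 / (N psi + 1) -> x * N psi <= e / 3.
  move=> x0 xe; rewrite (le_trans (_ : _ <= x * (N psi + 1)))//.
    by rewrite ler_wpM2l// lerDl.
  by rewrite -ler_pdivlMr.
rewrite (le_trans (ler_normD _ _))// (_ : e = e / 3 + e / 3 + e / 3); last by field.
rewrite lerD//; last first.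
  by rewrite (le_trans (normr_ip_le _ _))// small// nrm_ge0.
rewrite (le_trans (ler_normD _ _))// lerD//; last first.
  rewrite (le_trans (normr_ip_le _ _))// (le_trans (_ : _ <= nrm (u - tL phi) * N psi))//.
    by rewrite ler_wpM2l ?nrm_ge0// nrm_avgs.
  by rewrite small// nrm_ge0.
rewrite (le_trans (normr_ip_le _ _))// -opprB tLN nrmN.
rewrite (le_trans (ler_wpM2l (nrm_ge0 _) (nrm_avgsB _ _ _ n0)))// normrN gtr0_norm// -/D.
rewrite mulrCA; rewrite (le_trans (_ : _ <= h * (nrm u * D + 1)))//.
  by rewrite ler_wpM2l ?(ltW h0)// lerDl.
by rewrite /h divfK// gt_eqF.
Qed.

Lemma nrm_sub_lap phi : N phi <= N (phi - lap phi).
Proof.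
have H : N phi ^+ 2 <= '[phi - lap phi, phi].
  rewrite tLB ipBl sqr_nrm lerDl oppr_ge0 ip_lap oppr_le0.
  by apply: sumr_ge0 => i _; exact: ip_ge0.
have [->|p0] := eqVneq (N phi) 0; first exact: nrm_ge0.
have {}p0 : 0 < N phi by rewrite lt_def p0 nrm_ge0.
by rewrite -(ler_pM2r p0) -expr2 (le_trans H)// ip_le.
Qed.

(* For a pair [(g, w)] in the weak graph of the Laplacian, approximate [g - w] by
   [phi - lap phi]; these are dense by [lap_separating], and [nrm_sub_lap] makes
   [phi] converge. *)
Lemma lap_graph_dense (g w : L2T leb) :
  (forall phi, ip g (tL (lap phi)) = ip w (tL phi)) ->
  forall e, 0 < e -> exists phi, nrm (g - tL phi) < e /\ nrm (w - tL (lap phi)) < e.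
Proof.
move=> gw e e0; pose f := g - w.
have dense c : 0 < c -> exists phi, nrm (f - tL (phi - lap phi)) < c.
  move=> c0; have [] := @orthogonal_dense _ _ _ leb
    (range (fun phi => tL (phi - lap phi))) _ _ _ f c c0.
  - exists 0 => //; rewrite -[X in lap X](scale0r 0) lapZ scale0r subrr; exact: tL0.
  - move=> a _ _ [phi _ <-] [psi _ <-]; exists (a *: phi + psi) => //.
    rewrite lapD lapZ -tLZ -tLD; congr tL; apply: TFP => x.
    by rewrite !TFE; ring.
  - by move=> v v0; apply: lap_separating => phi; apply: v0; exists phi.
  - by move=> _ [phi _ <-] h; exists phi.
have half_gt0 n : 0 < (2^-1 : R) ^+ n / 2 by rewrite divr_gt0// exprn_gt0.
have /choice[phi Hphi] n := dense _ (half_gt0 n).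
have [g' Hg'] : exists g', forall n, nrm (g' - tL (phi n)) <= 2 * 2^-1 ^+ n.
  apply: L2T_complete => n; rewrite -tLB (le_trans (nrm_sub_lap _))//.
  rewrite lapB (_ : phi n.+1 - phi n - _ =
    (phi n.+1 - lap (phi n.+1)) - (phi n - lap (phi n))); last first.
    by apply: TFP => x; rewrite !TFE; ring.
  rewrite tLB (_ : _ - _ = (f - tL (phi n - lap (phi n))) -
      (f - tL (phi n.+1 - lap (phi n.+1)))); last first.
    by apply/LfuneqP => x; rewrite !L2TE; ring.
  rewrite (le_trans (nrmB _ _))// [leRHS]splitr lerD// ?(ltW (Hphi n))//.
  rewrite (le_trans (ltW (Hphi _)))// ler_wpM2r ?invr_ge0// exprS.
  by rewrite ler_piMl ?exprn_ge0// invf_le1// ler1n.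
(* The limit [g'] of the [phi n] satisfies the same equation weakly, so [g - g'] is orthogonal to
   every [psi - lap psi]. *)
have gg' : nrm (g - g') = 0.
  apply: lap_separating => psi; apply/eqP; rewrite -normr_le0.
  apply/ler_addgt0Pr => c c0; rewrite add0r.
  pose L := N (psi - lap psi) + N psi + 1.
  have L0 : 0 < L by rewrite ltr_wpDl// addr_ge0// nrm_ge0.
  have [n nc] := half_pow_lt (divr_gt0 c0 (mulr_gt0 (ltr0n R 2) L0)).
  have -> : ip (g - g') (tL (psi - lap psi)) =
     ip (f - tL (phi n - lap (phi n))) (tL psi) - ip (g' - tL (phi n)) (tL (psi - lap psi)).
    rewrite !ipBl !tLB !ipBr !ipBl gw ip_lapC; ring.
  rewrite (le_trans (ler_normB _ _))//.
  rewrite (le_trans (lerD (normr_ip_le _ _) (normr_ip_le _ _)))//.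
  have h1 := ltW (Hphi n); have h2 := Hg' n.
  have q0 : 0 < (2^-1 : R) ^+ n by rewrite exprn_gt0.
  have : 2^-1 ^+ n * (2 * L) <= c by rewrite -ler_pdivlMr ?mulr_gt0// ltW.
  have := nrm_ge0 (tL psi); have := nrm_ge0 (tL (psi - lap psi)).
  rewrite /L; move: h1 h2 q0; move: (2^-1 ^+ n) (nrm _) (nrm (g' - _)) (N psi) (N (psi - _)).
  move=> q a b s t h1 h2 q0 t0 s0 h.
  have := ler_wpM2r s0 h1; have := ler_wpM2r t0 h2; nra.
have [n ne] := half_pow_lt (divr_gt0 e0 (ltr0n R 4)).
have gphi : nrm (g - tL (phi n)) <= 2 * 2^-1 ^+ n.
  rewrite (_ : g - _ = (g - g') + (g' - tL (phi n))); last by rewrite addrA subrK.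
  by rewrite (le_trans (nrmD _ _))// gg' add0r.
have q0 : 0 < (2^-1 : R) ^+ n by rewrite exprn_gt0.
exists (phi n); split; first by rewrite (le_lt_trans gphi)//; move: ne; lra.
rewrite (_ : w - _ = (g - tL (phi n)) - (f - tL (phi n - lap (phi n)))); last first.
  by apply/LfuneqP => x; rewrite /f tLB !L2TE; ring.
rewrite (le_lt_trans (nrmB _ _))//.
by have := Hphi n; move: ne gphi; lra.
Qed.

End laplacian_density.

(** * The weak Laplacian *)

Section regularity.
Context (R : realType) (d : nat).
Implicit Types (phi psi : TF R d) (g w : L2T (lebesgue_rV R d)) (s : seq 'I_d).
Local Notation leb := (lebesgue_rV R d).
Local Notation "''[' phi , psi ]" := (ip (tL phi) (tL psi)).
Local Notation N phi := (nrm (tL phi)).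

Lemma eq_half_pow (a b K : R) : (forall n, `|a - b| <= K * 2^-1 ^+ n) -> a = b.
Proof.
move=> ab; apply/eqP; rewrite -subr_eq0 -normr_le0.
apply/ler_addgt0Pr => c c0; rewrite add0r.
have K0 : 0 < `|K| + 1 by rewrite ltr_wpDl.
have [n nc] := half_pow_lt (divr_gt0 c0 K0).
have q0 : 0 < (2^-1 : R) ^+ n by rewrite exprn_gt0.
rewrite (le_trans (ab n))// (le_trans (_ : _ <= (`|K| + 1) * 2^-1 ^+ n))//.
  by rewrite ler_wpM2r ?(ltW q0)// (le_trans (ler_norm _))// lerDl.
by rewrite mulrC -ler_pdivlMr// ltW.
Qed.

Definition dTs s phi : TF R d := foldr (@dT R d) phi s.

Lemma dTsE s phi : dTs s phi = partials s phi :> ('rV[R]_d -> R).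
Proof. by elim: s => //= i s <-. Qed.

Lemma dTs_rcons s i phi : dTs (rcons s i) phi = dTs s (dT i phi).
Proof. by rewrite /dTs foldr_rcons. Qed.

Lemma dTsB s phi psi : dTs s (phi - psi) = dTs s phi - dTs s psi.
Proof. by elim: s => //= i s IH; rewrite -dTB IH. Qed.

Lemma ip_dTs s phi psi :
  '[phi, dTs s psi] = (-1) ^+ size s * '[dTs (rev s) phi, psi].
Proof.
elim: s phi => [|i s IH] phi /=; first by rewrite expr0 mul1r.
rewrite ipC ip_dT ipC IH rev_cons dTs_rcons exprS; ring.
Qed.

(** Interpolation: [|D_i phi|^2 <= - <lap phi, phi> <= |lap phi| * |phi|]. *)
Lemma nrm_dT_le i phi : N (dT i phi) <= N phi + N (lap phi).
Proof.
rewrite -(@ler_pXn2r _ 2)// ?nnegrE ?addr_ge0 ?nrm_ge0//.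
have : N (dT i phi) ^+ 2 <= - '[lap phi, phi].
  rewrite ip_lap opprK (bigD1 i)//= sqr_nrm lerDl.
  by apply: sumr_ge0 => j _; exact: ip_ge0.
have := normr_ip_le (tL (lap phi)) (tL phi); rewrite ler_norml => /andP[+ _].
have := nrm_ge0 (tL phi); have := nrm_ge0 (tL (lap phi)); nra.
Qed.

(** By [ip_dT_mixed], [|lap phi|^2] is the sum over all [i] and [j] of [|D_j D_i phi|^2]; a single
    term is kept. *)
Lemma nrm_dT2_le i j phi : N (dT j (dT i phi)) <= N (lap phi).
Proof.
rewrite -(@ler_pXn2r _ 2)// ?nnegrE ?nrm_ge0// !sqr_nrm ip_dT_mixed.
rewrite /lap !tL_sum ip_suml (bigD1 j)//= ip_sumr (bigD1 i)//= -addrA lerDl.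
rewrite addr_ge0//; apply: sumr_ge0 => k _; first by rewrite -ip_dT_mixed ip_ge0.
by rewrite ip_sumr; apply: sumr_ge0 => m _; rewrite -ip_dT_mixed ip_ge0.
Qed.

Lemma nrm_dTs_le s phi : (size s <= 2)%N -> N (dTs s phi) <= N phi + N (lap phi).
Proof.
case: s => [|i [|j [|]]]//= _; first by rewrite lerDl nrm_ge0.
  exact: nrm_dT_le.
by rewrite (le_trans (nrm_dT2_le _ _ _))// lerDr nrm_ge0.
Qed.

Lemma Dmi_partials (a : 'I_d -> nat) : exists2 s, size s = mlength a &
  forall f : 'rV[R]_d -> R, Dmi a f = partials s f.
Proof.
exists (flatten [seq nseq (a i) i | i <- enum 'I_d]).
  rewrite size_flatten /shape -map_comp /mlength sumnE big_map big_enum/=.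
  by apply: eq_bigr => i _; rewrite /= size_nseq.
move=> f; rewrite /Dmi; elim: (enum 'I_d) => //= i l ->.
by rewrite /partials foldr_cat; elim: (a i) => //= n ->.
Qed.

Lemma Rintegral_ip g (f : 'rV[R]_d -> R) phi : f =1 phi ->
  \int[leb]_x (g x * f x) = ip g (tL phi).
Proof. by move=> fphi; rewrite ip_def; apply: eq_Rintegral => x _; rewrite fphi. Qed.

(** The Laplacian of [g] in the sense of distributions; unlike membership in [H2], it asks for no
    derivative of [g] taken alone. *)
Definition weak_lap g w := forall phi, ip g (tL (lap phi)) = ip w (tL phi).

Lemma weak_lap_approx g w : weak_lap g w -> exists phi : nat -> TF R d,
  forall n, nrm (g - tL (phi n)) <= 2^-1 ^+ n /\
            nrm (w - tL (lap (phi n))) <= 2^-1 ^+ n.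
Proof.
move=> gw.
have H n : exists phi, nrm (g - tL phi) <= 2^-1 ^+ n /\
    nrm (w - tL (lap phi)) <= 2^-1 ^+ n.
  have q0 : 0 < (2^-1 : R) ^+ n by rewrite exprn_gt0.
  by have [phi [h1 h2]] := lap_graph_dense gw q0; exists phi; rewrite !ltW.
by have [phi Hphi] := choice H; exists phi.
Qed.

(** Elliptic regularity. For test functions converging in the graph of the Laplacian, each
    derivative of order at most two is Cauchy by [nrm_dTs_le], and its limit is the weak
    derivative. *)
Lemma weak_lap_H2 g w : weak_lap g w -> H2 (g : 'rV[R]_d -> R).
Proof.
move=> gw; split; first exact: LfunP.
move=> a a2; have [s sz sE] := Dmi_partials a.
have [phi0 Hphi0] := weak_lap_approx gw.
(* The shift gains a factor 8, so that the increments of [g] and of the Laplacian together stay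
   below [2^-1 ^+ n]. *)
pose phi n := phi0 n.+3.
have Hphi n : nrm (g - tL (phi n)) <= 2^-1 ^+ n / 8 /\
    nrm (w - tL (lap (phi n))) <= 2^-1 ^+ n / 8.
  have := Hphi0 n.+3; rewrite !exprS (_ : 2^-1 * (2^-1 * (2^-1 * 2^-1 ^+ n)) =
    2^-1 ^+ n / 8 :> R)//; by field.
have step f (F : nat -> L2T leb) : (forall n, nrm (f - F n) <= 2^-1 ^+ n / 8) ->
    forall n, nrm (F n.+1 - F n) <= 2^-1 ^+ n / 4.
  move=> fF n; rewrite (_ : _ - _ = (f - F n) - (f - F n.+1)); last first.
    by apply/LfuneqP => x; rewrite !L2TE; ring.
  have q0 : 0 < (2^-1 : R) ^+ n by rewrite exprn_gt0.
  rewrite (le_trans (nrmB _ _))//; have := fF n; have := fF n.+1; rewrite exprS.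
  lra.
have sz2 : (size (rev s) <= 2)%N by rewrite size_rev sz.
have [h Hh] : exists h, forall n,
    nrm (h - tL (dTs (rev s) (phi n))) <= 2 * 2^-1 ^+ n.
  apply: L2T_complete => n; rewrite -tLB.
  have -> : dTs (rev s) (phi n.+1) - dTs (rev s) (phi n) =
      dTs (rev s) (phi n.+1 - phi n).
    by rewrite dTsB.
  have q0 : 0 < (2^-1 : R) ^+ n by rewrite exprn_gt0.
  rewrite (le_trans (nrm_dTs_le _ sz2))// lapB !tLB.
  have := step g (fun n => tL (phi n)) (fun n => (Hphi n).1) n.
  have := step w (fun n => tL (lap (phi n))) (fun n => (Hphi n).2) n.
  rewrite /=; lra.
exists (h : 'rV[R]_d -> R); first exact: LfunP.
move=> f /tfunP tf; pose psi := MkTF tf.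
rewrite (@Rintegral_ip g (Dmi a f) (dTs s psi)); last first.
  by move=> x; rewrite sE -[f]/(psi : 'rV[R]_d -> R) dTsE.
rewrite (@Rintegral_ip h f psi)// -sz.
apply: (@eq_half_pow _ _ (N (dTs s psi) + 2 * N psi)) => n.
have -> : ip g (tL (dTs s psi)) - (-1) ^+ size s * ip h (tL psi) =
    ip (g - tL (phi n)) (tL (dTs s psi)) -
    (-1) ^+ size s * ip (h - tL (dTs (rev s) (phi n))) (tL psi).
  by rewrite !ipBl ip_dTs; ring.
have q0 : 0 < (2^-1 : R) ^+ n by rewrite exprn_gt0.
rewrite (le_trans (ler_normB _ _))// normrM normrX normrN1 expr1n mul1r.
rewrite (le_trans (lerD (normr_ip_le _ _) (normr_ip_le _ _)))// mulrDl.
rewrite lerD//.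
  rewrite mulrC ler_wpM2l ?nrm_ge0// (le_trans (Hphi n).1)//; lra.
by rewrite mulrAC ler_wpM2r ?nrm_ge0.
Qed.

Lemma weak_derivative_spec a (f : 'rV[R]_d -> R) :
  (exists2 h, L2 h & is_weak_derivative a f h) ->
  L2 (weak_derivative a f) /\ is_weak_derivative a f (weak_derivative a f).
Proof.
move=> [h h1 h2]; rewrite /weak_derivative.
by case: xgetP => [_ -> //|/(_ h)[]].
Qed.

Lemma Dmi_diag i (f : 'rV[R]_d -> R) :
  Dmi (fun j => (2 * (j == i))%N) f = partial i (partial i f).
Proof.
pose F := fun (k : 'I_d) (u : 'rV[R]_d -> R) => iter (2 * (k == i)) (partial k) u.
rewrite /Dmi -/F.
have notin l : i \notin l -> foldr F f l = f.
  elim: l => //= k l IH; rewrite inE negb_or => /andP[ik /IH ->].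
  by rewrite /F eq_sym (negbTE ik) muln0.
have := enum_uniq 'I_d; have : i \in enum 'I_d by rewrite mem_enum.
elim: (enum 'I_d) => //= j l IH; rewrite inE => /orP[/eqP <-|il] /andP[jl ul].
  by rewrite notin// /F eqxx.
have ji : (j == i) = false by apply: contraNF jl => /eqP ->.
rewrite (IH il ul) /F ji muln0; reflexivity.
Qed.

Lemma mlength_diag i : mlength (fun j : 'I_d => (2 * (j == i))%N) = 2%N.
Proof.
rewrite /mlength (bigD1 i)//= eqxx big1 ?addn0// => j /negbTE ->.
by rewrite muln0.
Qed.

Lemma weak_laplacian_spec (f : 'rV[R]_d -> R) (fH2 : H2 f) :
  exists g w, [/\ (g : 'rV[R]_d -> R) = f, (w : 'rV[R]_d -> R) = weak_laplacian f &
    weak_lap g w].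
Proof.
have [fL2 fw] := fH2.
pose g : L2T leb := Lfun_Sub (lee1n 2) fL2.
have D i := weak_derivative_spec (fw _ (eq_leq (mlength_diag i))).
pose W i : L2T leb := Lfun_Sub (lee1n 2) (D i).1.
exists g, (\sum_i W i); split => //.
  apply/funext => x; rewrite /weak_laplacian.
  by elim/big_ind2 : _ => // a b c e <- <-.
move=> phi; rewrite /lap tL_sum ip_sumr ip_suml; apply: eq_bigr => i _.
have := (D i).2 phi (tf_test phi).
rewrite mlength_diag sqrrN expr1n mul1r.
rewrite (@Rintegral_ip g _ (dT i (dT i phi))); last by move=> x; rewrite Dmi_diag.
by rewrite (@Rintegral_ip (W i) _ phi).
Qed.

Lemma weak_lap_uniq g w w' : weak_lap g w -> weak_lap g w' -> nrm (w - w') = 0.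
Proof.
by move=> gw gw'; apply: tf_separating => phi; rewrite ipBl -gw -gw' subrr.
Qed.

End regularity.

(** * The spectrum of the Schroedinger operator *)

Section schrodinger_resolvent.
Context (R : realType) (d : nat) (theta : R) (V : 'rV[R]_d -> R) (M : R).
Hypotheses (theta0 : 0 < theta) (mV : measurable_fun setT V)
  (VM : forall x, `|V x| <= M).
Implicit Types (phi psi : TF R d) (f g w u : L2T (lebesgue_rV R d)).
Local Notation leb := (lebesgue_rV R d).
Local Notation N phi := (nrm (tL phi)).
Local Notation B := (schrodinger theta V).

Lemma mulV_Lfun f : (fun x => V x * f x) \in Lfun leb 2%:E.
Proof.
apply: (le_Lfun2 (g := M *: f)).
  by apply: measurable_funM => //; exact: measurable_L2T.
move=> x; rewrite L2TZ !normrM ler_wpM2r// (le_trans (VM x))//; exact: ler_norm.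
Qed.

Definition mulV f : L2T leb := Lfun_Sub (lee1n 2) (mulV_Lfun f).

Lemma mulVE f x : mulV f x = V x * f x. Proof. by []. Qed.

Lemma mulVD f g : mulV (f + g) = mulV f + mulV g.
Proof. by apply/LfuneqP => x; rewrite !(mulVE, L2TE); ring. Qed.

Lemma mulVZ a f : mulV (a *: f) = a *: mulV f.
Proof. by apply/LfuneqP => x; rewrite !(mulVE, L2TE); ring. Qed.

Lemma mulVN f : mulV (- f) = - mulV f.
Proof. by rewrite -scaleN1r mulVZ scaleN1r. Qed.

Lemma mulVB f g : mulV (f - g) = mulV f - mulV g.
Proof. by rewrite mulVD mulVN. Qed.

Lemma ip_mulVC f g : ip (mulV f) g = ip f (mulV g).
Proof. by rewrite !ip_def; apply: eq_Rintegral => x _; rewrite !mulVE; ring. Qed.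

Lemma M_ge0 : 0 <= M.
Proof. exact: le_trans (normr_ge0 (V 0)) (VM 0). Qed.

Lemma nrm_mulV f : nrm (mulV f) <= M * nrm f.
Proof.
have M0 := M_ge0.
rewrite -(ger0_norm M0) -nrmZ -(@ler_pXn2r _ 2)// ?nnegrE ?nrm_ge0//.
rewrite !sqr_nrm -lee_fin !ipE; apply: ge0_le_integral => //.
- by move=> x _; rewrite lee_fin sqr_ge0.
- exact/measurable_EFinP/measurable_funX/measurable_L2T.
- exact/measurable_EFinP/measurable_funX/measurable_L2T.
- move=> x _; rewrite lee_fin L2TZ !exprMn ler_wpM2r ?sqr_ge0//.
  by rewrite -(real_normK (num_real (V x))) lerXn2r ?nnegrE.
Qed.

(* The operator [B - l] on pairs [(g, Delta g)]. *)
Definition shifted l g w := - theta ^+ 2 *: w + mulV g - l *: g.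

Local Notation A l phi := (shifted l (tL phi) (tL (lap phi))).

Lemma shiftedB l g w g' w' :
  shifted l (g - g') (w - w') = shifted l g w - shifted l g' w'.
Proof.
rewrite /shifted mulVB.
by apply/LfuneqP => x; rewrite !L2TE; ring.
Qed.

Lemma shifted_tfB l phi psi : A l (phi - psi) = A l phi - A l psi.
Proof. by rewrite lapB !tLB shiftedB. Qed.

Lemma ip_shifted_tfC l phi psi : ip (A l phi) (tL psi) = ip (tL phi) (A l psi).
Proof.
by rewrite /shifted !(ipBl, ipDl, ipZl, ipBr, ipDr, ipZr) ip_mulVC ip_lapC.
Qed.

Lemma nrm_shifted l g w :
  nrm (shifted l g w) <= theta ^+ 2 * nrm w + (M + `|l|) * nrm g.
Proof.
rewrite /shifted (le_trans (nrmB _ _))// (le_trans (lerD (nrmD _ _) (lexx _)))//.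
rewrite !nrmZ normrN ger0_norm ?sqr_ge0// mulrDl addrA lerD// lerD//.
exact: nrm_mulV.
Qed.

(** The weak equation [(B - l) g = f] is solved for the Laplacian:
    [theta ^+ 2 w = V g - l g - f]. *)
Lemma weak_lap_shifted l g f : (forall psi, ip f (tL psi) = ip g (A l psi)) ->
  exists2 w, weak_lap g w & f = shifted l g w.
Proof.
move=> fg; have t0 : theta != 0 by rewrite gt_eqF.
exists ((theta ^+ 2)^-1 *: (mulV g - l *: g - f)).
  move=> psi; rewrite ipZl !ipBl ipZl fg /shifted.
  rewrite !(ipBr, ipDr, ipZr) ip_mulVC; field; exact: t0.
apply/LfuneqP => x; rewrite /shifted !L2TE; field; exact: t0.
Qed.

Lemma schrodinger_shifted h (hH2 : H2 h) : exists g w,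
  [/\ (g : 'rV[R]_d -> R) = h, weak_lap g w &
   forall l, (fun x => B h x - l * h x) = (shifted l g w : 'rV[R]_d -> R)].
Proof.
have [g [w [gE wE gw]]] := weak_laplacian_spec hH2; exists g, w; split => // l.
by apply/funext => x; rewrite /schrodinger /shifted !L2TE -wE -gE.
Qed.

Section coercive.
Context (l c : R).
Hypotheses (c0 : 0 < c)
  (coer : forall phi, c * N phi ^+ 2 <= ip (A l phi) (tL phi)).

Lemma coercive_tf phi : c * N phi <= nrm (A l phi).
Proof.
have [->|p0] := eqVneq (N phi) 0; first by rewrite mulr0 nrm_ge0.
have {}p0 : 0 < N phi by rewrite lt_def p0 nrm_ge0.
by rewrite -(ler_pM2r p0) -mulrA -expr2 (le_trans (coer phi))// ip_le.
Qed.

(** Both sides are continuous in the graph norm, in which test functions are dense. *)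
Lemma coercive_weak g w : weak_lap g w -> c * nrm g <= nrm (shifted l g w).
Proof.
move=> gw; have [phi Hphi] := weak_lap_approx gw.
rewrite -subr_le0; apply/ler_addgt0Pr => e e0; rewrite add0r.
pose K := c + (theta ^+ 2 + (M + `|l|)).
have K0 : 0 < K.
  by rewrite ltr_pwDl// addr_ge0 ?sqr_ge0// addr_ge0 ?M_ge0.
have [n ne] := half_pow_lt (divr_gt0 e0 K0).
have [h1 h2] := Hphi n.
have q0 : 0 < (2^-1 : R) ^+ n by rewrite exprn_gt0.
have a1 : nrm g <= N (phi n) + 2^-1 ^+ n.
  by rewrite -{1}[g](subrK (tL (phi n))) addrC (le_trans (nrmD _ _))// lerD2l.
have a2 : nrm (A l (phi n)) <= nrm (shifted l g w) + K * 2^-1 ^+ n - c * 2^-1 ^+ n.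
  rewrite (_ : A l (phi n) = shifted l g w -
    shifted l (g - tL (phi n)) (w - tL (lap (phi n)))); last first.
    by rewrite shiftedB opprB addrC subrK.
  rewrite (le_trans (nrmB _ _))// -addrA lerD2l (le_trans (nrm_shifted _ _ _))//.
  rewrite (_ : K * _ - _ = theta ^+ 2 * 2^-1 ^+ n + (M + `|l|) * 2^-1 ^+ n); last first.
    by rewrite /K; ring.
  rewrite lerD//.
    by rewrite ler_wpM2l ?sqr_ge0.
  by rewrite ler_wpM2l// addr_ge0 ?M_ge0.
have a3 := coercive_tf (phi n).
have a4 := ler_wpM2l (ltW c0) a1.
move: ne; rewrite ltr_pdivlMr// => /ltW; move: a2 a3 a4.
move: (2^-1 ^+ n) => q; lra.
Qed.

(** The images of test functions are dense: a vector orthogonal to them is a weak solution of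
    [(B - l) u = 0], null by [coercive_weak]. Coercivity makes the preimages of approximants
    converge, and [weak_lap_H2] puts the limit in the domain. *)
Lemma coercive_resolvent : resolvent_set (@H2 R d) B l.
Proof.
split.
- move=> f fL2; pose F : L2T leb := Lfun_Sub (lee1n 2) fL2.
  have dense e : 0 < e -> exists phi, nrm (F - A l phi) < e.
    move=> e0; have [] := @orthogonal_dense _ _ _ leb
      (range (fun phi => A l phi)) _ _ _ F e e0.
    + exists 0 => //; rewrite -[X in lap X](scale0r 0) lapZ scale0r tL0 /shifted.
      rewrite -[X in mulV X](scale0r 0) mulVZ !scale0r.
      by rewrite !scaler0 subr0 addr0.
    + move=> a _ _ [phi _ <-] [psi _ <-]; exists (a *: phi + psi) => //.
      rewrite lapD lapZ !tLD !tLZ /shifted mulVD mulVZ.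
      by apply/LfuneqP => x; rewrite !L2TE; ring.
    + move=> u u0; have uA psi : ip 0 (tL psi) = ip u (A l psi).
        by rewrite ip0l u0//; exists psi.
      have [w uw uE] := weak_lap_shifted uA.
      have := coercive_weak uw; rewrite -uE nrm0 pmulr_rle0// => u_le0.
      by apply/eqP; rewrite eq_le u_le0 nrm_ge0.
    + by move=> _ [phi _ <-] h; exists phi.
  have e_gt0 n : 0 < c * (2^-1 ^+ n / 2) by rewrite mulr_gt0// divr_gt0// exprn_gt0.
  have /choice[phi Hphi] n := dense _ (e_gt0 n).
  have [g Hg] : exists g, forall n, nrm (g - tL (phi n)) <= 2 * 2^-1 ^+ n.
    apply: L2T_complete => n; rewrite -tLB -(ler_pM2l c0).
    rewrite (le_trans (coercive_tf _))// shifted_tfB.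
    rewrite (_ : _ - _ = (F - A l (phi n)) - (F - A l (phi n.+1))); last first.
      by apply/LfuneqP => x; rewrite !L2TE; ring.
    rewrite (le_trans (nrmB _ _))//.
    have q0 : 0 < (2^-1 : R) ^+ n by rewrite exprn_gt0.
    have := Hphi n; have := Hphi n.+1; rewrite exprS.
    have := mulr_gt0 c0 q0; move: (2^-1 ^+ n) => q; lra.
  have FA psi : ip F (tL psi) = ip g (A l psi).
    apply: (@eq_half_pow _ _ _ (c / 2 * N psi + 2 * nrm (A l psi))) => n.
    rewrite (_ : _ - _ = ip (F - A l (phi n)) (tL psi) - ip (g - tL (phi n)) (A l psi)).
      rewrite (le_trans (ler_normB _ _))//.
      rewrite (le_trans (lerD (normr_ip_le _ _) (normr_ip_le _ _)))// mulrDl lerD//.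
        rewrite mulrAC ler_wpM2r ?nrm_ge0// (le_trans (ltW (Hphi n)))//; lra.
      by rewrite mulrAC ler_wpM2r ?nrm_ge0.
    by rewrite (ipBl F) (ipBl g) ip_shifted_tfC; ring.
  have [w gw FE] := weak_lap_shifted FA.
  have gH2 := weak_lap_H2 gw; exists (g : 'rV[R]_d -> R) => //.
  (* [schrodinger] works with chosen representatives of the weak derivatives, so its Laplacian [w']
     equals [w] only almost everywhere. *)
  have [g' [w' [g'E gw' AE]]] := schrodinger_shifted gH2.
  have g'g : g' = g by apply/LfuneqP => x; rewrite g'E.
  rewrite g'g in gw'.
  have : nrm (shifted l g w' - F) = 0.
    apply/eqP; rewrite eq_le nrm_ge0 andbT FE -shiftedB subrr.
    rewrite (le_trans (nrm_shifted _ _ _))// nrm0 mulr0 addr0.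
    by rewrite (weak_lap_uniq gw' gw) mulr0.
  move=> /nrm_eq0; apply: filterS => x /(_ I) /eqP.
  rewrite L2TD L2TN subr_eq0 => /eqP h.
  transitivity ((shifted l g' w' : 'rV[R]_d -> R) x); first by rewrite -AE.
  by rewrite g'g h.
- move=> h1 h2 h1H h2H h12.
  have [g1 [w1 [g1E gw1 A1]]] := schrodinger_shifted h1H.
  have [g2 [w2 [g2E gw2 A2]]] := schrodinger_shifted h2H.
  have gw : weak_lap (g1 - g2) (w1 - w2).
    by move=> phi; rewrite !ipBl gw1 gw2.
  have n0 : nrm (shifted l (g1 - g2) (w1 - w2)) = 0.
    rewrite -(@nrm0 _ _ _ leb); apply: eq_nrm; apply: filterS h12 => x h12 _.
    by rewrite shiftedB L2TD L2TN -A1 -A2 h12 subrr.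
  have := coercive_weak gw; rewrite n0 pmulr_rle0// => g_le0.
  have : nrm (g1 - g2) = 0 by apply/eqP; rewrite eq_le g_le0 nrm_ge0.
  move=> /nrm_eq0; apply: filterS => x /(_ I) /eqP.
  by rewrite L2TD L2TN subr_eq0 g1E g2E => /eqP.
- exists c^-1 => h hH.
  have [g [w [gE gw AE]]] := schrodinger_shifted hH.
  rewrite AE -gE !Lnorm2E -EFinM lee_fin ler_pdivlMl//.
  exact: coercive_weak.
Qed.

End coercive.

(* Let [g] solve [(B - l) g = phi], with [nrm g <= K * N phi]. Cauchy-Schwarz for the
   form [a] of [B - l] gives [N phi ^+ 4 = a(phi, g) ^+ 2 <= a(phi, phi) * ip phi g
   <= a(phi, phi) * K * N phi ^+ 2]; [g] is approximated by test functions. *)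
Lemma resolvent_coercive l : resolvent_set (@H2 R d) B l ->
  (forall phi, 0 <= ip (A l phi) (tL phi)) ->
  exists2 c, 0 < c & forall phi, c * N phi ^+ 2 <= ip (A l phi) (tL phi).
Proof.
move=> [surj _ [C hC]] A_ge0.
pose K : R := `|C| + 1; have K0 : 0 < K by rewrite ltr_wpDl.
exists K^-1; first by rewrite invr_gt0.
move=> phi; rewrite ler_pdivrMl//.
have [h hH hphi] := surj _ (LfunP (tL phi)).
have [g [w [gE gw AE]]] := schrodinger_shifted hH.
have gphi : nrm (shifted l g w - tL phi) = 0.
  rewrite -(@nrm0 _ _ _ leb); apply: eq_nrm; apply: filterS hphi => x hx _.
  by rewrite L2TD L2TN -AE hx subrr.
have gK : nrm g <= K * N phi.
  have := hC h hH; rewrite AE -gE !Lnorm2E -EFinM lee_fin => /le_trans; apply.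
  have -> : nrm (shifted l g w) = N phi.
    apply: eq_nrm; have := nrm_eq0 gphi; apply: filterS => x /(_ I) /eqP + _.
    by rewrite L2TD L2TN subr_eq0 => /eqP.
  by rewrite ler_wpM2r ?nrm_ge0// (le_trans (ler_norm _))// lerDl.
have CS psi : ip (A l phi) (tL psi) ^+ 2 <= ip (A l phi) (tL phi) * ip (A l psi) (tL psi).
  apply: (@sqr_form_le _ _ (fun phi psi => ip (A l phi) (tL psi))) => //.
  - by move=> x y; rewrite ip_shifted_tfC ipC.
  - move=> x y z; rewrite -ipDl; congr (ip _ _).
    rewrite lapD !tLD /shifted mulVD.
    by apply/LfuneqP => t; rewrite !L2TE; ring.
  - move=> a x y; rewrite -ipZl; congr (ip _ _).
    rewrite lapZ !tLZ /shifted mulVZ.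
    by apply/LfuneqP => t; rewrite !L2TE; ring.
have [psi Hpsi] := weak_lap_approx gw.
have [->|p0] := eqVneq (N phi) 0; first by rewrite expr0n/= mulr_ge0// ltW.
have {}p0 : 0 < N phi by rewrite lt_def p0 nrm_ge0.
rewrite -(ler_pM2r (exprn_gt0 2 p0)).
set a := ip (A l phi) (tL phi); set P := N phi in p0 gK *.
pose K' := theta ^+ 2 + (M + `|l|).
have K'0 : 0 <= K' by rewrite addr_ge0 ?sqr_ge0// addr_ge0 ?M_ge0.
have a0 : 0 <= a by exact: A_ge0.
apply/ler_addgt0Pr => e e0.
(* [D * 2^-1 ^+ n] bounds the total error of replacing [g] by [psi n] in [P ^+ 4 <= a * K * P ^+ 2]:
   the first term is the loss in the square, the second the excess in the form at [psi n]. *)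
pose D := 2 * P ^+ 3 * K' + a * (P + K' * K * P + K').
have D0 : 0 <= D.
  have P0 := ltW p0; have K0' := ltW K0.
  have t1 : 0 <= 2 * P ^+ 3 * K' by rewrite mulr_ge0// mulr_ge0// exprn_ge0.
  have t2 : 0 <= P + K' * K * P + K'.
    by apply: addr_ge0 => //; apply: addr_ge0 => //; rewrite !mulr_ge0.
  by rewrite addr_ge0// mulr_ge0.
have [n ne] := half_pow_lt (divr_gt0 e0 (ltr_wpDl D0 ltr01)).
have [h1 h2] := Hpsi n.
have q0 : 0 < (2^-1 : R) ^+ n by rewrite exprn_gt0.
have q1 : (2^-1 : R) ^+ n <= 1 by rewrite exprn_ile1// invf_le1// ler1n.
have dA : nrm (A l (psi n) - tL phi) <= K' * 2^-1 ^+ n.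
  rewrite (_ : _ - _ = (shifted l g w - tL phi) -
      shifted l (g - tL (psi n)) (w - tL (lap (psi n)))); last first.
    rewrite shiftedB; apply/LfuneqP => x; rewrite !L2TE; ring.
  rewrite (le_trans (nrmB _ _))// gphi add0r (le_trans (nrm_shifted _ _ _))//.
  by rewrite [leRHS]mulrDl lerD// ler_wpM2l ?sqr_ge0// addr_ge0 ?M_ge0.
have xE : `|ip (A l phi) (tL (psi n)) - P ^+ 2| <= P * (K' * 2^-1 ^+ n).
  rewrite ip_shifted_tfC sqr_nrm -ipBr (le_trans (normr_ip_le _ _))//.
  by rewrite ler_wpM2l ?nrm_ge0.
have yE : ip (A l (psi n)) (tL (psi n)) <= (P + K' * 2^-1 ^+ n) * (K * P + 2^-1 ^+ n).
  rewrite (le_trans (ip_le _ _))// ler_pM ?nrm_ge0//.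
    by rewrite -[A l (psi n)](subrK (tL phi)) addrC (le_trans (nrmD _ _))// lerD2l.
  rewrite -[tL (psi n)](subrK g) addrC (le_trans (nrmD _ _))// lerD//.
  by rewrite -opprB nrmN.
have := CS (psi n); rewrite -/a.
move: ne; rewrite ltr_pdivlMr ?ltr_wpDl// => /ltW; rewrite mulrDr mulr1 => ne.
have {}ne : 2^-1 ^+ n * D <= e by rewrite (le_trans _ ne)// lerDl ltW.
have := ler_wpM2l a0 yE.
move: xE ne q0 q1; rewrite /D ler_norml => /andP[xE _].
move: (2^-1 ^+ n) (ip _ _) (ip _ _) xE => q y x xE ne q0 q1 ay xx.
have xP : P ^+ 4 - 2 * P ^+ 3 * K' * q <= x ^+ 2.
  have P2 : 0 <= P ^+ 2 by rewrite sqr_ge0.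
  have h0 : 0 <= P ^+ 2 * ((x - P ^+ 2) + P * (K' * q)).
    by apply: mulr_ge0 => //; move: xE; lra.
  have h3 := sqr_ge0 (x - P ^+ 2).
  rewrite -subr_ge0 (_ : _ - _ = (x - P ^+ 2) ^+ 2 +
    2 * (P ^+ 2 * ((x - P ^+ 2) + P * (K' * q)))); last by ring.
  by rewrite addr_ge0// mulr_ge0.
have aq : a * K' * (q * q) <= a * K' * q.
  by rewrite ler_wpM2l ?mulr_ge0// ler_piMl// ltW.
have := le_trans xP (le_trans xx ay); nra.
Qed.

Definition form_bound l := forall phi, 0 <= ip (A l phi) (tL phi).

(** The point found is the supremum of the [l] for which the form of [B - l] is nonnegative. In the
    resolvent set, it could be increased by the gap from [resolvent_coercive]. *)
Lemma spectrum_bottom L : (forall phi, 0 <= ip (A 0 phi) (tL phi)) ->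
  (exists phi, ip (A L phi) (tL phi) < 0) ->
  exists2 l, spectrum (@H2 R d) B l & l <= L.
Proof.
move=> A0 [phi0 phi0L].
have shift l l' phi : ip (A l phi) (tL phi) =
    ip (A l' phi) (tL phi) + (l' - l) * N phi ^+ 2.
  by rewrite /shifted !(ipBl, ipDl, ipZl) sqr_nrm; ring.
pose S := [set l | form_bound l].
have ubS : ubound S L.
  move=> l Sl; rewrite leNgt; apply/negP => Ll.
  have := Sl phi0; rewrite (shift l L) leNgt => /negP; apply.
  rewrite (le_lt_trans _ phi0L)// gerDl mulr_le0_ge0 ?sqr_ge0//.
  by rewrite subr_le0 ltW.
have S0 : S 0 by [].
have supS : has_sup S by split; [exists 0|exists L].
exists (sup S); last exact: sup_le_ub (ex_intro _ _ S0) ubS.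
have Ssup : S (sup S).
  move=> phi; apply/ler_addgt0Pr => e e0.
  pose c := e / (N phi ^+ 2 + 1).
  have N1 : 0 < N phi ^+ 2 + 1 by rewrite ltr_wpDl// sqr_ge0.
  have c0 : 0 < c by rewrite divr_gt0.
  have [l Sl lc] := sup_adherent c0 supS.
  rewrite (shift _ l) (le_trans (Sl phi))// -addrA lerDl.
  have l1 : 0 <= sup S - l by rewrite subr_ge0; apply: sup_upper_bound.
  have l2 : sup S - l <= c by rewrite lerBlDr -lerBlDl ltW.
  have : (sup S - l) * (N phi ^+ 2) <= c * (N phi ^+ 2 + 1).
    by rewrite ler_pM ?sqr_ge0// lerDl.
  by rewrite divfK ?gt_eqF// -(opprB (sup S)) mulNr; lra.
move=> /resolvent_coercive/(_ Ssup)[c c0 hc].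
have : S (sup S + c).
  by move=> phi; rewrite (shift _ (sup S)); have := hc phi; lra.
by move=> /(sup_upper_bound supS); rewrite gerDl leNgt c0.
Qed.

End schrodinger_resolvent.

(** * The potential *)

Section potential.
Context (R : realType) (d : nat) (V : 'rV[R]_d -> R) (p : nat).
Hypotheses (V_ge0 : forall x, 0 <= V x) (V_smooth : smooth V)
  (V_periodic : Zd_periodic V) (p_gt1 : (2 <= p)%N)
  (V_coercive : uniformly_coercive V p)
  (V_isolated : critical_points V `<=` isolated (critical_points V)).
Implicit Types (x y m : 'rV[R]_d) (k : 'rV[int]_d).
Local Notation leb := (lebesgue_rV R d).
Local Notation N phi := (nrm (tL phi)).

Lemma periodicB x k : V (x - map_mx intr k) = V x.
Proof. by rewrite -{2}(subrK (map_mx intr k) x) V_periodic. Qed.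

Lemma integer_translate x : exists k, `|x - map_mx intr k| <= 1.
Proof.
exists (\row_i Num.floor (x ord0 i)); apply: rV_norm_le => // i; rewrite !mxE.
have /andP[h1 h2] := floor_itv (x ord0 i).
by rewrite ger0_norm ?subr_ge0// lerBlDr addrC ltW// -intrD1.
Qed.

Lemma potential_bounded : exists M, forall x, `|V x| <= M.
Proof.
have : compact [set x : 'rV[R]_d | `|x| <= 1].
  apply: bounded_closed_compact; first by apply/bounded_setP; exists 1.
  exact: closed_norm_le.
have cV := smooth_continuous V_smooth.
move=> /(continuous_compact (continuous_subspaceT cV))/compact_bounded/bounded_setP[M hM].
exists M => x; have [k xk] := integer_translate x.
by rewrite -(periodicB x k); apply: hM; exists (x - map_mx intr k).
Qed.

Lemma Dmi0 (f : 'rV[R]_d -> R) : Dmi (fun=> 0%N) f = f.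
Proof. by rewrite /Dmi; elim: (enum 'I_d) => //= i l ->. Qed.

Lemma critical_zero q m : critical_point V q m -> V m = 0.
Proof.
move=> [q0 /(_ (fun=> 0%N)) + _]; rewrite Dmi0; apply.
by rewrite /mlength big1.
Qed.

Lemma enorm_ge x : `|x| <= enorm x.
Proof.
apply: rV_norm_le => [|i]; first exact: sqrtr_ge0.
rewrite -sqrtr_sqr ler_wsqrtr// (bigD1 i)//= lerDl.
by apply: sumr_ge0 => j _; exact: sqr_ge0.
Qed.

Lemma inf_potential_ge0 : 0 <= inf (range V).
Proof. by apply: lb_le_inf => [|_ [x _ <-]]; [exists (V 0); exists 0|exact: V_ge0]. Qed.

(** [inf (range V) >= 0] lets coercivity apply to [V y <= t]; uniformity fixes the order to [p], and
    the sup norm is at most the Euclidean one. *)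
Lemma potential_sublevel : exists t0 K, [/\ 0 < t0, 1 <= K &
  forall t y, t <= t0 -> V y <= t ->
    exists2 m, critical_point V p m & `|y - m| <= K * t `^ p%:R^-1].
Proof.
have [[t0 [K [t00 K1 H]]] uniq_p] := V_coercive.
exists t0, K; split => // t y tt0 Vyt.
have [|q [m [_ cm ym]]] := H t y tt0.
  by rewrite (le_trans Vyt)// lerDl inf_potential_ge0.
move: (cm) ym; rewrite (uniq_p _ _ cm) => cpm ym.
by exists m => //; rewrite (le_trans (enorm_ge _)).
Qed.

(** Coercivity at [t = 0], where the radius around the critical point is 0. *)
Lemma zero_critical y : V y = 0 -> critical_point V p y.
Proof.
move=> Vy; have [t0 [K [t00 K1 H]]] := potential_sublevel.
have [|m cm] := H 0 y (ltW t00); first by rewrite Vy.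
rewrite powR0; last by rewrite invr_eq0 pnatr_eq0 -lt0n (leq_trans _ p_gt1).
by rewrite mulr0 normr_le0 subr_eq0 => /eqP ->.
Qed.

Lemma critical_exists : exists m, critical_point V p m.
Proof.
have [[t0 [K [t00 K1 H]]] uniq_p] := V_coercive.
have hinf : has_inf (range V).
  by split; [exists (V 0); exists 0|exists 0 => _ [x _ <-]; exact: V_ge0].
have [_ [y _ <-] /ltW Vy] := inf_adherent t00 hinf.
have [|q [m [_ cm _]]] := H t0 y (lexx _); first by rewrite addrC.
by exists m; rewrite -(uniq_p _ _ cm).
Qed.

(** Otherwise, by periodicity, pairs of distinct zeros at distance below [2^-1 ^+ n] exist with
    first member in the unit ball. Those first members cluster at a zero, which is an isolated
    critical point, yet its isolating ball contains both members of some pair. *)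
Lemma zeros_separated : exists2 s, 0 < s &
  forall m m', V m = 0 -> V m' = 0 -> `|m - m'| < s -> m = m'.
Proof.
apply: contrapT => nsep.
have H n : exists mm : 'rV[R]_d * 'rV[R]_d,
    [/\ V mm.1 = 0, V mm.2 = 0, `|mm.1 - mm.2| < 2^-1 ^+ n, `|mm.1| <= 1 & mm.1 <> mm.2].
  apply: contrapT => nmm; apply: nsep; exists (2^-1 ^+ n); first by rewrite exprn_gt0.
  move=> m m' Vm Vm' mm'; apply: contrapT => mNm'; apply: nmm.
  have [k mk] := integer_translate m.
  exists (m - map_mx intr k, m' - map_mx intr k); rewrite /= !periodicB.
  split=> //; first by rewrite opprB addrA subrK.
  by move=> /addIr.
have /choice[mm Hmm] := H.
have cpt : compact [set x : 'rV[R]_d | `|x| <= 1].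
  apply: bounded_closed_compact; first by apply/bounded_setP; exists 1.
  exact: closed_norm_le.
have [|x [x1 clx]] := cpt ((fun n => (mm n).1) @ \oo).
  by exists 0%N => // n _ /=; have [] := Hmm n.
have Vx : V x = 0.
  apply: contrapT => /eqP Vx0.
  have cV := smooth_continuous V_smooth.
  have oU : open [set y | V y != 0].
    by apply: (@open_comp _ _ V [set z | z != 0]) => [y _|]; [exact: cV|exact: open_neq].
  have [||y [yz yU]] := clx [set y | V y = 0] [set y | V y != 0].
  - by exists 0%N => // n _ /=; have [] := Hmm n.
  - exact: open_nbhs_nbhs.
  by move: yU; rewrite /= yz eqxx.
have [_ [U /nbhs_ballP[e /= e0 eU] Ux]] := V_isolated (ex_intro _ p (zero_critical Vx)).
have e20 : 0 < e / 2 by rewrite divr_gt0.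
have [n0 ne] := half_pow_lt e20.
have [||y [[n n0n <-] xy]] :=
    clx [set (mm n).1 | n in [set n | (n0 <= n)%N]] (ball x (e / 2)).
- by exists n0 => // n n0n; exists n.
- exact: nbhsx_ballx.
have [V1 V2 m12 _ m12n] := Hmm n.
have inU z : V z = 0 -> ball x e z -> z = x.
  move=> Vz xz; have : [set x] z by rewrite -Ux; split; [exact: eU|exists p; exact: zero_critical].
  by [].
apply: m12n; rewrite [LHS](inU _ V1) ?[RHS](inU _ V2)//.
  move: xy; rewrite !mx_norm_ball /ball_/= => xy.
  rewrite -(subrK (mm n).1 x) -addrA (le_lt_trans (ler_normD _ _))// [ltRHS]splitr ltrD//.
  rewrite (lt_trans m12)// (le_lt_trans _ ne)//.
  by rewrite ler_iXn2l// ?invf_lt1 ?ltr1n// invr_gt0.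
by apply: (le_ball _ xy); rewrite ler_pdivrMr// ler_peMr ?ler1n// ltW.
Qed.

(* A point of the sublevel set is within [K * t `^ p^-1] of a zero of [V]. If both
   [x] and its translate were such points, their zeros would be too close to be
   distinct, while for a common zero the translation is too long. *)
Lemma translate_out_of_sublevel : exists t0 K s, [/\ 0 < t0, 1 <= K, 0 < s &
  forall t (i : 'I_d) x, 0 < t -> t <= t0 -> 5 * (K * t `^ p%:R^-1) < s -> V x <= t ->
    t < V (x + (3 * (K * t `^ p%:R^-1)) *: delta_mx ord0 i)].
Proof.
have [t0 [K [t00 K1 H]]] := potential_sublevel; have [s s0 Hs] := zeros_separated.
exists t0, K, s; split=> // t i x tgt0 tt0; set r := K * _ => rs Vx.
have r0 : 0 < r by rewrite mulr_gt0 ?powR_gt0// (lt_le_trans ltr01).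
rewrite ltNge; apply/negP => Vxr.
have [m cm xm] := H t x tt0 Vx; have [m' cm' xm'] := H t _ tt0 Vxr.
have vn : `|(3 * r) *: (delta_mx ord0 i : 'rV[R]_d)| <= 3 * r.
  apply: rV_norm_le => [|j]; first by rewrite mulr_ge0// ltW.
  have r3 : 0 < 3 * r by rewrite mulr_gt0.
  rewrite !mxE eqxx normrM (gtr0_norm r3).
  by case: (_ == _); rewrite /= ?normr1 ?normr0 ?mulr1 ?mulr0// ltW.
(* The constant 5 is the two distances to zeros plus the translation [3 r]. *)
have mm' : m = m'.
  apply: Hs (critical_zero cm) (critical_zero cm') _.
  rewrite (_ : m - m' = (x + (3 * r) *: delta_mx ord0 i - m') - (x - m) -
      (3 * r) *: delta_mx ord0 i); last first.
    by apply/rowP => j; rewrite !mxE; ring.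
  rewrite (le_lt_trans (ler_normB _ _))// (le_lt_trans (lerD (ler_normB _ _) (lexx _)))//.
  by move: xm xm' vn rs; rewrite -/r; lra.
(* With a common zero, coordinate [i] would give [3 r <= 2 r]. *)
have := rV_norm_ge (x + (3 * r) *: delta_mx ord0 i - m') i.
have := rV_norm_ge (x - m) i; rewrite -mm' !mxE !eqxx mulr1.
move: xm xm'; rewrite -mm' -/r => h1 h2 h3 h4.
have := le_trans h3 h1; have := le_trans h4 h2.
by rewrite !ler_norml => /andP[_ h5] /andP[h6 _]; lra.
Qed.

Section poincare.
Context (M : R) (mV : measurable_fun setT V) (VM : forall x, `|V x| <= M).

(* Where [V x <= t], write [phi x] as [phi (x + rho e_i)] minus the increment: the
   first term is controlled by [V (x + rho e_i) > t], the second by the derivative. *)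
Lemma potential_poincare t rho i phi : 0 < t ->
  (forall x, V x <= t -> t < V (x + rho *: delta_mx ord0 i)) ->
  t * N phi ^+ 2 <= 3 * ip (mulV mV VM (tL phi)) (tL phi) +
    2 * t * rho ^+ 2 * N (dT i phi) ^+ 2.
Proof.
move=> t0 Ht; pose v : 'rV[R]_d := rho *: delta_mx ord0 i.
have mV' : measurable_fun setT (fun x => V (x + v)).
  exact: (measurableT_comp mV (measurable_translation v)).
have VM' x : `|V (x + v)| <= M by exact: VM.
have I1 := L2T_integrableM (t *: tL phi) (tL phi).
have I2 := L2T_integrableM (mulV mV VM (tL phi)) (tL phi).
have I3 := L2T_integrableM ((2 : R) *: mulV mV' VM' (tL (tT v phi))) (tL (tT v phi)).
have I4 := L2T_integrableM ((2 * t) *: tL (tT v phi - phi)) (tL (tT v phi - phi)).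
have ip3 : ip (mulV mV' VM' (tL (tT v phi))) (tL (tT v phi)) =
    ip (mulV mV VM (tL phi)) (tL phi).
  rewrite !ip_def; apply: (@Rintegral_translation R d (fun x => V x * phi x * phi x)).
  apply: measurable_funM; last exact: tf_measurable.
  by apply: measurable_funM => //; exact: tf_measurable.
have Nv : N (tT v phi - phi) ^+ 2 <= rho ^+ 2 * N (dT i phi) ^+ 2.
  rewrite -(real_normK (num_real rho)) -exprMn lerXn2r ?nnegrE ?mulr_ge0 ?nrm_ge0//.
  exact: nrm_tTB.
apply: (@le_trans _ _ (ip (mulV mV VM (tL phi)) (tL phi) +
    ip ((2 : R) *: mulV mV' VM' (tL (tT v phi))) (tL (tT v phi)) +
    ip ((2 * t) *: tL (tT v phi - phi)) (tL (tT v phi - phi)))).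
  rewrite sqr_nrm -ipZl !ip_def -RintegralD// -RintegralD//; last first.
    exact: (integrableD measurableT I2 I3).
  apply: le_Rintegral => //.
    exact: (integrableD measurableT (integrableD measurableT I2 I3) I4).
  move=> x _; rewrite !L2TZ !mulVE.
  rewrite -[tL phi x]/(phi x) -[tL (tT v phi) x]/(phi (x + v)).
  rewrite -[tL (tT v phi - phi) x]/(phi (x + v) - phi x).
  have h1 := V_ge0 x; have h2 := V_ge0 (x + v).
  have q1 := sqr_ge0 (phi x); have q2 := sqr_ge0 (phi (x + v)).
  have q3 := sqr_ge0 (phi (x + v) - phi x).
  have [Vx|Vx] := leP (V x) t.
    have Vxv := Ht _ Vx; rewrite -/v in Vxv.
    have e1 : 0 <= (V (x + v) - t) * phi (x + v) ^+ 2 by rewrite mulr_ge0// subr_ge0 ltW.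
    have e2 : 0 <= V x * phi x ^+ 2 by rewrite mulr_ge0.
    (* With [a = phi x] and [b = phi (x + v)]: [2 b^2 + 2 (b - a)^2 - a^2 = (2 b - a)^2]. *)
    have e3 : 0 <= t * (2 * phi (x + v) - phi x) ^+ 2 by rewrite mulr_ge0 ?sqr_ge0// ltW.
    nra.
  have e1 : 0 <= (V x - t) * phi x ^+ 2 by rewrite mulr_ge0// subr_ge0 ltW.
  have e2 : 0 <= V (x + v) * phi (x + v) ^+ 2 by rewrite mulr_ge0.
  have e3 : 0 <= t * (phi (x + v) - phi x) ^+ 2 by rewrite mulr_ge0// ltW.
  nra.
rewrite !ipZl ip3 -sqr_nrm.
have := ler_wpM2l (ltW t0) Nv; nra.
Qed.

End poincare.

End potential.

(** * Taylor bound and trial functions *)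

Section taylor.
Context (R : realType) (d : nat).
Implicit Types (u f : 'rV[R]_d -> R) (x m h : 'rV[R]_d) (l : seq 'I_d).
Local Notation e_ i := (delta_mx ord0 i : 'rV[R]_d).

(* All derivatives of [u] of order less than [q] along the axes in [l], in the order
   of [l], vanish at [m]. With this fixed order the Taylor bound follows one
   coordinate at a time, without symmetry of mixed derivatives. *)
Fixpoint vanishes m l u q : Prop :=
  if l is k :: l' then forall n, vanishes m l' (iter n (partial k) u) (q - n)%N
  else (0 < q)%N -> u m = 0.

Lemma smooth_bounded_near u m : smooth u ->
  exists C, forall h, `|h| <= 1 -> `|u (m + h)| <= C.
Proof.
move=> su.
have : compact [set x : 'rV[R]_d | `|x| <= `|m| + 1].
  apply: bounded_closed_compact; first by apply/bounded_setP; exists (`|m| + 1).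
  exact: closed_norm_le.
have cu := smooth_continuous su.
move=> /(continuous_compact (continuous_subspaceT cu))/compact_bounded/bounded_setP[C hC].
exists C => h h1; apply: hC; exists (m + h) => //=.
by rewrite (le_trans (ler_normD _ _))// lerD2l.
Qed.

(** Double induction on [l] and [q]. Setting coordinate [k] of [h] to 0 leaves a point handled by
    the rest of [l]; the mean value theorem restores it at the cost of [h_k] times [partial k u],
    which vanishes to order [q - 1]. *)
Lemma vanishes_bound m l u q : smooth u -> vanishes m l u q ->
  exists2 C, 0 <= C & forall h, (forall j, j \notin l -> h ord0 j = 0) ->
    `|h| <= 1 -> `|u (m + h)| <= C * `|h| ^+ q.
Proof.
elim: l u q => [|k l IHl] u q su.
  move=> /= uq; exists `|u m| => // h h0 _.
  have -> : h = 0 by apply/rowP => j; rewrite mxE h0.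
  rewrite addr0 normr0; case: q uq => [|q] uq; first by rewrite expr0 mulr1.
  by rewrite uq// normr0 mul0r.
elim: q u su => [|q IHq] u su vu.
  have [C hC] := smooth_bounded_near m su; exists `|C| => // h _ h1.
  by rewrite expr0 mulr1 (le_trans (hC h h1))// ler_norm.
have [C1 C10 H1] := IHl _ _ su (vu 0%N).
have [|C2 C20 H2] := IHq _ (smooth_partial k su).
  by move=> n; have := vu n.+1; rewrite iterSr subSS.
exists (C1 + C2) => [|h hl h1]; first exact: addr_ge0.
pose s := h ord0 k; pose h' := h - s *: e_ k.
have h'E t j : (h' + t *: e_ k) ord0 j = if j == k then t else h ord0 j.
  rewrite !mxE eqxx; case: eqVneq => [->|_]; last by rewrite !mulr0 subr0 addr0.
  by rewrite !mulr1 subrr add0r.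
have h'n t : `|t| <= `|s| -> `|h' + t *: e_ k| <= `|h|.
  move=> ts; apply: rV_norm_le => // j; rewrite h'E; case: ifP => _.
    by rewrite (le_trans ts)// rV_norm_ge.
  exact: rV_norm_ge.
have h'0 : h' + 0 *: e_ k = h' by rewrite scale0r addr0.
have h'h : `|h'| <= `|h| by rewrite -h'0 h'n// normr0.
have [t ts E] := partial_MVT (m + h') s (fun y => @smooth_derivable R d u k y su).
have uh : u (m + h) = u (m + h') + s * partial k u (m + (h' + t *: e_ k)).
  have -> : m + (h' + t *: e_ k) = m + h' + t *: e_ k by exact: addrA.
  have hk : m + h' + s *: e_ k = m + h by rewrite -[LHS]addrA subrK.
  by rewrite -E hk subrKC.
rewrite uh (le_trans (ler_normD _ _))// mulrDl lerD//.
  apply: le_trans (H1 h' _ _) _.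
  - move=> j jl; rewrite -h'0 h'E; case: eqVneq => // jk.
    by apply: hl; rewrite inE negb_or jk.
  - exact: le_trans h1.
  - by rewrite subn0 ler_wpM2l// lerXn2r ?nnegrE.
rewrite normrM exprS mulrCA ler_pM ?rV_norm_ge//.
apply: le_trans (H2 (h' + t *: e_ k) _ _) _.
- move=> j; rewrite inE negb_or => /andP[jk jl]; rewrite h'E (negbTE jk).
  by apply: hl; rewrite inE negb_or jk.
- by rewrite (le_trans (h'n _ ts)).
- by rewrite ler_wpM2l// lerXn2r ?nnegrE// h'n.
Qed.

(** [foldr] differentiates along the last index first, whereas [vanishes] starts from the head of
    the list; hence [rev]. *)
Lemma vanishes_Dmi m l u q : uniq l ->
  (forall a : 'I_d -> nat, (\sum_(i <- l) a i < q)%N ->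
    foldr (fun i v => iter (a i) (partial i) v) u l m = 0) ->
  vanishes m (rev l) u q.
Proof.
elim/last_ind: l u q => [|l k IH] u q; first by move=> _ /(_ (fun=> 0%N)); rewrite big_nil.
rewrite rcons_uniq rev_rcons /= => /andP[kl ul] H n; apply: IH => // a an.
pose a' j := if j == k then n else a j.
have := H a'; rewrite -cats1 big_cat big_seq1 foldr_cat /= /a' eqxx.
have -> : (\sum_(i <- l) (if i == k then n else a i) = \sum_(i <- l) a i)%N.
  rewrite [LHS]big_seq [RHS]big_seq; apply: eq_bigr => i il; case: eqVneq => // ik.
  by rewrite ik (negbTE kl) in il.
have -> : foldr (fun i v => iter (if i == k then n else a i) (partial i) v)
    (iter n (partial k) u) l =
  foldr (fun i v => iter (a i) (partial i) v) (iter n (partial k) u) l.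
  elim: l kl {ul H an} => //= i l IHl; rewrite inE negb_or => /andP[ki /IHl ->].
  by rewrite eq_sym (negbTE ki).
by apply; rewrite addnC -ltn_subRL.
Qed.

Lemma critical_point_bound f q m : smooth f -> critical_point f q m ->
  exists2 C, 0 <= C & forall h, `|h| <= 1 -> `|f (m + h)| <= C * `|h| ^+ q.
Proof.
move=> sf [_ Hf _].
have [|C C0 HC] := @vanishes_bound m (rev (enum 'I_d)) f q sf.
  apply: vanishes_Dmi; first exact: enum_uniq.
  by move=> a aq; apply: Hf; rewrite /mlength -big_enum.
exists C => // h h1; apply: HC => // j.
by rewrite mem_rev mem_enum.
Qed.

End taylor.

Section trial.
Context (R : realType) (d : nat) (r : R) (r0 : 0 < r).
Local Notation leb := (lebesgue_rV R d).
Local Notation N phi := (nrm (tL phi)).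

(** The bump parameter equals the half-width, so this is one profile rescaled by [r]: its height
    does not depend on [r], and its derivatives are of order [1 / r]. *)
Definition trial : TF R d := MkTF (bump_test (const_mx (- r)) (const_mx r) r0).

Lemma trial_supp x : trial x != 0 -> `|x| <= r.
Proof.
move=> /bump_supp xr; apply: rV_norm_le => [|i]; first exact: ltW.
by have := xr i; rewrite !mxE -ltr_norml => /ltW.
Qed.

Lemma trial_partial_supp i x : dT i trial x != 0 -> `|x| <= r.
Proof. exact: (partial_supp trial_supp). Qed.

(** The derivative is at most [4 / r], and its support, known only to lie in the closed box of
    half-width [r], is enclosed in an open one of half-width [2 r]. *)
Lemma trial_partial_le i : N (dT i trial) ^+ 2 <= (4 / r) ^+ 2 * (4 * r) ^+ d.
Proof.
rewrite sqr_nrm -lee_fin ipE.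
have := @sqr_integral_obox R d _ (4 / r) (const_mx (- (2 * r))) (const_mx (2 * r))
  (tf_measurable (dT i trial)) (fun x => normr_partial_bump _ _ i x r0).
under eq_bigr do rewrite !mxE.
rewrite big_const_ord iter_mulr_1 max_r; last by have := r0; lra.
rewrite (_ : 2 * r - - (2 * r) = 4 * r); last by ring.
apply => x /trial_partial_supp xr j; rewrite !mxE -ltr_norml.
by rewrite (le_lt_trans (le_trans (rV_norm_ge x j) xr))// ltr_pMl// ltr1n.
Qed.

Lemma bumpf_half_ge t : r / 2 <= t -> expR (- 2) <= bumpf r 0 t.
Proof.
move=> rt; have t0 : 0 < t by have := r0; lra.
rewrite /bumpf t0 expr0 mul1r ler_expR mulNr lerN2 ler_pdivrMr//; lra.
Qed.

(** On the concentric box of side [r] every distance to a face is at least [r / 2], so each factor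
    is at least [expR (- 2)]; there are two per coordinate, and the square doubles the exponent. *)
Lemma trial_ge : expR (- 8) ^+ d * r ^+ d <= N trial ^+ 2.
Proof.
pose a : 'rV[R]_d := const_mx (- (r / 2)); pose b : 'rV[R]_d := const_mx (r / 2).
have mab := measurable_obox a b.
rewrite sqr_nrm -lee_fin ipE.
apply: (@le_trans _ _ (\int[leb]_x (expR (- 8) ^+ d * \1_(obox a b) x)%:E)%E).
  under eq_integral do rewrite EFinM.
  rewrite ge0_integralZl//; last exact/measurable_EFinP/measurable_indic.
  rewrite integral_indic// setIT.
  have E : leb (obox a b) = (r ^+ d)%:E.
    rewrite lebesgue_rV_obox; congr EFin.
    under eq_bigr do rewrite !mxE opprK -splitr max_r ?(ltW r0)//.
    by rewrite prodr_const card_ord.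
  by rewrite EFinM -E; exact: lexx.
apply: ge0_le_integral => //.
- by apply/measurable_EFinP/measurable_funM => //; exact: measurable_indic.
- by apply/measurable_EFinP/measurable_funX; exact: measurable_L2T.
move=> x _; rewrite lee_fin indicE; case: (boolP (x \in obox a b)) => [/set_mem xab|_].
  rewrite mulr1 (_ : expR (- 8) = expR (- 4) ^+ 2); last first.
    by rewrite expr2 -expRD; congr expR; ring.
  rewrite exprAC lerXn2r ?nnegrE ?exprn_ge0 ?expR_ge0//; first exact: bump_ge0.
  rewrite -{1}(card_ord d) -prodr_const; apply: ler_prod => i _; rewrite expR_ge0/=.
  rewrite (_ : expR (- 4) = expR (- 2) * expR (- 2)); last first.
    by rewrite -expRD; congr expR; ring.
  have := xab i; rewrite !mxE => /andP[x1 x2].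
  by apply: ler_pM; rewrite ?expR_ge0//; apply: bumpf_half_ge; lra.
by rewrite mulr0 sqr_ge0.
Qed.

End trial.

(** * The two bounds *)

Section scale.
Context (R : realType) (p : nat).
Implicit Types (theta e : R).

(* [t = u ^+ p] is the energy scale and [u] the length scale: both terms of the
   form balance, [theta ^+ 2 / u ^+ 2 = u ^+ p]. *)
Lemma scaleP theta (u := theta `^ (2 / (p + 2)%:R)) : (0 < p)%N -> 0 < theta ->
  [/\ 0 < u, theta `^ ((2 * p)%:R / (p + 2)%:R) = u ^+ p, (u ^+ p) `^ p%:R^-1 = u &
      theta ^+ 2 = u ^+ p * u ^+ 2].
Proof.
move=> p0 theta0; have u0 : 0 < u by exact: powR_gt0.
have pR : p%:R != 0 :> R by rewrite pnatr_eq0 -lt0n.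
have p2R : (p + 2)%:R != 0 :> R by rewrite pnatr_eq0 addn2.
split=> //.
- rewrite -powR_mulrn ?(ltW u0)// -powRrM; congr (_ `^ _).
  by rewrite natrM mulrAC.
- by rewrite -powR_mulrn ?(ltW u0)// -powRrM divff// powRr1// ltW.
- by rewrite -exprD -(powR_mulrn (p + 2)) ?(ltW u0)// -powRrM divfK// powR_mulrn// ltW.
Qed.

Lemma near_scale_lt e : 0 < e -> \forall theta \near 0^'+, theta `^ (2 / (p + 2)%:R) < e.
Proof.
move=> e0; have a0 : 0 < 2 / (p + 2)%:R :> R by rewrite divr_gt0// ltr0n addn2.
have b0 : 0 < e `^ (2 / (p + 2)%:R)^-1 by exact: powR_gt0.
near=> theta; have theta0 : 0 < theta by near: theta; exact: nbhs_right_gt.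
have : theta < e `^ (2 / (p + 2)%:R)^-1 by near: theta; exact: nbhs_right_lt.
move=> /(gt0_ltr_powR a0); rewrite -powRrM mulVf ?gt_eqF// powRr1 ?(ltW e0)//.
by apply; rewrite nnegrE ltW.
Unshelve. all: by end_near. Qed.

End scale.

Section bounds.
Context (R : realType) (d : nat) (V : 'rV[R]_d -> R) (p : nat).
Hypotheses (V_ge0 : forall x, 0 <= V x) (V_smooth : smooth V)
  (V_periodic : Zd_periodic V) (p_gt1 : (2 <= p)%N)
  (V_coercive : uniformly_coercive V p)
  (V_isolated : critical_points V `<=` isolated (critical_points V)).
Local Notation leb := (lebesgue_rV R d).
Local Notation N phi := (nrm (tL phi)).

Lemma potential_measurable : measurable_fun setT V.
Proof. by apply: continuous_measurable_rV; exact: smooth_continuous. Qed.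

Local Notation mV := potential_measurable.

Section form.
Context (M theta : R) (VM : forall x, `|V x| <= M).

Local Notation A l phi := (shifted theta mV VM l (tL phi) (tL (lap phi))).
Local Notation Q phi := (ip (mulV mV VM (tL phi)) (tL phi)).

Lemma ip_shifted l phi : ip (A l phi) (tL phi) =
  theta ^+ 2 * (\sum_i N (dT i phi) ^+ 2) + Q phi - l * N phi ^+ 2.
Proof.
rewrite /shifted ipBl ipDl !ipZl ip_lap sqr_nrm mulrNN; congr (_ * _ + _ - _).
by apply: eq_bigr => i _; rewrite sqr_nrm.
Qed.

Lemma potential_form_ge0 phi : 0 <= Q phi.
Proof.
rewrite ip_def; apply: Rintegral_ge0 => x _.
by rewrite mulVE -mulrA mulr_ge0// -expr2 sqr_ge0.
Qed.

Lemma potential_form_le (C : R) (phi : TF R d) : (forall x, phi x != 0 -> V x <= C) ->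
  Q phi <= C * N phi ^+ 2.
Proof.
move=> VC; rewrite -subr_ge0 sqr_nrm -ipZl -ipBl ip_def; apply: Rintegral_ge0 => x _.
rewrite !(L2TE, mulVE) -mulrBl -mulrA -expr2.
have [phi0|/VC h] := eqVneq (phi x) 0; first by rewrite (phi0 : tL phi x = 0) expr0n mulr0.
by rewrite mulr_ge0 ?sqr_ge0// subr_ge0.
Qed.

Lemma shifted0_ge0 phi : 0 <= ip (A 0 phi) (tL phi).
Proof.
rewrite ip_shifted mul0r subr0 addr_ge0 ?potential_form_ge0// mulr_ge0 ?sqr_ge0//.
by apply: sumr_ge0 => i _; rewrite sqr_ge0.
Qed.

End form.

Lemma mu_B_ge theta (c : R) :
  (forall l, l < c -> resolvent_set (@H2 R d) (schrodinger theta V) l) ->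
  (c%:E <= mu_B V theta)%E.
Proof.
move=> cres; apply: le_ereal_inf_tmp => _ [l sl <-]; rewrite lee_fin leNgt.
by apply/negP => /cres.
Qed.

Lemma mu_B_lower : (0 < d)%N -> exists2 c : R, 0 < c &
  \forall theta \near 0^'+,
    ((c * theta `^ ((2 * p)%:R / (p + 2)%:R))%:E <= mu_B V theta)%E.
Proof.
move=> d0; pose i0 : 'I_d := Ordinal d0.
have p0 : (0 < p)%N by exact: ltn_trans p_gt1.
have [t0 [K [s [t00 K1 s0 escape]]]] :=
  translate_out_of_sublevel V_ge0 V_smooth V_periodic p_gt1 V_coercive V_isolated.
have [M VM] := potential_bounded V_smooth V_periodic.
have K0 : 0 < K by exact: lt_le_trans K1.
(* In [potential_poincare] with [rho = 3 K u], [2 t rho^2 = 18 K^2 theta^2] multiplies the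
   derivative and 3 the potential; the sum dominates both. *)
have c0 : 0 < 18 * K ^+ 2 + 3 by rewrite ltr_wpDl// mulr_ge0// sqr_ge0.
exists (18 * K ^+ 2 + 3)^-1; first by rewrite invr_gt0.
near=> theta; have theta0 : 0 < theta by near: theta; exact: nbhs_right_gt.
have [+ -> + theta2] := scaleP p0 theta0.
have u1 : theta `^ (2 / (p + 2)%:R) < 1 by near: theta; exact: near_scale_lt.
have ut : theta `^ (2 / (p + 2)%:R) < t0 by near: theta; exact: near_scale_lt.
have us : theta `^ (2 / (p + 2)%:R) < s / (5 * K).
  by near: theta; apply: near_scale_lt; rewrite divr_gt0// mulr_gt0.
move: u1 ut us theta2; set u := _ `^ _ => u1 ut us theta2 u0 uK.
have up0 : 0 < u ^+ p by exact: exprn_gt0.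
apply: mu_B_ge => l lc.
(* The form of [B] is at least the claimed bound times [|phi|^2], so that of [B - l] keeps the
   difference as its gap. *)
apply: (@coercive_resolvent R d theta V M theta0 mV VM l
  ((18 * K ^+ 2 + 3)^-1 * u ^+ p - l)); first by rewrite subr_gt0.
move=> phi; rewrite ip_shifted mulrBl lerB// mulrC mulrCA ler_pdivrMl//.
(* As [u < 1], [u ^+ p <= u]. *)
have upt : u ^+ p <= t0.
  rewrite (le_trans _ (ltW ut))// -[leRHS]expr1.
  by rewrite ler_wiXn2l ?ltW.
have := @potential_poincare R d V V_ge0 M mV VM (u ^+ p) (3 * (K * u)) i0 phi up0.
have Ku : 5 * (K * u) < s by rewrite mulrA mulrC -ltr_pdivlMr// mulr_gt0.
have := escape (u ^+ p) i0 _ up0 upt; rewrite uK => /(_ _ Ku) h /(_ h){h}.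
rewrite mulrC => /le_trans; apply.
have Q0 := potential_form_ge0 VM phi; set q := ip _ _ in Q0 *.
have : N (dT i0 phi) ^+ 2 <= \sum_i N (dT i phi) ^+ 2.
  by rewrite (bigD1 i0)//= lerDl sumr_ge0// => i _; exact: sqr_ge0.
rewrite theta2; set n := N _ ^+ 2; set S := \sum_i _ => nS.
have n0 : 0 <= n by exact: sqr_ge0.
have K20 : 0 <= K ^+ 2 by exact: sqr_ge0.
have u20 : 0 <= u ^+ 2 by exact: sqr_ge0.
set t := u ^+ p in up0 *.
have tS : t * u ^+ 2 * n <= t * u ^+ 2 * S by rewrite ler_wpM2l// mulr_ge0// ltW.
have tn : 0 <= t * u ^+ 2 * n by rewrite mulr_ge0// mulr_ge0// ltW.
have kS : K ^+ 2 * (t * u ^+ 2 * n) <= K ^+ 2 * (t * u ^+ 2 * S) by rewrite ler_wpM2l.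
have kq : 0 <= K ^+ 2 * q by rewrite mulr_ge0.
have -> : 2 * t * (3 * (K * u)) ^+ 2 * n = 18 * (K ^+ 2 * (t * u ^+ 2 * n)) by ring.
have -> : (18 * K ^+ 2 + 3) * (t * u ^+ 2 * S + q) =
  18 * (K ^+ 2 * (t * u ^+ 2 * S)) + 3 * (t * u ^+ 2 * S) + 18 * (K ^+ 2 * q) + 3 * q.
  by ring.
lra.
Unshelve. all: by end_near. Qed.

Lemma mu_B_upper :
  O_at0 (mu_B V) (fun theta => theta `^ ((2 * p)%:R / (p + 2)%:R)).
Proof.
have p0 : (0 < p)%N by exact: ltn_trans p_gt1.
have [m mcrit] := critical_exists V_ge0 V_coercive.
have [C C0 VC] := critical_point_bound V_smooth mcrit.
have [M VM] := potential_bounded V_smooth V_periodic.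
(* Bounds [u^2] times the squared gradient norm by [|phi|^2]: [d] axes, [16 * 4 ^+ d * u ^+ d] for
   each from [trial_partial_le], against [expR (- 8) ^+ d * u ^+ d] from [trial_ge]. *)
pose D : R := d%:R * (16 * 4 ^+ d / expR (- 8) ^+ d).
have e0 : 0 < expR (- 8) ^+ d :> R by rewrite exprn_gt0// expR_gt0.
have D0 : 0 <= D by rewrite !mulr_ge0// invr_ge0 ltW.
(* The extra 1 gives the strict inequality that [spectrum_bottom] demands. *)
exists (D + C + 1); near=> theta.
have theta0 : 0 < theta by near: theta; exact: nbhs_right_gt.
have [+ -> _ theta2] := scaleP p0 theta0.
have u1 : theta `^ (2 / (p + 2)%:R) < 1 by near: theta; exact: near_scale_lt.
move: u1 theta2; set u := _ `^ _ => u1 theta2 u0.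
have up0 : 0 < u ^+ p by exact: exprn_gt0.
(* Disposes of the absolute value in [O_at0]: for negative [l] the form of [B - l] has gap [- l]. *)
have mu0 : (0 <= mu_B V theta)%E.
  apply: mu_B_ge => l l0.
  apply: (@coercive_resolvent R d theta V M theta0 mV VM l (- l)); first by rewrite oppr_gt0.
  move=> phi; have := shifted0_ge0 theta VM phi.
  by rewrite !ip_shifted mul0r subr0 mulNr lerDr.
rewrite gee0_abs// (gtr0_norm up0).
pose phi := tT (- m) (trial d u0).
have N0 : 0 < N phi ^+ 2.
  by rewrite nrm_tT (lt_le_trans _ (trial_ge d u0))// mulr_gt0// exprn_gt0.
have [||l sl lL] := @spectrum_bottom R d theta V M mV VM ((D + C + 1) * u ^+ p).
- exact: shifted0_ge0.
- exists phi; rewrite ip_shifted.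
  have Qle : ip (mulV mV VM (tL phi)) (tL phi) <= C * u ^+ p * N phi ^+ 2.
    apply: potential_form_le => x xu; have {}xu : `|x - m| <= u by exact: trial_supp xu.
    rewrite -(subrKC m x) -[leLHS]ger0_norm// (le_trans (VC _ _))//.
      by rewrite (le_trans xu)// ltW.
    by rewrite ler_wpM2l// lerXn2r ?nnegrE// ltW.
  have Dle : u ^+ 2 * (\sum_i N (dT i phi) ^+ 2) <= D * N phi ^+ 2.
    apply: (@le_trans _ _ (u ^+ 2 * \sum_(i < d) ((4 / u) ^+ 2 * (4 * u) ^+ d))).
      rewrite ler_wpM2l ?sqr_ge0// ler_sum// => i _.
      by rewrite dT_tT nrm_tT trial_partial_le.
    rewrite sumr_const card_ord -[_ *+ d]mulr_natl mulrCA /D -(mulrA d%:R) ler_wpM2l//.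
    have -> : u ^+ 2 * ((4 / u) ^+ 2 * (4 * u) ^+ d) = 16 * 4 ^+ d * u ^+ d.
      by rewrite [(4 * u) ^+ d]exprMn; field; rewrite gt_eqF.
    rewrite nrm_tT -(mulrA (16 * _)).
    by rewrite ler_wpM2l ?mulr_ge0 ?exprn_ge0// ler_pdivlMl// trial_ge.
  rewrite theta2 -mulrA.
  have : u ^+ p * (u ^+ 2 * (\sum_i N (dT i phi) ^+ 2)) <= u ^+ p * (D * N phi ^+ 2).
    by rewrite ler_wpM2l// ltW.
  have : 0 < u ^+ p * N phi ^+ 2 by rewrite mulr_gt0.
  move: Qle; set q := ip _ _; set n := N phi ^+ 2; set t := u ^+ p; set S := u ^+ 2 * _.
  move=> Qle tn tS; have := Qle; have := tS; have := tn.
  rewrite (_ : C * t * n = C * (t * n)); last by ring.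
  rewrite (_ : t * (D * n) = D * (t * n)); last by ring.
  rewrite (_ : (D + C + 1) * t * n = D * (t * n) + C * (t * n) + t * n); last by ring.
  lra.
apply: (@le_trans _ _ l%:E); last by rewrite lee_fin.
by apply: ereal_inf_lbound; exists l.
Unshelve. all: by end_near. Qed.

End bounds.

Theorem proposition1p5 (R : realType) (d : nat) (V : 'rV[R]_d -> R) (p : nat)
    (hd : (1 <= d)%N)
    (V_ge0 : forall x, 0 <= V x)
    (V_smooth : smooth V)
    (V_periodic : Zd_periodic V)
    (hp : (2 <= p)%N)
    (V_coercive : uniformly_coercive V p)
    (V_isolated : critical_points V `<=` isolated (critical_points V)) :
  [/\ (d = 1%N \/ d = 2%N ->
        Omega_at0 (mu_B V) (fun theta => theta `^ ((2 * p)%:R / (p + 1)%:R))),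
      ((3 <= d)%N ->
        Omega_at0 (mu_B V) (fun theta => theta `^ ((2 * p)%:R / (p + 2)%:R))) &
      O_at0 (mu_B V) (fun theta => theta `^ ((2 * p)%:R / (p + 2)%:R))].
Proof.
have [c c0 muc] :=
  mu_B_lower V_ge0 V_smooth V_periodic hp V_coercive V_isolated hd.
split=> [_|_|]; last exact: (mu_B_upper V_ge0 V_smooth V_periodic hp V_coercive).
  exists c => //; near=> theta.
  have theta0 : 0 < theta by near: theta; exact: nbhs_right_gt.
  have theta1 : theta <= 1 by near: theta; exact: nbhs_right_le.
  apply: (@le_trans _ _ (c * theta `^ ((2 * p)%:R / (p + 2)%:R))%:E); last by near: theta.
  rewrite lee_fin ler_wpM2l// ?(ltW c0)// ger_powR ?theta0//.
  by rewrite ler_wpM2l// lef_pV2 ?posrE ?ltr0n ?addn1 ?addn2// ler_nat.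
by exists c.
Unshelve. all: by end_near. Qed.
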